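(* Let $n\ge2$, $t\in\mathbb{N}$. Suppose the following hold. (1) $A=A_0/\sqrt n$, where $A_0$ is a symmetric $n\times n$ random matrix and the entries of its upper triangle are independent mean $0$ random variables with $\max_{i,j\in[n]}|A_{0,ij}|\le K$ for some $K\ge2$. (2) For all $s\in[t],\ell\in[n]$, $\mathsf{F}_{s,\ell},\mathsf{G}_{s,\ell}\in C^3(\mathbb{R})$, and there exist $\Lambda\ge2$ and $\mathfrak p\in\mathbb{N}$ such that $$\max_{s\in[t]}\max_{\mathsf{E}_s\in\{\mathsf{F}_s,\mathsf{G}_s\}}\max_{\ell\in[n]}\Big\{\|\mathsf{E}_{s,\ell}\|_{\mathrm{Lip}}+\max_{q\in\{0,1,2,3\}}\big\|(1+|\cdot|)^{-\mathfrak p}|\mathsf{E}^{(q)}_{s,\ell}(\cdot)|\big\|_\infty\Big\}\le\Lambda.$$ Then for any $D>0$, there exist $C_0=C_0(D)>0$, a universal $c_0>0$ and another $c_1=c_1(\mathfrak p)>0$ such that if $t\le c_0^{-1}\log n$, then for all $i,j\in[n]$, $$\mathbb{P}\Big[\Big(\max_{k\ne i,j}\sqrt n+\max_k\Big)\,|\partial_{ij}z^{(t)}_k|\vee|\partial_{ij}^2z^{(t)}_k|\ \ge\ \big(C_0K\Lambda\log n\cdot(1+\|z^{(0)}\|_\infty)\big)^{c_1t^3}\,\Big|\,z^{(0)}\Big]\le c_0^t\cdot C_0n^{-D}.$$ Moreover, for any $p\ge1$ there exists a constant $C_p>0$ such that for all $i,j\in[n]$, $$\Big(\max_{k\ne i,j}\sqrt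 n+\max_k\Big)\,\mathbb{E}^{1/p}\big[|\partial_{ij}z^{(t)}_k|^p\,\big|\,z^{(0)}\big]\le\big(C_pK\Lambda\log n\cdot(1+\|z^{(0)}\|_\infty)\big)^{c_1t^3}.$$
   Context: Notation: $[n]=\{1,\dots,n\}$; $a\vee b=\max\{a,b\}$; $\|\cdot\|_{\mathrm{Lip}}$ is the Lipschitz constant; $\mathbb{E}^{1/p}[\cdot]=(\mathbb{E}[\cdot])^{1/p}$. For nonnegative numbers $(x_k)_{k\in[n]}$, $(\max_{k\ne i,j}\sqrt n+\max_k)x_k$ means $\sqrt n\max_{k\in[n]\setminus\{i,j\}}x_k+\max_{k\in[n]}x_k$ (a maximum over the empty set being $0$). Iterates: from $z^{(0)}\in\mathbb{R}^n$ independent of $A$, for $t=1,2,\dots$, $z^{(t)}=A\,\mathsf{F}_t(z^{(t-1)})+\mathsf{G}_t(z^{(t-1)})\in\mathbb{R}^n$, where $\mathsf{F}_t,\mathsf{G}_t:\mathbb{R}^n\to\mathbb{R}^n$ act coordinatewise, $(\mathsf{F}_t(z))_\ell=\mathsf{F}_{t,\ell}(z_\ell)$ and $(\mathsf{G}_t(z))_\ell=\mathsf{G}_{t,\ell}(z_\ell)$. $\partial_{ij}=\partial/\partial A_{ij}$ is the derivative of the iterate as a function of the symmetric matrix $A$, the entries $A_{ij}=A_{ji}$ being varied simultaneously, i.e. $\partial_{ij}A=(\mathbf{1}_{i\ne j}+\tfrac12\mathbf{1}_{i=j})(e_ie_j^\top+e_je_i^\top)$. *)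

(* Defs.v *)
From HB Require Import structures.
From mathcomp Require Import all_boot all_order all_algebra.
From mathcomp Require Import all_classical all_reals all_analysis.
From mathcomp Require Import measurable_realfun.

Set Implicit Arguments.
Unset Strict Implicit.
Unset Printing Implicit Defensive.

Import Order.TTheory GRing.Theory Num.Theory.
Import numFieldNormedType.Exports.

Local Open Scope classical_set_scope.
Local Open Scope ring_scope.

Section Probability.
Context {d : measure_display} {T : measurableType d} {R : realType}.
Variable P : probability T R.

Definition random_mx (m n : nat) (X : T -> 'M[R]_(m, n)) : Prop :=
  forall i j, measurable_fun setT (fun w => X w i j).

Definition sigma_mx (m n : nat) (X : T -> 'M[R]_(m, n)) : set (set T) :=
  g_sigma_preimage (fun k w => mxvec (X w) 0 k).

Definition indep_sigma (G H : set (set T)) : Prop :=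
  forall E F, G E -> H F -> P (E `&` F) = (P E * P F)%E.

Definition mutually_indep (I : finType) (D : {set I}) (X : I -> T -> R) : Prop :=
  forall (J : {set I}) (B : I -> set R), J \subset D ->
    (forall i, measurable (B i)) ->
    P [set w | forall i, i \in J -> B i (X i w)] =
    (\prod_(i in J) P (X i @^-1` B i))%E.

(* [g] is a version of E[f | G], for a sub-sigma-algebra [G] and [f >= 0];
   no integrability of [f] is required, so the values lie in [0, +oo]. *)
Definition is_cond_exp (G : set (set T)) (f g : T -> \bar R) : Prop :=
  [/\ forall B : set (\bar R), measurable B -> G (g @^-1` B),
      forall w, (0 <= g w)%E
    & forall E, G E -> (\int[P]_(w in E) g w = \int[P]_(w in E) f w)%E].

(* Some version of E[f | G]; versions agree almost surely. The default value
   +oo makes an upper bound on [cond_exp G f] false when no version exists. *)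
Definition cond_exp (G : set (set T)) (f : T -> \bar R) : T -> \bar R :=
  xget (cst +oo%E) [set g | is_cond_exp G f g].

Definition cond_prob (G : set (set T)) (E : set T) : T -> \bar R :=
  cond_exp G (fun w => (\1_E w)%:E).

End Probability.

Section Functions.
Context {R : realType}.

Definition class_C (k : nat) (f : R -> R) : Prop :=
  (forall q, (q < k)%N -> forall x, derivable (derive1n q f) x 1) /\
  continuous (derive1n k f).

Definition lip_norm (f : R -> R) : \bar R :=
  ereal_sup [set (`|f u.1 - f u.2| / `|u.1 - u.2|)%:E
            | u in [set u : R * R | u.1 != u.2]].

(* Sup norm of (1 + |.|)^(-p) |f|. *)
Definition weighted_norm (p : nat) (f : R -> R) : \bar R :=
  ereal_sup (range (fun x => ((1 + `|x|) ^- p * `|f x|)%:E)).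

Definition smooth_norm (p : nat) (f : R -> R) : \bar R :=
  (lip_norm f + \big[maxe/0]_(q < 4) weighted_norm p (derive1n q f))%E.

End Functions.

Section Iteration.
Context {R : realType} {n : nat}.
Implicit Types (A : 'M[R]_n) (z : 'cV[R]_n).

Definition coordwise (f : 'I_n -> R -> R) z : 'cV[R]_n :=
  \col_l f l (z l 0).

Fixpoint iterate (F G : nat -> 'I_n -> R -> R) z0 (t : nat) A : 'cV[R]_n :=
  match t with
  | 0 => z0
  | s.+1 => let z := iterate F G z0 s A in
            A *m coordwise (F s.+1) z + coordwise (G s.+1) z
  end.

Definition sym_dir (i j : 'I_n) : 'M[R]_n :=
  (if i == j then 2^-1 else 1) *: (delta_mx i j + delta_mx j i).

Definition partial_sym (i j : 'I_n) (f : 'M[R]_n -> R) : 'M[R]_n -> R :=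
  fun A => 'D_(sym_dir i j) f A.

Definition dz F G z0 (t : nat) (i j k : 'I_n) A : R :=
  partial_sym i j (fun B => iterate F G z0 t B k 0) A.

Definition d2z F G z0 (t : nat) (i j k : 'I_n) A : R :=
  partial_sym i j (partial_sym i j (fun B => iterate F G z0 t B k 0)) A.

Definition sup_norm z : R := \big[Num.max/0]_(k < n) `|z k 0|.

(* (max_{k <> i,j} sqrt n + max_k) x_k for nonnegative x *)
Definition weighted_max (i j : 'I_n) (x : 'I_n -> \bar R) : \bar R :=
  ((Num.sqrt n%:R)%:E * \big[maxe/0]_(k < n | (k != i) && (k != j)) x k
   + \big[maxe/0]_(k < n) x k)%E.

End Iteration.

(* Main.v *)
Require Import Defs.
From HB Require Import structures.
From mathcomp Require Import all_boot all_order all_algebra.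
From mathcomp Require Import all_classical all_reals all_analysis.
From mathcomp Require Import measurable_realfun ring lra zify.
Import Order.TTheory GRing.Theory Num.Theory.
Import numFieldNormedType.Exports.
Local Open Scope classical_set_scope.
Local Open Scope ring_scope.

Set Implicit Arguments.
Unset Strict Implicit.
Unset Printing Implicit Defensive.

(** The derivative of the iterate in the direction of the entry [(i, j)] obeys
    the recursion differentiated once, and its second derivative the recursion
    differentiated twice. Both recursions are linear with source terms, so the
    derivatives are sums of sources transported by the propagators of the
    linearised iteration. The sources are large only at [i] and [j], or are
    squares of such vectors. Everything therefore reduces to one fact about
    the propagators: their off-diagonal entries are smaller by a factor
    [1 / sqrt n] than their diagonal ones ([prop_evec_entry],
    [prop_col_entry]).

    That fact is deterministic on a good event. The matrix is good
    ([good_matrix]) when its operator norm is bounded and when each row [k]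
    pairs with finitely many explicit vectors as if it were independent of
    them; these vectors are computed from the matrix with row and column [k]
    deleted, so they are independent of the row. The entry [k] of a propagated
    vector is the pairing of row [k] with a vector that does depend on the
    row; the error made in replacing it by its left-out version is propagated
    as an invariant of the evolution ([coupled_step]). Summing the sources
    gives [derivative_bound]: at time [t > 0] both derivatives are at most a
    power of order [t ^ 2] of [lam * K * L * (1 + sup_norm z0)], with the
    required gain [1 / sqrt n] outside [i] and [j].

    Hoeffding's inequality, with coefficients that do not depend on the entries
    they multiply, makes each requirement fail with probability at most
    [2 * exp (- lam ^ 2 / 8)]; the operator norm is reduced to finitely many
    bilinear forms by a grid in the ball. The number of requirements is at most
    [8 * n ^ 2 * 4 ^ t], which is where the factor [c0 ^ t] comes from
    ([good_event]).

    Because the initial vector is independent of the matrix, the conditional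
    expectation is an expectation over the matrix for a frozen initial vector
    ([cond_exp_indep_le]), and the preceding estimates apply to each frozen
    value. For the tail estimate [lam ^ 2] is a multiple of [log n] depending
    on [D]. For the moments the good event alone does not suffice. However,
    every matrix with entries at most [K / sqrt n] is good at the level
    [lam = sqrt n] ([good_matrix_crude]), which bounds the derivatives almost
    surely by a further power of [n] of order [t ^ 2]; taking [lam ^ 2] of
    order [t ^ 2 * log n], the probability of the bad event compensates this
    power ([crude_tail]). The factor [t ^ 2] now inside [lam] is what the
    exponent [t ^ 3] absorbs ([moment_exponent]). *)

(** * Euclidean vectors *)

Section Euclid.
Context {R : realType} {n : nat}.
Implicit Types x y z : 'cV[R]_n.

Definition dot x y : R := \sum_k x k 0 * y k 0.
Definition nrm x : R := Num.sqrt (dot x x).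
Definition had x y : 'cV[R]_n := \col_k (x k 0 * y k 0).
Definition evec (i : 'I_n) : 'cV[R]_n := delta_mx i 0.

Lemma dotDl x y z : dot (x + y) z = dot x z + dot y z.
Proof. by rewrite /dot -big_split; apply: eq_bigr => k _; rewrite mxE mulrDl. Qed.

Lemma dotC x y : dot x y = dot y x.
Proof. by apply: eq_bigr => k _; rewrite mulrC. Qed.

Lemma dotDr x y z : dot x (y + z) = dot x y + dot x z.
Proof. by rewrite dotC dotDl !(dotC x). Qed.

Lemma dotZl a x y : dot (a *: x) y = a * dot x y.
Proof. by rewrite /dot mulr_sumr; apply: eq_bigr => k _; rewrite mxE mulrA. Qed.

Lemma dotZr a x y : dot x (a *: y) = a * dot x y.
Proof. by rewrite dotC dotZl dotC. Qed.

Lemma dot_ge0 x : 0 <= dot x x.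
Proof. by apply: sumr_ge0 => k _; rewrite -expr2 sqr_ge0. Qed.

Lemma nrm_ge0 x : 0 <= nrm x.
Proof. exact: sqrtr_ge0. Qed.

Lemma nrm_sqr x : nrm x ^+ 2 = dot x x.
Proof. by rewrite sqr_sqrtr ?dot_ge0. Qed.

Lemma nrm_sqrE x : nrm x ^+ 2 = \sum_k x k 0 ^+ 2.
Proof. by rewrite nrm_sqr; apply: eq_bigr => k _; rewrite expr2. Qed.

Lemma ler_nrm (c : R) x : 0 <= c -> dot x x <= c ^+ 2 -> nrm x <= c.
Proof. by move=> c0 h; rewrite -(@ler_pXn2r _ 2) ?nnegrE ?nrm_ge0 ?nrm_sqr. Qed.

Lemma dot_sqr_le x y : dot x y ^+ 2 <= dot x x * dot y y.
Proof.
have quad (s : R) : 0 <= dot x x - s * dot x y *+ 2 + s ^+ 2 * dot y y.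
  rewrite (_ : _ + _ = dot (x - s *: y) (x - s *: y)) ?dot_ge0 //.
  by rewrite -scaleNr !(dotDl, dotDr, dotZl, dotZr) (dotC y x); ring.
have [y0|y0] := eqVneq (dot y y) 0.
  have [->|xy0] := eqVneq (dot x y) 0; first by rewrite y0 mulr0 expr0n.
  have := quad ((dot x x + 1) / dot x y).
  rewrite y0 mulr0 addr0 divfK // => h; exfalso.
  have := dot_ge0 x; lra.
have yp : 0 < dot y y by rewrite lt_def y0 dot_ge0.
have := quad (dot x y / dot y y).
rewrite -(ler_pM2r yp) mul0r => h; rewrite -subr_ge0; apply: le_trans h _.
by rewrite le_eqVlt; apply/orP; left; apply/eqP; field.
Qed.

Lemma dot_cauchy x y : `|dot x y| <= nrm x * nrm y.
Proof.
rewrite -(@ler_pXn2r _ 2) ?nnegrE ?mulr_ge0 ?nrm_ge0 //.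
by rewrite -normrX ger0_norm ?sqr_ge0 // exprMn !nrm_sqr dot_sqr_le.
Qed.

Lemma nrmD x y : nrm (x + y) <= nrm x + nrm y.
Proof.
apply: ler_nrm; first by rewrite addr_ge0 ?nrm_ge0.
rewrite dotDl !dotDr (dotC y x) sqrrD !nrm_sqr.
have := le_trans (ler_norm _) (dot_cauchy x y); lra.
Qed.

Lemma nrmZ a x : nrm (a *: x) = `|a| * nrm x.
Proof.
by rewrite /nrm dotZl dotZr mulrA -expr2 sqrtrM ?sqr_ge0 // sqrtr_sqr.
Qed.

Lemma nrmN x : nrm (- x) = nrm x.
Proof. by rewrite -scaleN1r nrmZ normrN normr1 mul1r. Qed.

Lemma nrm0 : nrm (0 : 'cV[R]_n) = 0.
Proof. by rewrite -(scale0r 0) nrmZ normr0 mul0r. Qed.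

Lemma nrm_eq0 x : nrm x = 0 -> x = 0.
Proof.
move=> x0; apply/colP => k; rewrite mxE.
have := nrm_sqrE x; rewrite x0 expr0n /= => /esym/eqP.
rewrite psumr_eq0 => [|l _]; last exact: sqr_ge0.
by move=> /allP/(_ k (mem_index_enum _))/=; rewrite sqrf_eq0 => /eqP.
Qed.

Lemma nrm_le x y : (forall k, `|x k 0| <= `|y k 0|) -> nrm x <= nrm y.
Proof.
move=> h; apply: ler_nrm; first exact: nrm_ge0.
rewrite nrm_sqr; apply: ler_sum => k _; rewrite -!expr2.
by rewrite -(real_normK (num_real (x k 0))) -(real_normK (num_real (y k 0))) lerXn2r ?nnegrE.
Qed.

Lemma entry_nrm x k : `|x k 0| <= nrm x.
Proof.
rewrite -(@ler_pXn2r _ 2) ?nnegrE ?nrm_ge0 // nrm_sqrE real_normK ?num_real //.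
by rewrite (bigD1 k) //= lerDl sumr_ge0 // => l _; exact: sqr_ge0.
Qed.

Lemma nrm_le_const x (c : R) :
  0 <= c -> (forall k, `|x k 0| <= c) -> nrm x <= Num.sqrt n%:R * c.
Proof.
move=> c0 h; apply: ler_nrm; first by rewrite mulr_ge0 ?sqrtr_ge0.
rewrite exprMn sqr_sqrtr ?ler0n //.
have -> : n%:R * c ^+ 2 = \sum_(k < n) c ^+ 2.
  by rewrite sumr_const card_ord mulr_natl.
apply: ler_sum => k _; rewrite -expr2.
by rewrite -(real_normK (num_real (x k 0))) lerXn2r ?nnegrE.
Qed.

Lemma hadC x y : had x y = had y x.
Proof. by apply/colP => k; rewrite !mxE mulrC. Qed.

Lemma hadDr x y z : had x (y + z) = had x y + had x z.
Proof. by apply/colP => k; rewrite !mxE mulrDr. Qed.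

Lemma hadBl x y z : had (x - y) z = had x z - had y z.
Proof. by apply/colP => k; rewrite !mxE mulrBl. Qed.

Lemma hadZr a x y : had x (a *: y) = a *: had x y.
Proof. by apply/colP => k; rewrite !mxE mulrCA. Qed.

Lemma nrm_had x y (c : R) :
  (forall k, `|x k 0| <= c) -> nrm (had x y) <= c * nrm y.
Proof.
move=> h.
have [n0|n0] := posnP n.
  have e0 z : nrm z = 0.
    rewrite /nrm /dot big1 ?sqrtr0 // => k _; exfalso.
    by have := leq_ltn_trans (leq0n k) (ltn_ord k); rewrite n0.
  by rewrite !e0 mulr0.
have c0 : 0 <= c by apply: le_trans (h (Ordinal n0)).
rewrite -[c]ger0_norm // -nrmZ; apply: nrm_le => k.
by rewrite !mxE !normrM (ger0_norm c0) ler_wpM2r.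
Qed.

Lemma nrm_evec i : nrm (evec i) = 1.
Proof.
rewrite -[RHS]sqrtr1; congr Num.sqrt; rewrite /dot (bigD1 i) //=.
rewrite big1 => [|k /negPf ki]; last by rewrite !mxE ki mul0r.
by rewrite !mxE !eqxx mulr1 addr0.
Qed.

Lemma mulmx_evec (A : 'M[R]_n) i k : (A *m evec i) k 0 = A k i.
Proof.
rewrite mxE (bigD1 i) //= big1 => [|l /negPf li]; last by rewrite !mxE li mulr0.
by rewrite !mxE !eqxx mulr1 addr0.
Qed.

Lemma vec_sum x : x = \sum_l x l 0 *: evec l.
Proof.
apply/colP => k; rewrite summxE (bigD1 k) //= big1 => [|l lk].
  by rewrite !mxE !eqxx mulr1 addr0.
by rewrite !mxE eq_sym (negPf lk) mulr0.
Qed.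

Definition off (i : 'I_n) x : 'cV[R]_n := \col_k (if k == i then 0 else x k 0).

Lemma off_split i x : x = off i x + x i 0 *: evec i.
Proof.
apply/colP => k; rewrite !mxE; case: eqP => [->|_] /=.
  by rewrite mulr1 add0r.
by rewrite mulr0 addr0.
Qed.

Lemma had_split i x y :
  had x y = had x (off i y) + (x i 0 * y i 0) *: evec i.
Proof. by rewrite {1}(off_split i y) hadDr; congr (_ + _); apply/colP => k;
  rewrite !mxE; case: eqP => [->|_]; rewrite ?mulr1 ?mulr0. Qed.

Lemma hadBr x y z : had x (y - z) = had x y - had x z.
Proof. by rewrite -scaleN1r hadDr hadZr scaleN1r. Qed.

(** Cauchy-Schwarz: a row with entries of size [K / sqrt n] has norm [K]. *)
Lemma mulmx_row_le (A : 'M[R]_n) (K : R) v k : (0 < n)%N -> 0 <= K ->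
  (forall l, `|A k l| <= K / Num.sqrt n%:R) -> `|(A *m v) k 0| <= K * nrm v.
Proof.
move=> n0 K0 h.
have -> : (A *m v) k 0 = dot (row k A)^T v.
  by rewrite mxE; apply: eq_bigr => l _; rewrite !mxE.
apply: le_trans (dot_cauchy _ _) _; apply: ler_wpM2r; first exact: nrm_ge0.
apply: (le_trans (nrm_le_const (c := K / Num.sqrt n%:R) _ _)).
- by rewrite divr_ge0 ?sqrtr_ge0.
- by move=> l; rewrite !mxE.
- by rewrite mulrC divfK // gt_eqF // sqrtr_gt0 ltr0n.
Qed.

End Euclid.

(** * Leaving out one row and column *)

Section LeaveOneOut.
Context {R : realType} {n : nat}.
Implicit Types (A : 'M[R]_n) (v : 'cV[R]_n).

Definition loo (k : 'I_n) A : 'M[R]_n :=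
  \matrix_(a, b) (if (a == k) || (b == k) then 0 else A a b).

(** [A - loo k A] is the row [k] and the column [k] of [A]. The pairing with
    the row stays in the form [(A *m v) k 0], because it is often much smaller
    than its Cauchy-Schwarz bound. *)
Lemma loo_col A k v :
  A *m v - loo k A *m v =
  (A *m v) k 0 *: evec k + v k 0 *: off k (col k A).
Proof.
apply/colP => a; rewrite !mxE.
have [->|ak] /= := eqVneq a k.
  rewrite mulr1 mulr0 addr0 [X in _ - X]big1 ?subr0 // => b _.
  by rewrite !mxE eqxx mul0r.
rewrite mulr0 add0r -sumrB (bigD1 k) //= big1 => [|b bk].
  by rewrite !mxE eqxx orbT mul0r subr0 addr0 mulrC.
by rewrite !mxE (negPf ak) (negPf bk) subrr.
Qed.

Lemma nrm_loo_diff A k v (K : R) : (0 < n)%N -> 0 <= K ->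
  (forall a b, `|A a b| <= K / Num.sqrt n%:R) ->
  nrm (A *m v - loo k A *m v) <= `|(A *m v) k 0| + K * `|v k 0|.
Proof.
move=> n0 K0 h; rewrite loo_col; apply: le_trans (nrmD _ _) _.
rewrite !nrmZ nrm_evec mulr1 lerD2l mulrC ler_wpM2r //.
apply: (le_trans (nrm_le_const (c := K / Num.sqrt n%:R) _ _)).
- by rewrite divr_ge0 ?sqrtr_ge0.
- by move=> l; rewrite !mxE; case: eqP; rewrite ?normr0 ?divr_ge0 ?sqrtr_ge0.
- by rewrite mulrC divfK // gt_eqF // sqrtr_gt0 ltr0n.
Qed.

Lemma nrm_loo A k (b : R) : 0 <= b ->
  (forall v, nrm (A *m v) <= b * nrm v) ->
  forall v, nrm (loo k A *m v) <= b * nrm v.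
Proof.
move=> b0 h v; apply: (@le_trans _ _ (nrm (A *m off k v))).
  apply: nrm_le => a; rewrite !mxE.
  have [->|ak] := eqVneq a k.
    by rewrite big1 ?normr0 // => c _; rewrite !mxE eqxx mul0r.
  rewrite (_ : \sum_j loo k A a j * v j 0 = \sum_j A a j * off k v j 0) //.
  apply: eq_bigr => c _; rewrite !mxE (negPf ak) /=.
  by case: eqP; rewrite ?mul0r ?mulr0.
apply: le_trans (h _) _; apply: ler_wpM2l => //.
by apply: nrm_le => a; rewrite !mxE; case: eqP; rewrite ?normr0.
Qed.

End LeaveOneOut.

(** * The linearised iteration *)

(** What the iteration needs to know of its nonlinearities. The first
    derivative is bounded and the second one has polynomial growth, hence the
    local Lipschitz constant of the derivative. *)
Record tame {R : realType} (L : R) (p : nat) (f : R -> R) : Prop := Tame {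
  tame_lip : forall x y, `|f x - f y| <= L * `|x - y|;
  tame_at0 : `|f 0| <= L;
  tame_d1 : forall x, `|derive1 f x| <= L;
  tame_d1_lip : forall M x y, `|x| <= M -> `|y| <= M ->
    `|derive1 f x - derive1 f y| <= L * (1 + M) ^+ p * `|x - y|;
  tame_d2 : forall x, `|derive1 (derive1 f) x| <= L * (1 + `|x|) ^+ p }.

Lemma tame_growth {R : realType} (L : R) p f x :
  tame L p f -> `|f x| <= L * (1 + `|x|).
Proof.
case=> lip at0 _ _ _; rewrite -(subrK (f 0) (f x)).
apply: le_trans (ler_normD _ _) _.
have := lip x 0; rewrite subr0; lra.
Qed.

Section Dynamics.
Context {R : realType} {n : nat}.
Variables (F G : nat -> 'I_n -> R -> R) (z0 : 'cV[R]_n).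
Implicit Types (A : 'M[R]_n) (x y : 'cV[R]_n).

Definition state A s : 'cV[R]_n := iterate F G z0 s A.

Definition slope (E : nat -> 'I_n -> R -> R) A s : 'cV[R]_n :=
  \col_l derive1 (E s.+1 l) (state A s l 0).

Definition step A s x : 'cV[R]_n :=
  A *m had (slope F A s) x + had (slope G A s) x.

(** The propagator of the linearised iteration, started at time [s]. *)
Fixpoint prop A s m x : 'cV[R]_n :=
  if m is m'.+1 then step A (s + m') (prop A s m' x) else x.

Lemma stepD A s x y : step A s (x + y) = step A s x + step A s y.
Proof. by rewrite /step !hadDr mulmxDr addrACA. Qed.

Lemma stepZ A s a x : step A s (a *: x) = a *: step A s x.
Proof. by rewrite /step !hadZr -scalemxAr scalerDr. Qed.

Lemma propD A s m x y : prop A s m (x + y) = prop A s m x + prop A s m y.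
Proof. by elim: m => [|m ih] /=; rewrite ?ih ?stepD. Qed.

Lemma propZ A s m a x : prop A s m (a *: x) = a *: prop A s m x.
Proof. by elim: m => [|m ih] /=; rewrite ?ih ?stepZ. Qed.

Lemma prop0 A s m : prop A s m 0 = 0.
Proof. by have := propZ A s m 0 0; rewrite !scale0r. Qed.

Lemma prop_sum A s m (I : Type) (r : seq I) (f : I -> 'cV[R]_n) :
  prop A s m (\sum_(i <- r) f i) = \sum_(i <- r) prop A s m (f i).
Proof.
apply: (big_morph (prop A s m)); [exact: propD|exact: prop0].
Qed.

Lemma prop_first A s m x : prop A s m.+1 x = prop A s.+1 m (step A s x).
Proof.
elim: m => [|m ih]; first by rewrite /= addn0.
by rewrite [LHS]/= -/(prop A s m.+1 x) ih /= addnS.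
Qed.

Section Bounds.
Variables (K L lam : R) (p t : nat).

Record regime : Prop := Regime {
  regime_n : (0 < n)%N;
  regime_K : 2 <= K;
  regime_L : 2 <= L;
  regime_lam : 1 <= lam;
  regime_F : forall s l, (s < t)%N -> tame L p (F s.+1 l);
  regime_G : forall s l, (s < t)%N -> tame L p (G s.+1 l) }.

Definition op_bounded A := forall v, nrm (A *m v) <= 11 * lam * K * nrm v.

(** The coefficient vector [v] behaves, against row [k] of [A], as if it
    were independent of that row. *)
Definition row_small A k v :=
  `|(A *m v) k 0| <= lam * K / Num.sqrt n%:R * nrm v.

(** The three families of vectors are exactly those that the deterministic
    estimates pair with a row: the nonlinearity at the left-out iterate, and
    the left-out linear response to a perturbation placed at one coordinate or
    spread over one column. *)
Record good_matrix A : Prop := GoodMatrix {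
  good_entry : forall a b, `|A a b| <= K / Num.sqrt n%:R;
  good_op : op_bounded A;
  good_state : forall k s, (s < t)%N ->
    row_small A k (coordwise (F s.+1) (state (loo k A) s));
  good_evec : forall k i s m, (s + m < t)%N ->
    row_small A k (had (slope F (loo k A) (s + m))
                       (prop (loo k A) s m (evec i)));
  good_col : forall k i s m, (s + m < t)%N ->
    row_small A k (had (slope F (loo k A) (s + m))
                       (prop (loo k A) s m (loo k A *m evec i))) }.

Hypothesis reg : regime.

Let rt : R := Num.sqrt n%:R.
Let kap : R := lam * K * L.
Let the : R := 19 * kap.

Let n_gt0 := regime_n reg.
Let K_ge2 := regime_K reg.
Let L_ge2 := regime_L reg.
Let lam_ge1 := regime_lam reg.

Lemma regime_rt_ge1 : 1 <= rt.
Proof. by rewrite -[leLHS]sqrtr1 ler_wsqrtr // (ler_nat _ 1). Qed.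
Let rt_ge1 := regime_rt_ge1.

Let rt_gt0 : 0 < rt. Proof. exact: lt_le_trans ltr01 rt_ge1. Qed.

Let K0 : 0 <= K. Proof. exact: le_trans (ler0n _ 2) K_ge2. Qed.
Let L0 : 0 <= L. Proof. exact: le_trans (ler0n _ 2) L_ge2. Qed.
Let lam0 : 0 <= lam. Proof. exact: le_trans ler01 lam_ge1. Qed.

Let KL_kap : K * L <= kap.
Proof. by rewrite /kap -mulrA ler_peMl // mulr_ge0. Qed.

Let L_KL : 2 * L <= K * L. Proof. by rewrite ler_wpM2r. Qed.

Let lamK_kap : 2 * (lam * K) <= kap.
Proof. by rewrite /kap mulrC ler_wpM2l ?mulr_ge0. Qed.

Let kap0 : 0 <= kap. Proof. by rewrite !mulr_ge0. Qed.

Let kap_ge4 : 4 <= kap.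
Proof. by move: KL_kap L_KL L_ge2; lra. Qed.
Let L_kap : L <= kap. Proof. by move: KL_kap L_KL L0; lra. Qed.
Let the_ge1 : 1 <= the. Proof. by move: kap_ge4; rewrite /the; lra. Qed.

Lemma slopeF_le A s k : (s < t)%N -> `|slope F A s k 0| <= L.
Proof. by move=> st; rewrite mxE; apply: (tame_d1 (regime_F reg k st)). Qed.

Lemma slopeG_le A s k : (s < t)%N -> `|slope G A s k 0| <= L.
Proof. by move=> st; rewrite mxE; apply: (tame_d1 (regime_G reg k st)). Qed.

Lemma op_bounded_loo A k : op_bounded A -> op_bounded (loo k A).
Proof. by move=> h; apply: nrm_loo => //; rewrite !mulr_ge0. Qed.

Lemma nrm_step A s x : op_bounded A -> (s < t)%N ->
  nrm (step A s x) <= the * nrm x.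
Proof.
move=> opA st; apply: le_trans (nrmD _ _) _.
have h1 := nrm_had x (fun k => slopeF_le A k st).
have h2 := nrm_had x (fun k => slopeG_le A k st).
have h3 := opA (had (slope F A s) x).
have x0 := nrm_ge0 x.
have h4 : 11 * lam * K * nrm (had (slope F A s) x) <= 11 * kap * nrm x.
  by rewrite /kap -!mulrA !ler_wpM2l.
have h5 : L * nrm x <= kap * nrm x by rewrite ler_wpM2r.
have h6 : 0 <= kap * nrm x by rewrite mulr_ge0.
rewrite /the; lra.
Qed.

Lemma nrm_prop A s m x : op_bounded A -> (s + m <= t)%N ->
  nrm (prop A s m x) <= the ^+ m * nrm x.
Proof.
move=> opA; elim: m => [|m ih] smt; first by rewrite expr0 mul1r.
rewrite addnS in smt.
apply: le_trans (nrm_step _ opA smt) _.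
by rewrite exprS -mulrA ler_wpM2l ?ih ?(ltnW smt) //; move: the_ge1; lra.
Qed.

(** ** Size of the iterates *)

Section Good.
Variable A : 'M[R]_n.
Hypothesis A_good : good_matrix A.
Let A_le := good_entry A_good.
Let A_op := good_op A_good.

Lemma good_row v k : `|(A *m v) k 0| <= K * nrm v.
Proof. exact: mulmx_row_le. Qed.
Let rowK := good_row.

Let A_loo_op k : op_bounded (loo k A). Proof. exact: op_bounded_loo. Qed.

Variable zeta : R.
Hypothesis z0_le : forall l, 1 + `|z0 l 0| <= zeta.

Lemma nrm_coordwise_lip (E : nat -> 'I_n -> R -> R) s x y :
  (forall l, tame L p (E s l)) ->
  nrm (coordwise (E s) x - coordwise (E s) y) <= L * nrm (x - y).
Proof.
move=> h.
rewrite -[L]ger0_norm // -nrmZ; apply: nrm_le => k.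
by rewrite !mxE normrM ger0_norm //; apply: tame_lip (h k) _ _.
Qed.

(** The size of the iterate and its distance to the left-out iterates are
    bounded together. The operator norm alone would only bound [nrm] of the
    iterate; its entry [k] is bounded by comparison with the iterate without
    row [k], whose pairing with that row is small by [good_state]. *)
Lemma state_bound s : (s <= t)%N -> forall k l,
  1 + `|state A s l 0| + nrm (state A s - state (loo k A) s)
    <= the ^+ s * zeta.
Proof.
elim: s => [_ k l|s ih st k l].
  by rewrite /state /= subrr nrm0 addr0 expr0 mul1r.
have {}ih := ih (ltnW st).
set Q := the ^+ s * zeta in ih *.
have Fst l' := regime_F reg l' st; have Gst l' := regime_G reg l' st.
have Q1 : 1 <= Q.
  by have := ih k l; have := nrm_ge0 (state A s - state (loo k A) s);
     have := normr_ge0 (state A s l 0); lra.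
have Frow k' : `|(A *m coordwise (F s.+1) (state A s)) k' 0| <= 2 * kap * Q.
  set z := state A s; set z' := state (loo k' A) s.
  set d := nrm (z - z').
  have d0 : 0 <= d := nrm_ge0 _.
  have dF : nrm (coordwise (F s.+1) z - coordwise (F s.+1) z') <= L * d.
    exact: nrm_coordwise_lip.
  have h1 := rowK (coordwise (F s.+1) z - coordwise (F s.+1) z') k'.
  have h2 := good_state A_good k' st.
  have dQ : d <= Q.
    by have := ih k' k'; rewrite -/d; have := normr_ge0 (z k' 0); rewrite -/z; lra.
  have hF : nrm (coordwise (F s.+1) z) <= rt * (L * (Q - d)).
    apply: nrm_le_const => [|l']; first by rewrite mulr_ge0 ?subr_ge0.
    rewrite mxE; apply: le_trans (tame_growth _ (Fst l')) _.
    by rewrite ler_wpM2l //; have := ih k' l'; rewrite -/d -/z; lra.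
  have hF' : nrm (coordwise (F s.+1) z') <= rt * (L * Q).
    rewrite -[coordwise _ z'](subrK (coordwise (F s.+1) z)).
    apply: le_trans (nrmD _ _) _.
    have : L * d <= rt * (L * d) by rewrite ler_peMl // mulr_ge0.
    by rewrite -nrmN opprB; move: hF dF; lra.
  rewrite -[coordwise (F s.+1) z](subrK (coordwise (F s.+1) z')) mulmxDr mxE.
  apply: le_trans (ler_normD _ _) _.
  have h3 : lam * K / rt * nrm (coordwise (F s.+1) z') <= kap * Q.
    apply: (@le_trans _ _ (lam * K / rt * (rt * (L * Q)))).
      by rewrite ler_wpM2l // divr_ge0 ?(ltW rt_gt0) // mulr_ge0.
    by rewrite /kap le_eqVlt; apply/orP; left; apply/eqP; field; rewrite gt_eqF.
  move: h2; rewrite /row_small -/z' => h2.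
  have KLd : K * nrm (coordwise (F s.+1) z - coordwise (F s.+1) z') <= kap * Q.
    apply: (@le_trans _ _ (K * (L * Q))).
      by rewrite ler_wpM2l // (le_trans dF) // ler_wpM2l.
    by rewrite mulrA ler_wpM2r // (le_trans _ Q1).
  lra.
have Q0 : 0 <= Q by lra.
have kQ : kap <= kap * Q by rewrite ler_peMr.
have LQ : L * Q <= kap * Q by rewrite ler_wpM2r.
have z1 : `|state A s.+1 l 0| <= 3 * kap * Q.
  rewrite /state /= mxE; apply: le_trans (ler_normD _ _) _.
  have := Frow l; rewrite /state => {}Frow.
  have : `|coordwise (G s.+1) (iterate F G z0 s A) l 0| <= L * Q.
    rewrite mxE; apply: le_trans (tame_growth _ (Gst l)) _.
    rewrite ler_wpM2l //.
    by have := ih k l; have := nrm_ge0 (state A s - state (loo k A) s); rewrite /state; lra.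
  lra.
suff d1 : nrm (state A s.+1 - state (loo k A) s.+1) <= 14 * kap * Q.
  by rewrite exprS -mulrA -/Q /the; move: kap_ge4; lra.
set z := state A s; set z' := state (loo k A) s; set d := nrm (z - z').
have d0 : 0 <= d := nrm_ge0 _.
have -> : state A s.+1 - state (loo k A) s.+1 =
   (A *m coordwise (F s.+1) z - loo k A *m coordwise (F s.+1) z)
   + loo k A *m (coordwise (F s.+1) z - coordwise (F s.+1) z')
   + (coordwise (G s.+1) z - coordwise (G s.+1) z').
  rewrite /state /= -/(state A s) -/(state (loo k A) s) -/z -/z'.
  by rewrite mulmxBr subrKA opprD addrACA.
apply: le_trans (nrmD _ _) _; apply: le_trans (lerD (nrmD _ _) (lexx _)) _.
have h1 := nrm_coordwise_lip z z' Gst.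
have h2 := nrm_coordwise_lip z z' Fst.
have h3 := A_loo_op k (coordwise (F s.+1) z - coordwise (F s.+1) z').
have h4 : nrm (A *m coordwise (F s.+1) z - loo k A *m coordwise (F s.+1) z) <=
    2 * kap * Q + K * (L * (Q - d)).
  apply: (le_trans (nrm_loo_diff k _ n_gt0 K0 A_le)).
  apply: lerD (Frow k) _; apply: ler_wpM2l => //.
  rewrite mxE; apply: le_trans (tame_growth _ (Fst k)) _.
  by rewrite ler_wpM2l //; have := ih k k; rewrite -/d -/z; lra.
have h5 : nrm (loo k A *m (coordwise (F s.+1) z - coordwise (F s.+1) z')) <= 11 * kap * d.
  apply: le_trans h3 _; rewrite /kap.
  have -> : 11 * (lam * K * L) * d = 11 * lam * K * (L * d) by ring.
  by rewrite ler_wpM2l // !mulr_ge0.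
have dQ : d <= Q.
  by have := ih k k; rewrite -/d; have := normr_ge0 (z k 0); rewrite -/z; lra.
have Ld : L * d <= kap * Q.
  by apply: le_trans LQ; rewrite ler_wpM2l.
have kd : kap * d <= kap * Q by rewrite ler_wpM2l.
have KLQ : K * (L * (Q - d)) <= kap * (Q - d).
  by rewrite mulrA ler_wpM2r // subr_ge0.
rewrite -/d in h1; lra.
Qed.

End Good.
End Bounds.
End Dynamics.

(** * Entries of the propagator *)

Section Propagator.
Context {R : realType} {n : nat}.
Variables (F G : nat -> 'I_n -> R -> R) (z0 : 'cV[R]_n).
Variables (K L lam : R) (p t : nat).
Hypothesis reg : regime F G K L lam p t.
Implicit Types (x y : 'cV[R]_n).

Let rt : R := Num.sqrt n%:R.
Let kap : R := lam * K * L.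
Let the : R := 19 * kap.
Let K_ge2 := regime_K reg.
Let L_ge2 := regime_L reg.
Let lam_ge1 := regime_lam reg.
Let K0 : 0 <= K. Proof. exact: le_trans (ler0n _ 2) K_ge2. Qed.
Let L0 : 0 <= L. Proof. exact: le_trans (ler0n _ 2) L_ge2. Qed.
Let lam0 : 0 <= lam. Proof. exact: le_trans ler01 lam_ge1. Qed.
Let rt_gt0 : 0 < rt.
Proof. exact: lt_le_trans ltr01 (regime_rt_ge1 reg). Qed.
Let KL_kap : K * L <= kap.
Proof. by rewrite /kap -mulrA ler_peMl // mulr_ge0. Qed.
Let L_kap : 2 * L <= kap.
Proof. by apply: le_trans KL_kap; rewrite ler_wpM2r. Qed.
Let K_kap : 2 * K <= kap.
Proof. by apply: le_trans KL_kap; rewrite mulrC ler_wpM2l. Qed.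
Let lamK_kap : 2 * (lam * K) <= kap.
Proof. by rewrite /kap mulrC ler_wpM2l ?mulr_ge0. Qed.

Variable zeta : R.
Hypotheses (zeta_ge1 : 1 <= zeta) (z0_le : forall l, 1 + `|z0 l 0| <= zeta).

Let q : R := (the * zeta) ^+ t.+1.
Let U : R := the ^+ t.+1.
Let Q : R := the ^+ t * zeta.

Let the_ge : 76 <= the.
Proof. by rewrite /the; move: L_kap L_ge2; lra. Qed.
Let the_ge1 : 1 <= the. Proof. by move: the_ge; lra. Qed.
Let op_the : 11 * lam * K <= the.
Proof. by rewrite /the; move: lamK_kap L_kap L0; rewrite -!mulrA; lra. Qed.
Let op_ge0 : 0 <= 11 * lam * K. Proof. by rewrite !mulr_ge0. Qed.
Let the0 : 0 <= the. Proof. by move: the_ge; lra. Qed.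

Let the_q : the <= q.
Proof.
rewrite /q exprS -[leLHS]mulr1 ler_pM //.
  by rewrite ler_peMr.
by rewrite exprn_ege1 // mulr_ege1.
Qed.

Let q_ge : 76 <= q. Proof. exact: le_trans the_ge the_q. Qed.

Let q0 : 0 <= q. Proof. by move: q_ge; lra. Qed.
Let q1 : 1 <= q. Proof. by move: q_ge; lra. Qed.

Let U_q : U <= q.
Proof. by rewrite /U /q lerXn2r ?nnegrE ?mulr_ge0 ?ler_peMr // (le_trans ler01). Qed.

Let U1 : 1 <= U. Proof. exact: exprn_ege1. Qed.

Let Q_q : Q <= q.
Proof.
have z0' : 0 <= zeta := le_trans ler01 zeta_ge1.
rewrite /Q /q [(the * zeta) ^+ _]exprMn ler_pM ?exprn_ge0 //.
  by rewrite exprS ler_peMl // exprn_ge0.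
by rewrite exprS ler_peMr // exprn_ege1.
Qed.

Let Q0 : 0 <= Q.
Proof. by rewrite mulr_ge0 ?exprn_ge0 // (le_trans ler01). Qed.

Let kapU : kap * U <= q ^+ 2.
Proof.
have kq : kap <= q by apply: le_trans the_q; rewrite /the; move: L_kap L_ge2; lra.
by rewrite expr2 ler_pM // ?exprn_ge0 // !mulr_ge0.
Qed.

Section Good.
Variable A : 'M[R]_n.
Hypothesis A_good : good_matrix F G z0 K lam t A.

Lemma state_le s l : (s <= t)%N -> 1 + `|state F G z0 A s l 0| <= Q.
Proof.
move=> st; have := state_bound reg A_good z0_le st l l.
have : the ^+ s * zeta <= Q.
  by rewrite ler_wpM2r ?(le_trans ler01) // ler_weXn2l.
have := nrm_ge0 (state F G z0 A s - state F G z0 (loo l A) s).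
rewrite -/kap -/the; lra.
Qed.

(** The derivatives are Lipschitz on the range of the iterates, which
    [state_bound] controls in sup norm, and the left-out iterate is close to
    the iterate in Euclidean norm. *)
Lemma slope_loo (E : nat -> 'I_n -> R -> R) s k : (s < t)%N ->
  (forall l, tame L p (E s.+1 l)) ->
  nrm (slope F G z0 E A s - slope F G z0 E (loo k A) s) <= q ^+ p.+2.
Proof.
move=> st Et.
have zb := fun l => state_bound reg A_good z0_le (ltnW st) k l.
rewrite -/kap -/the in zb.
set z := state F G z0 A s in zb *; set z' := state F G z0 (loo k A) s in zb *.
have QQ : the ^+ s * zeta <= Q.
  by rewrite ler_wpM2r ?(le_trans ler01) // ler_weXn2l // ltnW.
set d := nrm (z - z') in zb.
have Lq : L <= q by apply: le_trans the_q; rewrite /the; move: L_kap L0; lra.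
have cp : 0 <= L * Q ^+ p by rewrite mulr_ge0 ?exprn_ge0.
have dQ : d <= Q by have := zb k; have := normr_ge0 (z k 0); lra.
apply: (@le_trans _ _ (L * Q ^+ p * d)).
  rewrite -[_ * Q ^+ p]ger0_norm // -nrmZ; apply: nrm_le => l.
  rewrite !mxE normrM (ger0_norm cp) -/z -/z'.
  have dl : `|z l 0 - z' l 0| <= d.
    by have := entry_nrm (z - z') l; rewrite !mxE.
  have := @tame_d1_lip _ _ _ _ (Et l) (Q - 1) (z l 0) (z' l 0).
  rewrite (addrC 1) subrK; apply.
    by have := zb l; have := nrm_ge0 (z - z'); rewrite -/d; lra.
  have : `|z' l 0| <= `|z l 0| + `|z l 0 - z' l 0|.
    by rewrite -[z' l 0](subKr (z l 0)) (le_trans (ler_normB _ _)) ?subKr.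
  have := zb l; lra.
apply: (@le_trans _ _ (L * Q ^+ p.+1)).
  by rewrite exprSr mulrA ler_wpM2l.
rewrite [q ^+ _]exprS ler_pM ?exprn_ge0 //.
by rewrite lerXn2r ?nnegrE.
Qed.

(** Invariant of the linear evolution at time [r]. The vector [x' k] is the
    evolution without row [k]; what is asked of [x - x' k] is not that it be
    small but that its future without row [k] pair weakly with row [k], a
    property that the next step can use at once. *)
Let coupled r i w x (x' : 'I_n -> 'cV[R]_n) :=
  (forall k, k != i -> `|x k 0| <= w / rt) /\
  (forall k, k != i -> forall m, (r + m < t)%N ->
    `|(A *m had (slope F G z0 F (loo k A) (r + m))
         (prop F G z0 (loo k A) r m (x - x' k))) k 0| <= w / rt).

(** The part of [x] away from [i] has small entries and is handled in
    Euclidean norm; the entry at [i] is large but multiplies [evec i], whose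
    left-out evolution is controlled by [good_evec] and [good_col]. *)
Lemma coupled_step r i w x (x' : 'I_n -> 'cV[R]_n) : (r < t)%N -> 1 <= w ->
  nrm x <= U -> coupled r i w x x' ->
  (forall k, k != i -> `|(A *m had (slope F G z0 F (loo k A) r) (x' k)) k 0|
     <= kap * U / rt) ->
  coupled r.+1 i (q ^+ (p + 7) * w) (step F G z0 A r x)
    (fun k => step F G z0 (loo k A) r (x' k)).
Proof.
move=> rt_t w1 xU [xw Gd] Hx'.
pose h := q ^+ p.+2.
have h1 : 1 <= h by rewrite exprn_ege1.
have q2 : 0 <= q ^+ 2 by rewrite exprn_ge0.
have w0 : 0 <= w by lra.
have wr0 : 0 <= w / rt by rewrite divr_ge0 // ltW.
have Kq : K <= q by apply: le_trans the_q; rewrite /the; move: K_kap L_kap L0; lra.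
have Lq : L <= q by apply: le_trans the_q; rewrite /the; move: L_kap L0; lra.
have bq : 11 * lam * K <= q := le_trans op_the the_q.
have LU : 2 * (L * U) <= q ^+ 2.
  apply: le_trans kapU; rewrite mulrA ler_wpM2r //; exact: le_trans ler01 U1.
have KU : 2 * (K * U) <= q ^+ 2.
  apply: le_trans kapU; rewrite mulrA ler_wpM2r //; exact: le_trans ler01 U1.
have KLU : K * L * U <= q ^+ 2.
  apply: le_trans kapU; rewrite ler_wpM2r //; exact: le_trans ler01 U1.
have aK := good_row reg A_good.
have eK k v : `|(A *m v) k 0| <= K * nrm v by apply: aK.
have xi : `|x i 0| <= U := le_trans (entry_nrm _ _) xU.
have oxw : forall l, `|off i x l 0| <= w / rt.
  by move=> l; rewrite mxE; case: eqP => [_|/eqP li]; rewrite ?normr0 ?xw.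
have dhad (E : nat -> 'I_n -> R -> R) k : (forall l, tame L p (E r.+1 l)) ->
    let d := slope F G z0 E A r - slope F G z0 E (loo k A) r in
    nrm (had d (off i x)) <= w / rt * h /\ `|d i 0 * x i 0| <= q ^+ 2.
  move=> Et d; split.
    rewrite hadC; apply: le_trans (nrm_had _ oxw) _.
    by rewrite ler_wpM2l // slope_loo.
  apply: le_trans LU; rewrite normrM mulrA ler_pM //.
  rewrite !mxE mulrC mulr_natr mulr2n; apply: le_trans (ler_normB _ _) _.
  by rewrite lerD // (tame_d1 (Et i)).
have invw : 0 <= rt^-1 by rewrite invr_ge0 ltW.
have hw1 : 1 <= h * w by rewrite mulr_ege1.
(* the pairing of row [k] with the current vector *)
have Y k : k != i ->
    `|(A *m had (slope F G z0 F A r) x) k 0| <= 5 * (q ^+ 2 * (h * w) / rt).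
  move=> ki.
  have [dF1 dF2] := dhad F k (fun l => regime_F reg l rt_t).
  set d := _ - _ in dF1 dF2.
  have -> : had (slope F G z0 F A r) x =
    had (slope F G z0 F (loo k A) r) (x' k)
    + had (slope F G z0 F (loo k A) r) (x - x' k)
    + had d (off i x) + (d i 0 * x i 0) *: evec i.
    by rewrite -addrA -had_split /d hadBl hadBr [X in X + _]addrC subrK addrC subrK.
  rewrite !mulmxDr -scalemxAr.
  rewrite [_ k 0]mxE [(_ + A *m had d _) k 0]mxE [(A *m had _ (x' k) + _) k 0]mxE.
  rewrite [(_ *: (A *m evec i)) k 0]mxE mulmx_evec.
  apply: le_trans (ler_normD _ _) _; rewrite normrM.
  apply: le_trans (lerD (ler_normD _ _) (lexx _)) _.
  apply: le_trans (lerD (lerD (ler_normD _ _) (lexx _)) (lexx _)) _.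
  have g0 := Gd k ki 0; rewrite addn0 in g0; have {}g0 := g0 rt_t; rewrite /= in g0.
  have g1 := Hx' k ki.
  have g2 : `|(A *m had d (off i x)) k 0| <= q * (w / rt * h).
    by apply: le_trans (eK _ _) _; rewrite ler_pM // nrm_ge0.
  have g3 : `|d i 0 * x i 0| * `|A k i| <= q ^+ 2 * (q / rt).
    rewrite ler_pM //; apply: le_trans (good_entry A_good k i) _.
    by rewrite ler_wpM2r.
  have e1 : kap * U / rt <= q ^+ 2 * (h * w) / rt.
    rewrite ler_wpM2r // (le_trans kapU) // ler_peMr //.
  have e2 : w / rt <= q ^+ 2 * (h * w) / rt.
    rewrite ler_wpM2r // mulrA ler_peMl // mulr_ege1 // exprn_ege1 //.
  have e3 : q * (w / rt * h) <= q ^+ 2 * (h * w) / rt.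
    rewrite (_ : q * (w / rt * h) = q * (h * w) / rt); last by ring.
    rewrite ler_wpM2r // ler_wpM2r ?(le_trans ler01) // expr2 ler_peMl //.
  have e4 : q ^+ 2 * (q / rt) <= q ^+ 2 * (h * w) / rt.
    rewrite mulrA ler_wpM2r // ler_wpM2l //.
    rewrite -[q]mulr1 ler_pM // /h exprS ler_peMr // exprn_ege1 //.
  have := lerD (lerD (lerD (le_trans g1 e1) (le_trans g0 e2)) (le_trans g2 e3))
    (le_trans g3 e4).
  set X := q ^+ 2 * _ / rt => sumX; apply: le_trans sumX _.
  have : 0 <= X := le_trans wr0 e2.
  by move: (X) => {}X; lra.
have big : 13 * q ^+ 4 * (h * w) <= q ^+ (p + 7) * w.
  rewrite mulrA ler_wpM2r //.
  have -> : (p + 7 = 1 + 4 + p.+2)%N := addnC p 7.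
  rewrite !exprD expr1 -/h.
  rewrite ler_wpM2r ?(le_trans ler01) // ler_wpM2r ?(exprn_ge0 _ q0) //.
  by move: q_ge; lra.
have sF k : `|slope F G z0 F A r k 0| <= q.
  by apply: le_trans (slopeF_le z0 reg A k rt_t) _.
have sG k : `|slope F G z0 G A r k 0| <= q.
  by apply: le_trans (slopeG_le z0 reg A k rt_t) _.
split=> [k ki|k ki m rmt].
  rewrite /step mxE; apply: le_trans (ler_normD _ _) _.
  have := Y k ki.
  have : `|had (slope F G z0 G A r) x k 0| <= q * (w / rt).
    by rewrite mxE normrM ler_pM // xw.
  have e1 : q * (w / rt) <= q ^+ 2 * (h * w) / rt.
    rewrite (mulrA q w) ler_wpM2r // expr2 -[q * q * _]mulrA ler_wpM2l //.
    by rewrite mulrA ler_peMl // mulr_ege1.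
  have e2 : 6 * q ^+ 2 * (h * w) / rt <= q ^+ (p + 7) * w / rt.
    rewrite ler_wpM2r // (le_trans _ big) // ler_wpM2r ?(le_trans ler01) //.
    apply: (@le_trans _ _ (13 * q ^+ 2)); first by move: q2; lra.
    by rewrite ler_wpM2l // ler_weXn2l.
  lra.
have -> : step F G z0 A r x - step F G z0 (loo k A) r (x' k) =
    step F G z0 (loo k A) r (x - x' k)
    + ((A *m had (slope F G z0 F A r) x - loo k A *m had (slope F G z0 F A r) x)
       + loo k A *m had (slope F G z0 F A r - slope F G z0 F (loo k A) r) x
       + had (slope F G z0 G A r - slope F G z0 G (loo k A) r) x).
  have cancel (u v a : 'cV[R]_n) : (u - v) + (a - u) = a - v.
    by rewrite addrC subrKA.
  by rewrite /step !hadBl !hadBr !mulmxBr subrKA addrACA !cancel opprD addrACA.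
have [dF1 dF2] := dhad F k (fun l => regime_F reg l rt_t).
have [dG1 dG2] := dhad G k (fun l => regime_G reg l rt_t).
set dF := _ - _ in dF1 dF2 *; set dG := slope F G z0 G A r - _ in dG1 dG2 *.
set Fx := had (slope F G z0 F A r) x.
pose Rm := A *m Fx - loo k A *m Fx + loo k A *m had dF (off i x)
  + had dG (off i x).
rewrite (had_split i dF) (had_split i dG) mulmxDr -scalemxAr.
set cF := dF i 0 * _ in dF2 *; set cG := dG i 0 * _ in dG2 *.
rewrite (_ : _ + _ + (had dG _ + _) = Rm + cF *: (loo k A *m evec i) + cG *: evec i);
  last first.
  rewrite /Rm -!addrA; congr (_ + (_ + (_ + _))); exact: addrCA.
pose phi y := (A *m had (slope F G z0 F (loo k A) (r.+1 + m))
                        (prop F G z0 (loo k A) r.+1 m y)) k 0.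
have phiD y1 y2 : phi (y1 + y2) = phi y1 + phi y2.
  by rewrite /phi propD hadDr mulmxDr mxE.
have phiZ a y : phi (a *: y) = a * phi y.
  by rewrite /phi propZ hadZr -scalemxAr mxE.
rewrite -/(phi _) (phiD (step F G z0 (loo k A) r (x - x' k))).
rewrite (phiD (Rm + _)) (phiD Rm) (phiZ cF) (phiZ cG).
have opl := op_bounded_loo reg k (good_op A_good).
have nhad y (c : R) : 0 <= c -> nrm (prop F G z0 (loo k A) r.+1 m y) <= c ->
    nrm (had (slope F G z0 F (loo k A) (r.+1 + m))
             (prop F G z0 (loo k A) r.+1 m y)) <= L * c.
  move=> c0 yc; apply: le_trans (nrm_had _ (fun l => slopeF_le z0 reg _ l rmt)) _.
  by rewrite ler_wpM2l.
have thm : the ^+ m.+1 <= U.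
  by rewrite ler_weXn2l // ltnS (leq_trans (leq_addl _ _) (ltnW rmt)).
have nprop y : nrm (prop F G z0 (loo k A) r.+1 m y) <= the ^+ m * nrm y.
  by apply: (nrm_prop _ reg _ opl (ltnW rmt)).
have thm0 : 0 <= the ^+ m by rewrite exprn_ge0.
have phi1 : `|phi (step F G z0 (loo k A) r (x - x' k))| <= w / rt.
  by rewrite /phi -prop_first addSnnS; apply: Gd; rewrite // -addSnnS.
have phiR : `|phi Rm| <= q ^+ 2 * nrm Rm.
  apply: le_trans (eK _ _) _; apply: (@le_trans _ _ (K * (L * (U * nrm Rm)))).
    rewrite ler_wpM2l // nhad // ?mulr_ge0 ?nrm_ge0 ?(le_trans ler01 U1) //.
    apply: le_trans (nprop _) _; rewrite ler_wpM2r ?nrm_ge0 //.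
    by apply: le_trans thm; rewrite ler_weXn2l.
  by rewrite !mulrA ler_wpM2r // nrm_ge0.
have lK0 : 0 <= lam * K / rt by rewrite divr_ge0 ?mulr_ge0 // ltW.
have phisrc (b : 'cV[R]_n) : nrm b <= the -> row_small K lam A k
   (had (slope F G z0 F (loo k A) (r.+1 + m)) (prop F G z0 (loo k A) r.+1 m b)) ->
   `|phi b| <= q ^+ 2 / rt.
  move=> nb rs; apply: le_trans rs _.
  apply: (@le_trans _ _ (lam * K / rt * (L * U))).
    rewrite ler_wpM2l // nhad // ?(le_trans ler01 U1) //.
    apply: le_trans (nprop _) _; apply: le_trans thm.
    by rewrite exprSr ler_wpM2l.
  rewrite (_ : lam * K / rt * (L * U) = kap * U / rt) ?ler_wpM2r //.
  by rewrite /kap; ring.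
have phie : `|phi (evec i)| <= q ^+ 2 / rt.
  by apply: phisrc (good_evec A_good k i rmt); rewrite nrm_evec.
have phic : `|phi (loo k A *m evec i)| <= q ^+ 2 / rt.
  apply: phisrc (good_col A_good k i rmt); apply: le_trans (opl _) _.
  by rewrite nrm_evec mulr1.
have nR : nrm Rm <= 8 * (q ^+ 2 * (h * w) / rt).
  have n1 := nrm_loo_diff k Fx (regime_n reg) K0 (good_entry A_good).
  have n2 := Y k ki; rewrite -/Fx in n2.
  have n3 : K * `|Fx k 0| <= q * (q * (w / rt)).
    by rewrite ler_pM // /Fx mxE normrM ler_pM // xw.
  have n4 : nrm (loo k A *m had dF (off i x)) <= q * (w / rt * h).
    by apply: le_trans (opl _) _; apply: (ler_pM op_ge0 (nrm_ge0 _) bq dF1).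
  rewrite /Rm; apply: le_trans (nrmD _ _) _.
  apply: le_trans (lerD (nrmD _ _) (lexx _)) _.
  have e0 : w / rt * h = h * w / rt by ring.
  have hwr0 : 0 <= h * w / rt by rewrite divr_ge0 ?(ltW rt_gt0) // (le_trans ler01).
  have e3 : q * (q * (w / rt)) <= q ^+ 2 * (h * w) / rt.
    rewrite (_ : q * (q * (w / rt)) = q ^+ 2 * w / rt); last by rewrite !mulrA.
    by rewrite ler_wpM2r // ler_wpM2l // ler_peMl.
  have e4 : q * (w / rt * h) <= q ^+ 2 * (h * w) / rt.
    rewrite (_ : q * (w / rt * h) = q * (h * w) / rt); last by rewrite e0 mulrA.
    by rewrite ler_wpM2r // ler_wpM2r ?(le_trans ler01 hw1) // expr2 ler_peMl.
  have e5 : w / rt * h <= q ^+ 2 * (h * w) / rt.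
    by rewrite e0 ler_wpM2r // ler_peMl ?(le_trans ler01 hw1) // exprn_ege1.
  have := lerD (lerD (le_trans n1 (lerD n2 (le_trans n3 e3))) (le_trans n4 e4))
    (le_trans dG1 e5).
  set X := q ^+ 2 * _ / rt => sumX; apply: le_trans sumX _.
  by rewrite (_ : 8 * X = 5 * X + X + X + X) //; ring.
apply: le_trans (ler_normD _ _) _.
apply: le_trans (lerD (lexx _) (ler_normD _ _)) _.
apply: le_trans (lerD (lexx _) (lerD (ler_normD _ _) (lexx _))) _.
rewrite (normrM cF) (normrM cG).
have qr0 : 0 <= q ^+ 2 / rt by rewrite divr_ge0 // ltW.
have f1 : `|cF| * `|phi (loo k A *m evec i)| <= q ^+ 2 * (q ^+ 2 / rt).
  by rewrite ler_pM.
have f2 : `|cG| * `|phi (evec i)| <= q ^+ 2 * (q ^+ 2 / rt) by rewrite ler_pM.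
have f3 : q ^+ 2 * nrm Rm <= q ^+ 2 * (8 * (q ^+ 2 * (h * w) / rt)).
  by rewrite ler_wpM2l.
have E4 : q ^+ 4 = q ^+ 2 * q ^+ 2 by rewrite -exprD.
have f4 : q ^+ 2 * (q ^+ 2 / rt) <= q ^+ 4 * (h * w) / rt.
  by rewrite mulrA -E4 ler_wpM2r // ler_peMr // exprn_ge0.
have f5 : w / rt <= q ^+ 4 * (h * w) / rt.
  by rewrite ler_wpM2r // mulrA ler_peMl // mulr_ege1 // exprn_ege1.
have f6 : q ^+ 2 * (8 * (q ^+ 2 * (h * w) / rt)) = 8 * (q ^+ 4 * (h * w) / rt).
  by rewrite E4; ring.
have f7 : 13 * (q ^+ 4 * (h * w) / rt) <= q ^+ (p + 7) * w / rt.
  by rewrite mulrA [13 * _]mulrA ler_wpM2r.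
have f8 : 0 <= q ^+ 4 * (h * w) / rt.
  exact: le_trans wr0 f5.
rewrite f6 in f3.
have := lerD (le_trans phi1 f5) (lerD (lerD (le_trans phiR f3)
  (le_trans f1 f4)) (le_trans f2 f4)).
set X := q ^+ 4 * _ / rt in f7 f8 * => sumX.
apply: le_trans sumX _; apply: le_trans f7.
rewrite (_ : X + (8 * X + X + X) = 11 * X); last by ring.
by rewrite ler_wpM2r // ler_nat.
Qed.

Let K_q : K <= q.
Proof. by apply: le_trans the_q; rewrite /the; move: K_kap L_kap L0; lra. Qed.

Let U0 : 0 <= U. Proof. exact: le_trans ler01 U1. Qed.

Let thm_U m : (m <= t.+1)%N -> the ^+ m <= U.
Proof. by move=> mt; rewrite ler_weXn2l. Qed.

Let invrt0 : 0 <= rt^-1. Proof. by rewrite invr_ge0 ltW. Qed.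

(** A perturbation started at [i] is amplified by [q ^+ (p + 7)] per step, and
    the gain [1 / rt] away from [i] is never lost. *)
Lemma coupled_prop s i x (x' : 'I_n -> 'cV[R]_n) :
  nrm x <= the -> (forall k, nrm (x' k) <= the) ->
  (forall k, k != i -> `|x k 0| <= K / rt) ->
  (forall k, k != i -> nrm (x - x' k) <= K / rt) ->
  (forall k m, (s + m < t)%N -> row_small K lam A k
     (had (slope F G z0 F (loo k A) (s + m))
          (prop F G z0 (loo k A) s m (x' k)))) ->
  forall m, (s + m <= t)%N ->
  coupled (s + m) i (q ^+ (3 + m * (p + 7))) (prop F G z0 A s m x)
    (fun k => prop F G z0 (loo k A) s m (x' k)).
Proof.
move=> nx nx' xk xx' rs; elim=> [|m ih] smt.
  have Kq3 : K <= q ^+ 3 by apply: le_trans K_q _; rewrite ler_eXnr.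
  rewrite mul0n /= addn0 addn0; split=> k ki.
    by apply: le_trans (xk k ki) _; rewrite ler_wpM2r.
  move=> m' smt'; apply: le_trans (good_row reg A_good _ _) _.
  apply: (@le_trans _ _ (K * (L * (U * (K / rt))))); last first.
    rewrite !mulrA ler_wpM2r // exprSr ler_pM ?mulr_ge0 //.
    by apply: le_trans kapU; rewrite ler_wpM2r.
  rewrite ler_wpM2l //.
  apply: le_trans (nrm_had _ (fun l => slopeF_le z0 reg _ l smt')) _.
  rewrite ler_wpM2l //.
  have opl := op_bounded_loo reg k (good_op A_good).
  apply: le_trans (nrm_prop _ reg _ opl (ltnW smt')) _.
  apply: ler_pM; rewrite ?nrm_ge0 ?exprn_ge0 ?xx' //.
  by rewrite thm_U // (leq_trans (leq_addl s m')) // ltnW // ltnW.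
rewrite addnS in smt *.
have w1 : 1 <= q ^+ (3 + m * (p + 7)) by rewrite exprn_ege1.
have mt : (m < t)%N by apply: leq_trans smt; rewrite ltnS leq_addl.
have xU : nrm (prop F G z0 A s m x) <= U.
  apply: le_trans (nrm_prop _ reg _ (good_op A_good) (ltnW smt)) _.
  apply: (@le_trans _ _ (the ^+ m.+1)); last by rewrite thm_U // ltnW.
  by rewrite exprSr ler_wpM2l ?exprn_ge0.
have := coupled_step smt w1 xU (ih (ltnW smt)).
rewrite -exprD addnCA -mulSn; apply=> k ki.
apply: le_trans (rs k m smt) _.
apply: (@le_trans _ _ (lam * K / rt * (L * U))); last first.
  rewrite (_ : lam * K / rt * (L * U) = kap * U / rt) ?ler_wpM2r //.
  by rewrite /kap; ring.
rewrite ler_wpM2l ?divr_ge0 ?mulr_ge0 ?(ltW rt_gt0) //.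
apply: le_trans (nrm_had _ (fun l => slopeF_le z0 reg _ l smt)) _.
rewrite ler_wpM2l //.
have opl := op_bounded_loo reg k (good_op A_good).
apply: le_trans (nrm_prop _ reg _ opl (ltnW smt)) _.
apply: (@le_trans _ _ (the ^+ m.+1)); last by rewrite thm_U // ltnW.
by rewrite exprSr ler_wpM2l ?exprn_ge0.
Qed.

Let W : R := q ^+ (3 + t * (p + 7)).

Let W1 : 1 <= W. Proof. exact: exprn_ege1. Qed.
Let W0 : 0 <= W. Proof. exact: le_trans ler01 W1. Qed.
Let q_W : q <= W. Proof. by rewrite /W exprS ler_peMr // exprn_ege1. Qed.

Let wm_W m : (m <= t)%N -> q ^+ (3 + m * (p + 7)) <= W.
Proof. by move=> mt; rewrite ler_weXn2l // leq_add2l leq_mul2r mt orbT. Qed.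

Let entry_bound (b : 'I_n -> 'cV[R]_n) :=
  forall k l, `|b l k 0| <= if k == l then W else W / rt.

Let nrm_col l : nrm (A *m evec l) <= the.
Proof.
apply: le_trans (good_op A_good _) _.
by rewrite nrm_evec mulr1.
Qed.

Let prop_diag s m x k : (s + m <= t)%N -> nrm x <= the ->
  `|prop F G z0 A s m x k 0| <= W.
Proof.
move=> smt nx; apply: le_trans (entry_nrm _ _) _.
apply: le_trans (nrm_prop _ reg _ (good_op A_good) smt) _.
apply: le_trans q_W; apply: le_trans U_q.
apply: (@le_trans _ _ (the ^+ m.+1)); last first.
  by rewrite thm_U // ltnS (leq_trans (leq_addl _ _) smt).
by rewrite exprSr ler_wpM2l ?exprn_ge0.
Qed.

(** The diagonal entries are bounded by the operator norm only; away from the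
    diagonal the starting vector vanishes. *)
Lemma prop_evec_entry s m : (s + m <= t)%N ->
  entry_bound (fun l => prop F G z0 A s m (evec l)).
Proof.
move=> smt k l; case: eqP => [_|/eqP kl].
  by apply: prop_diag; rewrite ?nrm_evec.
have ne : nrm (evec l : 'cV[R]_n) <= the by rewrite nrm_evec.
have off0 k' : k' != l -> `|evec l k' 0 : R| <= K / rt.
  by move=> /negPf k'l; rewrite mxE k'l normr0 divr_ge0 // ltW.
have d0 k' : k' != l -> nrm (evec l - evec l : 'cV[R]_n) <= K / rt.
  by rewrite subrr nrm0 divr_ge0 // ltW.
have [h1 _] := coupled_prop ne (fun=> ne) off0 d0
  (fun k' m' h => good_evec A_good k' l h) smt.
apply: le_trans (h1 k kl) _; rewrite ler_wpM2r // wm_W //.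
exact: leq_trans (leq_addl _ _) smt.
Qed.

(** A column of [A] is large only at [l] and nearly unchanged when another row
    is deleted, so it is as good a starting vector as [evec l]. *)
Lemma prop_col_entry s m : (s + m <= t)%N ->
  entry_bound (fun l => prop F G z0 A s m (A *m evec l)).
Proof.
move=> smt k l; case: eqP => [_|/eqP kl].
  exact: prop_diag.
have opl k' := op_bounded_loo reg k' (good_op A_good).
have nl k' : nrm (loo k' A *m evec l) <= the.
  by apply: le_trans (opl _ _) _; rewrite nrm_evec mulr1.
have offl k' : k' != l -> `|(A *m evec l) k' 0| <= K / rt.
  by rewrite mulmx_evec (good_entry A_good).
have dl k' : k' != l -> nrm (A *m evec l - loo k' A *m evec l) <= K / rt.
  move=> /negPf k'l.
  apply: le_trans (nrm_loo_diff _ _ (regime_n reg) K0 (good_entry A_good)) _.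
  by rewrite mulmx_evec mxE k'l normr0 mulr0 addr0 (good_entry A_good).
have [h1 _] := coupled_prop (nrm_col l) nl offl dl
  (fun k' m' h => good_col A_good k' l h) smt.
apply: le_trans (h1 k kl) _; rewrite ler_wpM2r // wm_W //.
exact: leq_trans (leq_addl _ _) smt.
Qed.
End Good.
End Propagator.

(** * Derivatives of the iterates *)

Section Derivatives.
Context {R : realType} {n : nat}.
Variables (F G : nat -> 'I_n -> R -> R) (z0 : 'cV[R]_n) (i j : 'I_n).
Implicit Types (A : 'M[R]_n) (x y : 'cV[R]_n).

Definition curv (E : nat -> 'I_n -> R -> R) A s : 'cV[R]_n :=
  \col_l derive1 (derive1 (E s.+1 l)) (state F G z0 A s l 0).

(** The derivatives of the iterate in the direction [sym_dir i j], defined by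
    the differentiated recursion: bounds and measurability then follow by
    induction, independently of the differentiability proved later. *)
Fixpoint dstate A s : 'cV[R]_n :=
  if s is r.+1 then
    step F G z0 A r (dstate A r)
    + sym_dir i j *m coordwise (F r.+1) (state F G z0 A r)
  else 0.

Fixpoint d2state A s : 'cV[R]_n :=
  if s is r.+1 then
    let d := dstate A r in
    step F G z0 A r (d2state A r)
    + (A *m had (curv F A r) (had d d) + (had (curv G A r) (had d d)
    + 2 *: (sym_dir i j *m had (slope F G z0 F A r) d)))
  else 0.

(** The shape of both derivatives: the weights of the maximum to be bounded
    are the inverses of the weights here when [e] is [1 / sqrt n]. *)
Definition concentrated (e om : R) x :=
  forall k, `|x k 0| <= om * (if (k == i) || (k == j) then 1 else e).

Lemma concentratedD e om om' x y : concentrated e om x ->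
  concentrated e om' y -> concentrated e (om + om') (x + y).
Proof.
move=> hx hy k; rewrite mxE mulrDl.
exact: le_trans (ler_normD _ _) (lerD (hx k) (hy k)).
Qed.

Lemma concentrated_le e om om' x : 0 <= e -> om <= om' ->
  concentrated e om x -> concentrated e om' x.
Proof.
by move=> e0 oo hx k; apply: le_trans (hx k) _; rewrite ler_wpM2r //; case: ifP.
Qed.

Lemma concentrated_had e om (c : R) (d x : 'cV[R]_n) :
  (forall k, `|d k 0| <= c) -> 0 <= c ->
  concentrated e om x -> concentrated e (c * om) (had d x).
Proof. by move=> hd c0 hx k; rewrite mxE normrM -mulrA ler_pM. Qed.

Lemma concentrated_sqr e om x : 0 <= e ->
  concentrated e om x -> concentrated (e ^+ 2) (om ^+ 2) (had x x).
Proof.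
move=> e0 hx k; rewrite mxE -expr2 normrX.
have := hx k; case: ifP => _ h; last first.
  by rewrite -exprMn lerXn2r ?nnegrE // (le_trans _ h).
by rewrite mulr1 in h; rewrite mulr1 lerXn2r ?nnegrE // (le_trans _ h).
Qed.

Lemma sym_dir_mul (v : 'cV[R]_n) k : (sym_dir i j *m v : 'cV[R]_n) k 0 =
  (if i == j then 2^-1 else 1) * ((k == i)%:R * v j 0 + (k == j)%:R * v i 0).
Proof.
rewrite /sym_dir -scalemxAl mxE; congr (_ * _).
have e a b : (delta_mx a b *m v : 'cV[R]_n) k 0 = (k == a)%:R * v b 0.
  rewrite mxE (bigD1 b) //= big1 => [|l lb]; last first.
    by rewrite mxE (negPf lb) andbF mul0r.
  by rewrite mxE eqxx andbT addr0.
by rewrite mulmxDl mxE !e.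
Qed.

Lemma concentrated_sym_dir e (c : R) (v : 'cV[R]_n) : 0 <= e ->
  `|v i 0| <= c -> `|v j 0| <= c -> concentrated e (2 * c) (sym_dir i j *m v).
Proof.
move=> e0 vi vj k; rewrite sym_dir_mul.
have c0 : 0 <= c := le_trans (normr_ge0 _) vi.
have [ki|ki] /= := eqVneq k i; last first.
  have [kj|kj] /= := eqVneq k j; last by rewrite !mul0r addr0 mulr0 normr0 !mulr_ge0.
  rewrite mul0r add0r mul1r mulr1 normrM; case: eqP => _.
    by rewrite ger0_norm ?invr_ge0 //; lra.
  by rewrite normr1; lra.
rewrite mul1r mulr1 normrM.
have h : `|v j 0 + (k == j)%:R * v i 0| <= 2 * c.
  apply: le_trans (ler_normD _ _) _; rewrite normrM.
  by case: eqP => _; rewrite ?normr1 ?normr0; lra.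
case: eqP => _; last by rewrite normr1 mul1r.
by rewrite ger0_norm ?invr_ge0 //; have := normr_ge0 (v j 0 + (k == j)%:R * v i 0); lra.
Qed.

Let rt : R := Num.sqrt n%:R.

(** A linear image of a strongly concentrated vector is concentrated when the
    images of the coordinate vectors are: the [n] small coordinates add up to
    no more than one large one. *)
Lemma concentrated_comb (W om : R) (b : 'I_n -> 'cV[R]_n) y : 0 <= W ->
  (forall k l, `|b l k 0| <= if k == l then W else W / rt) ->
  concentrated n%:R^-1 om y ->
  concentrated rt^-1 (4 * om * W) (\sum_l y l 0 *: b l).
Proof.
move=> W0 hb hy k.
have n0 : (0 < n)%N by apply: leq_ltn_trans (ltn_ord k).
have nR0 : 0 < n%:R :> R by rewrite ltr0n.
have om0 : 0 <= om.
  by have := hy i; rewrite eqxx mulr1; apply: le_trans.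
have rt0 : 0 < rt by rewrite sqrtr_gt0.
have rtV : 0 <= rt^-1 by rewrite invr_ge0 ltW.
have rt1 : 1 <= rt by rewrite -[leLHS]sqrtr1 ler_wsqrtr // (ler_nat _ 1).
have rtV1 : rt^-1 <= 1 by rewrite invf_le1.
have nrt : n%:R = rt ^+ 2 by rewrite sqr_sqrtr ?ltW.
have nrtV : n%:R^-1 <= rt^-1 by rewrite nrt lef_pV2 ?posrE ?exprn_gt0 // expr2 ler_peMr // ltW.
have sum_y : \sum_l `|y l 0| <= 3 * om.
  apply: (@le_trans _ _ (\sum_(l < n) om * ((l == i)%:R + (l == j)%:R + n%:R^-1))).
    apply: ler_sum => l _; apply: le_trans (hy l) _; rewrite ler_wpM2l //.
    have : 0 <= n%:R^-1 :> R by rewrite invr_ge0 ltW.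
    by case: eqP => _; case: eqP => _ /=; lra.
  rewrite -mulr_sumr mulrC ler_wpM2r // !big_split /=.
  have e1 a : \sum_(l < n) (l == a)%:R = 1 :> R.
    rewrite (bigD1 a) //= big1 => [|l /negPf ->]; last by [].
    by rewrite eqxx addr0.
  by rewrite !e1 sumr_const card_ord -[_ *+ n]mulr_natr mulVf ?gt_eqF //; lra.
rewrite summxE; apply: le_trans (ler_norm_sum _ _ _) _.
apply: (@le_trans _ _ (`|y k 0| * W + 3 * om * (W / rt))).
  apply: (@le_trans _ _ (`|y k 0| * W + (\sum_l `|y l 0|) * (W / rt))); last first.
    by rewrite lerD2l ler_wpM2r // mulr_ge0.
  rewrite (bigD1 k) //= mxE normrM; apply: lerD.
    by rewrite ler_wpM2l //; have := hb k k; rewrite eqxx.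
  rewrite mulr_suml [leRHS](bigD1 k) //= ler_wpDl ?mulr_ge0 //.
  apply: ler_sum => l lk; rewrite mxE normrM ler_wpM2l //.
  by have := hb k l; rewrite eq_sym (negPf lk).
have h := hy k; case: ifP h => [_|_] h.
  rewrite mulr1 in h; rewrite mulr1.
  have : `|y k 0| * W <= om * W by rewrite ler_wpM2r.
  have : 3 * om * (W / rt) <= 3 * om * W.
    by rewrite ler_wpM2l ?mulr_ge0 // ler_piMr.
  lra.
have h1 : `|y k 0| * W <= om * rt^-1 * W.
  by rewrite ler_wpM2r // (le_trans h) // ler_wpM2l.
have -> : 4 * om * W / rt = om * rt^-1 * W + 3 * om * (W / rt) by ring.
by rewrite lerD2r.
Qed.

Section Bounds.
Variables (A : 'M[R]_n) (t : nat) (W L B C : R).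
Hypotheses (W_ge1 : 1 <= W) (L_ge1 : 1 <= L).
Hypothesis evec_le : forall s m k l, (s + m <= t)%N ->
  `|prop F G z0 A s m (evec l) k 0| <= if k == l then W else W / rt.
Hypothesis col_le : forall s m k l, (s + m <= t)%N ->
  `|prop F G z0 A s m (A *m evec l) k 0| <= if k == l then W else W / rt.
Hypothesis F_le : forall s k, (s < t)%N -> `|F s.+1 k (state F G z0 A s k 0)| <= B.
Hypothesis slope_le : forall s k, (s < t)%N -> `|slope F G z0 F A s k 0| <= L.
Hypothesis curvF_le : forall s k, (s < t)%N -> `|curv F A s k 0| <= C.
Hypothesis curvG_le : forall s k, (s < t)%N -> `|curv G A s k 0| <= C.

Let W0 : 0 <= W. Proof. exact: le_trans ler01 W_ge1. Qed.
Let rtV : 0 <= rt^-1. Proof. by rewrite invr_ge0 sqrtr_ge0. Qed.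
Let nV : 0 <= n%:R^-1 :> R. Proof. by rewrite invr_ge0 ler0n. Qed.

Lemma prop_concentrated s m om y : (s + m <= t)%N ->
  concentrated n%:R^-1 om y ->
  concentrated rt^-1 (4 * om * W) (prop F G z0 A s m y).
Proof.
move=> smt hy; rewrite (vec_sum y) prop_sum.
under eq_bigr do rewrite propZ.
by apply: concentrated_comb => // k l; apply: evec_le.
Qed.

Lemma prop_mul_concentrated s m om y : (s + m <= t)%N ->
  concentrated n%:R^-1 om y ->
  concentrated rt^-1 (4 * om * W) (prop F G z0 A s m (A *m y)).
Proof.
move=> smt hy; rewrite (vec_sum y) mulmx_sumr prop_sum.
under eq_bigr do rewrite -scalemxAr propZ.
by apply: concentrated_comb => // k l; apply: col_le.
Qed.

(** The induction hypothesis has to speak of all later evolutions of the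
    derivative: one [step] does not preserve concentration. *)
Lemma prop_dstate s m : (s + m <= t)%N ->
  concentrated rt^-1 (s%:R * (4 * (2 * B) * W))
    (prop F G z0 A s m (dstate A s)).
Proof.
elim: s m => [|s ih] m smt.
  by rewrite prop0 => k; rewrite mxE normr0 !mul0r.
have st : (s < t)%N by apply: leq_trans smt; rewrite leq_addr.
rewrite /= propD -prop_first -natr1 mulrDl mul1r; apply: concentratedD.
  by apply: ih; rewrite -addSnnS.
by apply: prop_concentrated => //; apply: concentrated_sym_dir; rewrite ?mxE ?F_le.
Qed.

Let om : R := t%:R * (4 * (2 * B) * W).

Let B0 : (0 < t)%N -> 0 <= B.
Proof. by move=> t0; apply: le_trans (F_le i t0). Qed.

Lemma dstate_concentrated s : (s <= t)%N -> concentrated rt^-1 om (dstate A s).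
Proof.
move=> st; have := @prop_dstate s 0; rewrite addn0 => /(_ st) /=.
case: (posnP t) => [t0|t0]; first by move: st; rewrite /om t0 leqn0 => /eqP ->.
apply: concentrated_le => //.
by rewrite ler_wpM2r ?ler_nat // !mulr_ge0 ?B0.
Qed.

(** The square of a vector concentrated at scale [1 / sqrt n] is concentrated
    at scale [1 / n], which is what makes the source term
    [A *m had (curv F) (had d d)] admissible in [concentrated_comb]. *)
Lemma prop_d2state s m : (s + m <= t)%N ->
  concentrated rt^-1 (s%:R * (8 * (C * om ^+ 2) * W + 16 * (L * om) * W))
    (prop F G z0 A s m (d2state A s)).
Proof.
elim: s m => [|s ih] m smt.
  by rewrite prop0 => k; rewrite mxE normr0 !mul0r.
have st : (s < t)%N by apply: leq_trans smt; rewrite leq_addr.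
have t0 : (0 < t)%N by apply: leq_ltn_trans st.
have C0 : 0 <= C by apply: le_trans (curvF_le i st).
have L0 : 0 <= L := le_trans ler01 L_ge1.
rewrite [d2state A s.+1]/=; set d := dstate A s.
have dc : concentrated rt^-1 om d by apply: dstate_concentrated; rewrite ltnW.
have om0 : 0 <= om by rewrite !mulr_ge0 // B0.
have rt1 : rt^-1 <= 1.
  rewrite invf_le1 ?sqrtr_gt0 ?ltr0n ?(leq_ltn_trans _ (ltn_ord i)) //.
  by rewrite -[leLHS]sqrtr1 ler_wsqrtr // (ler_nat _ 1) (leq_ltn_trans _ (ltn_ord i)).
have dd : concentrated n%:R^-1 (om ^+ 2) (had d d).
  have -> : n%:R^-1 = rt^-1 ^+ 2 :> R by rewrite exprVn sqr_sqrtr ?ler0n.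
  exact: concentrated_sqr.
have dle k : `|had (slope F G z0 F A s) d k 0| <= L * om.
  rewrite mxE normrM ler_pM // ?slope_le //.
  by apply: le_trans (dc k) _; rewrite ler_piMr //; case: ifP.
rewrite propD -prop_first -natr1 mulrDl mul1r; apply: concentratedD.
  by apply: ih; rewrite -addSnnS.
have -> : 8 * (C * om ^+ 2) * W + 16 * (L * om) * W =
  4 * (C * om ^+ 2) * W + (4 * (C * om ^+ 2) * W
   + 4 * (2 * (2 * (L * om))) * W) by ring.
rewrite propD; apply: concentratedD.
  by apply: prop_mul_concentrated => //; apply: concentrated_had => // k; apply: curvF_le.
rewrite propD; apply: concentratedD.
  by apply: prop_concentrated => //; apply: concentrated_had => // k; apply: curvG_le.
apply: prop_concentrated => //.
have -> : 2 * (2 * (L * om)) = 2 * (L * om) + 2 * (L * om) by ring.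
by rewrite scalerDl scale1r; apply: concentratedD; apply: concentrated_sym_dir.
Qed.

Lemma d2state_concentrated s : (s <= t)%N ->
  concentrated rt^-1 (t%:R * (8 * (C * om ^+ 2) * W + 16 * (L * om) * W))
    (d2state A s).
Proof.
move=> st; have := @prop_d2state s 0; rewrite addn0 => /(_ st) /=.
case: (posnP t) => [t0|t0]; first by move: st; rewrite t0 leqn0 => /eqP ->.
have C0 : 0 <= C by apply: le_trans (curvF_le i t0).
have om0 : 0 <= om by rewrite !mulr_ge0 // B0.
have L0 : 0 <= L := le_trans ler01 L_ge1.
apply: concentrated_le => //.
by rewrite ler_wpM2r ?ler_nat // addr_ge0 // mulr_ge0 // mulr_ge0 // mulr_ge0 //
  exprn_ge0.
Qed.

End Bounds.
End Derivatives.

Section DerivativeBound.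
Context {R : realType} {n : nat}.
Variables (F G : nat -> 'I_n -> R -> R) (z0 : 'cV[R]_n).
Variables (K L lam zeta : R) (p t : nat) (A : 'M[R]_n).
Hypotheses (reg : regime F G K L lam p t)
  (A_good : good_matrix F G z0 K lam t A)
  (zeta_ge1 : 1 <= zeta) (z0_le : forall l, 1 + `|z0 l 0| <= zeta)
  (t_gt0 : (0 < t)%N).

Let rt : R := Num.sqrt n%:R.
Let the : R := 19 * (lam * K * L).
Let beta : R := the * zeta.
Let q : R := beta ^+ t.+1.
Let Q : R := the ^+ t * zeta.
Let W : R := q ^+ (3 + t * (p + 7)).

Let L0 : 0 <= L. Proof. exact: le_trans (ler0n _ 2) (regime_L reg). Qed.

Let L_the : 38 * L <= the.
Proof.
have h : 2 <= lam * K.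
  rewrite -[2]mul1r ler_pM // ?ler01 ?(regime_lam reg) ?(regime_K reg) //.
have : 2 * L <= lam * K * L by rewrite ler_wpM2r.
by rewrite /the; lra.
Qed.

Let the_ge : 76 <= the.
Proof. by have := regime_L reg; have := L_the; lra. Qed.

Let the_beta : the <= beta.
Proof. by rewrite ler_peMr //; have := the_ge; lra. Qed.

Let beta_ge : 76 <= beta. Proof. exact: le_trans the_ge the_beta. Qed.
Let beta1 : 1 <= beta. Proof. by apply: le_trans beta_ge; rewrite ler1n. Qed.
Let beta0 : 0 <= beta. Proof. exact: le_trans ler01 beta1. Qed.

Let beta_q : beta <= q. Proof. by rewrite /q exprS ler_peMr // exprn_ege1. Qed.
Let q_ge : 76 <= q. Proof. exact: le_trans beta_ge beta_q. Qed.
Let q1 : 1 <= q. Proof. by apply: le_trans q_ge; rewrite ler1n. Qed.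
Let q0 : 0 <= q. Proof. exact: le_trans ler01 q1. Qed.
Let L_q : L <= q.
Proof. by apply: le_trans beta_q; apply: le_trans the_beta; have := L_the; have := L0; lra. Qed.
Let Q_q : Q <= q.
Proof.
have z0' : 0 <= zeta := le_trans ler01 zeta_ge1.
have the1 : 1 <= the by apply: le_trans the_ge; rewrite ler1n.
have the0 : 0 <= the := le_trans ler01 the1.
rewrite /Q /q /beta [(the * zeta) ^+ _]exprMn ler_pM ?exprn_ge0 //.
  by rewrite [leRHS]exprS ler_peMl // exprn_ge0.
by rewrite [leRHS]exprS ler_peMr // exprn_ege1.
Qed.
Let Q0 : 0 <= Q.
Proof.
by rewrite mulr_ge0 ?exprn_ge0 ?(le_trans _ the_ge) ?(le_trans _ zeta_ge1).
Qed.
Let W1 : 1 <= W. Proof. exact: exprn_ege1. Qed.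
Let W0 : 0 <= W. Proof. exact: le_trans ler01 W1. Qed.

Let t_q : t%:R <= q.
Proof.
have h m : m%:R <= 2 ^+ m :> R by rewrite -natrX ler_nat ltnW // ltn_expl.
apply: le_trans (h t) _; apply: (@le_trans _ _ (2 ^+ t.+1)).
  by rewrite ler_weXn2l // ler1n.
rewrite /q lerXn2r ?nnegrE //.
by apply: le_trans beta_ge; rewrite ler_nat.
Qed.

Let om : R := t%:R * (4 * (2 * (L * Q)) * W).

Let om_le : om <= q ^+ 4 * W.
Proof.
rewrite /om (_ : t%:R * (4 * (2 * (L * Q)) * W) = t%:R * 8 * (L * Q) * W);
  last by ring.
have -> : q ^+ 4 = q * q * (q * q) by rewrite -!expr2 -exprM.
have q8 : 8 <= q by apply: le_trans q_ge; rewrite ler_nat.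
rewrite ler_wpM2r // (ler_pM (mulr_ge0 _ _) (mulr_ge0 L0 Q0)) //.
  exact: ler_pM.
exact: ler_pM.
Qed.

Let LQ0 : 0 <= L * Q. Proof. exact: mulr_ge0. Qed.
Let om0 : 0 <= om.
Proof. by rewrite mulr_ge0 // mulr_ge0 // mulr_ge0 // mulr_ge0. Qed.

Let om2_le : t%:R * (8 * (L * Q ^+ p * om ^+ 2) * W + 16 * (L * om) * W)
  <= q ^+ (p + 11) * W ^+ 3.
Proof.
pose O := q ^+ 4 * W; have oO : om <= O := om_le.
have O1 : 1 <= O by rewrite mulr_ege1 // exprn_ege1.
have O0 : 0 <= O := le_trans ler01 O1.
have oo : om ^+ 2 <= O ^+ 2 by rewrite lerXn2r ?nnegrE.
have qp1 : 1 <= q ^+ p.+1 by rewrite exprn_ege1.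
have qp0 : 0 <= q ^+ p.+1 := le_trans ler01 qp1.
have O20 : 0 <= O ^+ 2 by rewrite exprn_ge0.
have C_le : L * Q ^+ p <= q ^+ p.+1.
  by rewrite exprS ler_pM ?exprn_ge0 // lerXn2r ?nnegrE.
have h1 : L * Q ^+ p * om ^+ 2 <= q ^+ p.+1 * O ^+ 2.
  apply: ler_pM => //; last exact: exprn_ge0.
  by apply: mulr_ge0 => //; apply: exprn_ge0.
have h2 : L * om <= q ^+ p.+1 * O ^+ 2.
  rewrite ler_pM //; first by apply: le_trans L_q _; rewrite ler_eXnr.
  by apply: le_trans oO _; rewrite ler_eXnr.
set X := q ^+ p.+1 * O ^+ 2 in h1 h2.
have X0 : 0 <= X by rewrite mulr_ge0.
apply: (@le_trans _ _ (q * (q * X * W))).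
  have om20 : 0 <= om ^+ 2 by apply: exprn_ge0.
  have CQ0 : 0 <= L * Q ^+ p by apply: mulr_ge0 => //; apply: exprn_ge0.
  apply: ler_pM => //.
    apply: addr_ge0; (apply: mulr_ge0 => //; apply: mulr_ge0 => //);
      exact: mulr_ge0.
  rewrite -mulrDl ler_wpM2r //.
  have : 24 * X <= q * X by rewrite ler_wpM2r //; have := q_ge; lra.
  move: h1 h2; lra.
rewrite /X /O le_eqVlt; apply/orP; left; apply/eqP.
have -> : (p + 11 = 1 + (1 + (p.+1 + (4 + 4))))%N.
  by rewrite (addnC p 11) (addnC p.+1).
rewrite !(exprD q) expr1; ring.
Qed.

Let bigger : 3 * (q ^+ (p + 11) * W ^+ 3) <= beta ^+ (8 * (p + 11) * t ^ 2).
Proof.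
apply: (@le_trans _ _ (q ^+ (p + 12 + (3 + t * (p + 7)) * 3))).
  rewrite [leRHS](exprD q) [q ^+ ((3 + _) * 3)]exprM -/W mulrA ler_wpM2r ?exprn_ge0 //.
  by rewrite !addnS [leRHS]exprS ler_wpM2r ?exprn_ge0 //; have := q_ge; lra.
rewrite /q -exprM; apply: ler_weXn2l => //.
rewrite expnS expn1; move: t_gt0; case: (t) => // u _; clear; nia.
Qed.

(** The bounds on the second derivative multiply three propagators, each of
    size [W], with powers of [q]; since [q] is a power [t + 1] and [W] a power
    of order [t ^ 2] of [beta], the total exponent is of order [t ^ 2]. *)
Lemma derivative_bound i j :
  let X := beta ^+ (8 * (p + 11) * t ^ 2) in
  concentrated i j rt^-1 (X / 3) (dstate F G z0 i j A t) /\
  concentrated i j rt^-1 (X / 3) (d2state F G z0 i j A t).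
Proof.
move=> X.
have L1 : 1 <= L by apply: le_trans (regime_L reg); rewrite ler1n.
have stQ s k : (s < t)%N -> 1 + `|state F G z0 A s k 0| <= Q.
  by move=> st; apply: (state_le reg zeta_ge1 z0_le A_good k (ltnW st)).
have He s m k l (h : (s + m <= t)%N) :=
  prop_evec_entry reg zeta_ge1 z0_le A_good h k l.
have Hc s m k l (h : (s + m <= t)%N) :=
  prop_col_entry reg zeta_ge1 z0_le A_good h k l.
have F_le s k : (s < t)%N -> `|F s.+1 k (state F G z0 A s k 0)| <= L * Q.
  move=> st; apply: le_trans (tame_growth _ (regime_F reg k st)) _.
  by rewrite ler_wpM2l // stQ.
have curv_le (E : nat -> 'I_n -> R -> R) s k : (s < t)%N -> tame L p (E s.+1 k) ->
    `|curv F G z0 E A s k 0| <= L * Q ^+ p.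
  move=> st Et; rewrite mxE; apply: le_trans (tame_d2 Et _) _.
  by rewrite ler_wpM2l // lerXn2r ?nnegrE ?addr_ge0 // stQ.
have F_tame s k st := curv_le F s k st (regime_F reg k st).
have G_tame s k st := curv_le G s k st (regime_G reg k st).
have sl s k : (s < t)%N -> `|slope F G z0 F A s k 0| <= L.
  by move=> st; apply: (slopeF_le z0 reg).
have rtV : 0 <= rt^-1 by rewrite invr_ge0 sqrtr_ge0.
have Y : q ^+ (p + 11) * W ^+ 3 <= X / 3 by rewrite ler_pdivlMr // mulrC bigger.
split.
  have := dstate_concentrated i j W1 He F_le (leqnn t).
  apply: concentrated_le => //; apply: le_trans om_le _; apply: le_trans Y.
  apply: ler_pM => //; rewrite ?exprn_ge0 //.
    by rewrite ler_weXn2l // addnC.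
  by rewrite ler_eXnr.
have := d2state_concentrated i j W1 L1 He Hc F_le sl F_tame G_tame (leqnn t).
by apply: concentrated_le => //; apply: le_trans om2_le Y.
Qed.

End DerivativeBound.

(** * Smoothness and directional derivatives *)

Section Smooth.
Context {R : realType}.
Implicit Types f : R -> R.

Lemma lip_norm_ge0 f : (0 <= lip_norm f)%E.
Proof.
apply: (@le_trans _ _ (`|f 0 - f 1| / `|0 - 1|)%:E).
  by rewrite lee_fin divr_ge0.
by apply: ereal_sup_ubound; exists (0, 1) => //=; rewrite eq_sym oner_eq0.
Qed.

Lemma weighted_norm_ub p f x :
  (((1 + `|x|) ^- p * `|f x|)%:E <= weighted_norm p f)%E.
Proof. by apply: ereal_sup_ubound; exists x. Qed.

Lemma derivable_continuous f : (forall x, derivable f x 1) -> continuous f.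
Proof. by move=> df x; apply/differentiable_continuous/derivable1_diffP. Qed.

Lemma lipschitz_derive1 (L : R) f x : derivable f x 1 ->
  (forall u v, `|f u - f v| <= L * `|u - v|) -> `|derive1 f x| <= L.
Proof.
move=> df lip.
have cv : (fun h => h^-1 *: (f (h + x) - f x)) @ 0^' --> derive1 f x.
  rewrite derive1E /derive (_ : (fun h => _) =
    (fun h => h^-1 *: ((f \o shift x) (h *: 1) - f x))) //.
  by apply/funext => h /=; rewrite [h%:A]mulr1.
rewrite -(cvg_lim _ (cvg_norm cv)) //; apply: limr_le.
  by apply: cvgP (cvg_norm cv).
near=> h => /=.
have h0 : h != 0 by near: h; exact: nbhs_dnbhs_neq.
rewrite normrM normfV ler_pdivrMl ?normr_gt0 // mulrC.
by apply: le_trans (lip _ _) _; rewrite addrK.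
Unshelve. all: by end_near. Qed.

Lemma bounded_derive1_lipschitz (C M : R) f x y :
  (forall u, derivable f u 1) -> (forall u, `|u| <= M -> `|derive1 f u| <= C) ->
  `|x| <= M -> `|y| <= M -> `|f x - f y| <= C * `|x - y|.
Proof.
move=> df fC.
wlog xy : x y / x <= y.
  move=> h xM yM; case/orP: (le_total x y) => [xy|yx]; first exact: h.
  by rewrite (distrC (f x)) (distrC x); exact: h.
move=> xM yM.
have fd (u : R) : u \in `]x, y[%R -> is_derive u 1 f (derive1 f u).
  by move=> _; rewrite derive1E; apply: derivableP.
have [c cxy e] := MVT_segment xy fd
  (continuous_subspaceT (derivable_continuous df)).
rewrite distrC e normrM distrC ler_wpM2r // fC //.
move: cxy; rewrite in_itv /= => /andP[xc cy].
by move: xM yM; rewrite !ler_norml => /andP[? ?] /andP[? ?]; apply/andP; split; lra.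
Qed.

(** What differentiating the recursion twice requires. *)
Definition smooth2 f := (forall x, derivable f x 1) /\
  (forall x, derivable (derive1 f) x 1) /\ continuous (derive1 (derive1 f)).

Lemma class_C_smooth2 f : class_C 3 f -> smooth2 f.
Proof.
move=> [d _]; split; first exact: (d 0%N).
split; first exact: (d 1%N).
by apply: derivable_continuous; exact: (d 2%N).
Qed.

Lemma smooth_norm_tame (L : R) p f :
  class_C 3 f -> (smooth_norm p f <= L%:E)%E -> tame L p f.
Proof.
move=> [d _]; rewrite /smooth_norm => fL.
have w q : (q < 4)%N -> (weighted_norm p (derive1n q f) <= L%:E)%E.
  move=> q4; apply: le_trans fL.
  apply: le_trans (leeDr _ (lip_norm_ge0 f)).
  by rewrite (le_bigmax _ (fun q : 'I_4 => weighted_norm p (derive1n q f)) (Ordinal q4)).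
have lip u v : `|f u - f v| <= L * `|u - v|.
  have [->|uv] := eqVneq u v; first by rewrite !subrr !normr0 mulr0.
  rewrite -ler_pdivrMr ?normr_gt0 ?subr_eq0 // -lee_fin.
  apply: le_trans fL; apply: (@le_trans _ _ (lip_norm f)).
    by apply: ereal_sup_ubound; exists (u, v).
  by rewrite leeDl // bigmax_ge_id.
have wle q x : (q < 4)%N -> `|derive1n q f x| <= L * (1 + `|x|) ^+ p.
  move=> /w h; have := le_trans (weighted_norm_ub p (derive1n q f) x) h.
  by rewrite lee_fin mulrC ler_pdivrMr // exprn_gt0 // ltr_pwDl.
have L0 : 0 <= L by have := lip 1 0; rewrite subr0 normr1 mulr1; apply: le_trans.
split => //.
- by have := wle 0%N 0 isT; rewrite normr0 addr0 expr1n mulr1.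
- by move=> x; apply: lipschitz_derive1 => //; exact: (d 0%N).
- move=> M x y xM yM; apply: (bounded_derive1_lipschitz (d 1%N isT)) xM yM => u uM.
  apply: le_trans (wle 2%N u isT) _; rewrite ler_wpM2l // lerXn2r ?nnegrE //.
  + by rewrite addr_ge0 // (le_trans _ uM).
  + by rewrite lerD2l.
- by move=> x; exact: (wle 2%N).
Qed.

End Smooth.

Section DirectionalDerivative.
Context {R : realType} {n : nat}.
Variables (F G : nat -> 'I_n -> R -> R) (z0 : 'cV[R]_n) (t : nat) (i j : 'I_n).
Hypothesis FG_smooth : forall s l, (s < t)%N ->
  smooth2 (F s.+1 l) /\ smooth2 (G s.+1 l).

(** A directional derivative sees only the restriction to a line, so the whole
    computation takes place in one real variable. *)
Lemma derive_along_line (V : normedModType R) (f : V -> R) (v a : V) d :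
  is_derive (0 : R) 1 (fun h : R => f (h *: v + a)) d -> 'D_v f a = d.
Proof.
move=> [_ <-]; rewrite /derive; congr (lim (_ @ 0^')).
by apply/funext => h /=; rewrite [h%:A]mulr1 addr0 scale0r add0r.
Qed.

Let V : 'M[R]_n := sym_dir i j.

Lemma is_derive_chain (f g : R -> R) (x b : R) : derivable f (g x) 1 ->
  is_derive x 1 g b -> is_derive x 1 (fun h => f (g h)) (derive1 f (g x) * b).
Proof.
move=> df dg; apply: is_derive1_comp.
by rewrite derive1E; apply: derivableP.
Qed.

Lemma is_derive_mul (f g : R -> R) (x a b : R) : is_derive x 1 f a ->
  is_derive x 1 g b -> is_derive x 1 (fun h => f h * g h) (a * g x + f x * b).
Proof.
move=> df dg; have := is_deriveM df dg.
by rewrite /GRing.scale /= => h; apply: is_derive_eq h _; rewrite addrC mulrC.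
Qed.

Lemma is_derive_add (f g : R -> R) (x a b : R) : is_derive x 1 f a ->
  is_derive x 1 g b -> is_derive x 1 (fun h => f h + g h) (a + b).
Proof. by move=> df dg; apply: is_deriveD. Qed.

Lemma is_derive_mulmx (M : R -> 'M[R]_n) (v : R -> 'cV[R]_n) (x : R) (M' : 'M[R]_n)
    (v' : 'cV[R]_n) k :
  (forall a b, is_derive x 1 (fun h => M h a b) (M' a b)) ->
  (forall a, is_derive x 1 (fun h => v h a 0) (v' a 0)) ->
  is_derive x 1 (fun h => (M h *m v h) k 0) ((M' *m v x + M x *m v') k 0).
Proof.
move=> dM dv.
have -> : (fun h => (M h *m v h) k 0) =
    \sum_(l < n) (fun h => M h k l * v h l 0).
  by apply/funext => h; rewrite mxE fct_sumE.
rewrite !mxE -big_split /=; apply: is_derive_sum => l.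
exact: is_derive_mul.
Qed.

Lemma is_derive_line A (h : R) a b :
  is_derive h 1 (fun h : R => (h *: V + A) a b) (V a b).
Proof.
have -> : (fun h : R => (h *: V + A) a b) = (fun h => h * V a b + A a b).
  by apply/funext => u; rewrite !mxE.
have dV : is_derive h 1 (fun=> V a b) 0 by exact: is_derive_cst.
have dA : is_derive h 1 (fun=> A a b) 0 by exact: is_derive_cst.
have did : is_derive h 1 (fun u : R => u) 1 by exact: is_derive_id.
by apply: is_derive_eq (is_derive_add (is_derive_mul did dV) dA) _; ring.
Qed.

Lemma is_derive_state A s k (h : R) : (s <= t)%N ->
  is_derive h 1 (fun h : R => state F G z0 (h *: V + A) s k 0)
    (dstate F G z0 i j (h *: V + A) s k 0).
Proof.
elim: s k => [k _|s ih k st].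
  by rewrite /state /= mxE; exact: is_derive_cst.
have dz l := ih l (ltnW st).
have -> : (fun h : R => state F G z0 (h *: V + A) s.+1 k 0) = fun h =>
   ((h *: V + A) *m coordwise (F s.+1) (state F G z0 (h *: V + A) s)) k 0
   + G s.+1 k (state F G z0 (h *: V + A) s k 0).
  by apply/funext => u; rewrite {1}/state /= mxE [coordwise (G _) _ _ _]mxE.
have dG := is_derive_chain ((FG_smooth k st).2.1 _) (dz k).
have dF l := is_derive_chain ((FG_smooth l st).1.1 _) (dz l).
have dAF := @is_derive_mulmx (fun h => h *: V + A)
  (fun h => coordwise (F s.+1) (state F G z0 (h *: V + A) s)) h V
  (had (slope F G z0 F (h *: V + A) s) (dstate F G z0 i j (h *: V + A) s)) k.
apply: is_derive_eq.
  apply: is_derive_add dG; apply: dAF; first by move=> a b; exact: is_derive_line.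
  move=> l; rewrite !mxE.
  have -> : (fun h0 : R => coordwise (F s.+1) (state F G z0 (h0 *: V + A) s) l 0)
    = (fun h0 => F s.+1 l (state F G z0 (h0 *: V + A) s l 0)).
    by apply/funext => u; rewrite mxE.
  exact: dF.
have addE (a b : 'cV[R]_n) : (a + b) k 0 = a k 0 + b k 0 by rewrite mxE.
rewrite /= /step !addE [had (slope F G z0 G _ _) _ _ _]mxE.
by rewrite [slope F G z0 G _ _ _ _]mxE; ring.
Qed.

(** The derivative of [dstate] has one term from the propagated second
    derivative, the two [curv] terms from the slopes, and the direction term
    twice: once from the matrix inside [step], once from the moving state. *)
Lemma is_derive_dstate A s k (h : R) : (s <= t)%N ->
  is_derive h 1 (fun h : R => dstate F G z0 i j (h *: V + A) s k 0)
    (d2state F G z0 i j (h *: V + A) s k 0).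
Proof.
elim: s k => [k _|s ih k st].
  by rewrite /= !mxE; exact: is_derive_cst.
pose B (u : R) := u *: V + A.
have dz l := is_derive_state A l h (ltnW st).
have ddz l := ih l (ltnW st).
have slopes (E : nat -> 'I_n -> R -> R) l : smooth2 (E s.+1 l) -> is_derive h 1
    (fun u => had (slope F G z0 E (B u) s) (dstate F G z0 i j (B u) s) l 0)
    ((had (curv F G z0 E (B h) s) (had (dstate F G z0 i j (B h) s)
       (dstate F G z0 i j (B h) s)) + had (slope F G z0 E (B h) s)
        (d2state F G z0 i j (B h) s)) l 0).
  move=> [_ [dE _]].
  have -> : (fun u => had (slope F G z0 E (B u) s) (dstate F G z0 i j (B u) s) l 0)
    = fun u => derive1 (E s.+1 l) (state F G z0 (B u) s l 0)
               * dstate F G z0 i j (B u) s l 0.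
    by apply/funext => u; rewrite !mxE.
  apply: is_derive_eq.
    exact: is_derive_mul (is_derive_chain (dE _) (dz l)) (ddz l).
  by rewrite !mxE; ring.
have -> : (fun u : R => dstate F G z0 i j (u *: V + A) s.+1 k 0) = fun u =>
   (B u *m had (slope F G z0 F (B u) s) (dstate F G z0 i j (B u) s)) k 0
   + had (slope F G z0 G (B u) s) (dstate F G z0 i j (B u) s) k 0
   + (V *m coordwise (F s.+1) (state F G z0 (B u) s)) k 0.
  by apply/funext => u; rewrite /= /step mxE mxE.
have dG := slopes G k (FG_smooth k st).2.
have dF l := slopes F l (FG_smooth l st).1.
have dBF : is_derive h 1 (fun u => (B u *m had (slope F G z0 F (B u) s)
    (dstate F G z0 i j (B u) s)) k 0) _ := is_derive_mulmx k (is_derive_line A h) dF.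
have dc l : is_derive h 1 (fun u : R => coordwise (F s.+1) (state F G z0 (B u) s) l 0)
    (had (slope F G z0 F (B h) s) (dstate F G z0 i j (B h) s) l 0).
  have -> : (fun u : R => coordwise (F s.+1) (state F G z0 (B u) s) l 0)
    = (fun u => F s.+1 l (state F G z0 (B u) s l 0)).
    by apply/funext => u; rewrite mxE.
  rewrite !mxE; exact: is_derive_chain ((FG_smooth l st).1.1 _) (dz l).
have d0 a b : is_derive h 1 (fun=> V a b) ((0 : 'M[R]_n) a b).
  by rewrite [X in is_derive _ _ _ X]mxE; exact: is_derive_cst.
have dVF : is_derive h 1
  (fun u => (V *m coordwise (F s.+1) (state F G z0 (B u) s)) k 0) _ :=
  is_derive_mulmx k d0 dc.
apply: is_derive_eq (is_derive_add (is_derive_add dBF dG) dVF) _.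
have addE (a b : 'cV[R]_n) : (a + b) k 0 = a k 0 + b k 0 by rewrite mxE.
rewrite /= -/(B h) /step !mulmxDr mul0mx add0r !addE.
have scE (a : R) (b : 'cV[R]_n) : (a *: b) k 0 = a * b k 0 by rewrite mxE.
by rewrite scE -/V; ring.
Qed.

Lemma dzE A k : dz F G z0 t i j k A = dstate F G z0 i j A t k 0.
Proof.
apply: derive_along_line; have := is_derive_state A k 0 (leqnn t).
by rewrite scale0r add0r.
Qed.

Lemma d2zE A k : d2z F G z0 t i j k A = d2state F G z0 i j A t k 0.
Proof.
have E : partial_sym i j (fun B => iterate F G z0 t B k 0) =
    fun B => dstate F G z0 i j B t k 0.
  by apply/funext => B; exact: dzE.
rewrite /d2z E.
apply: derive_along_line; have := is_derive_dstate A k 0 (leqnn t).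
by rewrite scale0r add0r.
Qed.

End DirectionalDerivative.

(** * Random matrices and independence *)

Section MatrixSigmaAlgebra.
Context {R : realType} {m n : nat}.

(** The sigma-algebra is the one of [sigma_mx], so that conditioning on a
    random matrix is conditioning on a map into this measurable space. *)
Let coordinates : set (set 'M[R]_(m, n)) :=
  g_sigma_preimage (fun k (M : 'M[R]_(m, n)) => mxvec M 0 k).

Let coordinates0 : coordinates set0.
Proof. exact: sigma_algebra0. Qed.

Let coordinatesC A : coordinates A -> coordinates (~` A).
Proof. exact: sigma_algebraC. Qed.

Let coordinatesU (f : (set 'M[R]_(m, n))^nat) :
  (forall i, coordinates (f i)) -> coordinates (\bigcup_i f i).
Proof. exact: sigma_algebra_bigcup. Qed.

HB.instance Definition _ := @isMeasurable.Build default_measure_display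
  'M[R]_(m, n) coordinates coordinates0 coordinatesC coordinatesU.

Lemma measurable_entry i j :
  measurable_fun [set: 'M[R]_(m, n)] (fun M => M i j).
Proof.
move=> _ Y mY; rewrite setTI; apply: sub_sigma_algebra.
rewrite -bigcup_seq /=; exists (mxvec_index i j) => /=.
  by rewrite mem_index_enum.
by exists Y => //; rewrite setTI; apply/seteqP; split => M /=; rewrite mxvecE.
Qed.

Lemma sigma_mxE (T : Type) (X : T -> 'M[R]_(m, n)) :
  g_sigma_preimage (fun k w => mxvec (X w) 0 k) =
  preimage_set_system setT X measurable.
Proof. exact: g_sigma_preimage_comp. Qed.

Lemma random_mxP d (T : measurableType d) (X : T -> 'M[R]_(m, n)) :
  random_mx X <-> measurable_fun setT X.
Proof.
split=> [mX|mX i j]; last exact: measurableT_comp (measurable_entry i j) mX.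
move=> _ Y mY; rewrite setTI.
suff : g_sigma_preimage (fun k w => mxvec (X w) 0 k) `<=` measurable.
  by rewrite sigma_mxE; apply; exists Y => //; rewrite setTI.
apply: smallest_sub; first exact: sigma_algebra_measurable.
rewrite -bigcup_seq /=; apply: bigcup_sub => k _ _ [B mB <-].
have [i [j kE]] : exists i j, k = mxvec_index i j.
  by case/mxvec_indexP: k => i j; exists i, j.
have -> : (fun w => mxvec (X w) 0 k) = (fun w => X w i j).
  by apply/funext => w; rewrite kE mxvecE.
exact: mX.
Qed.

End MatrixSigmaAlgebra.

Section Independence.
Context {d d1 d2 : measure_display} {T : measurableType d}
  {T1 : measurableType d1} {T2 : measurableType d2} {R : realType}.
Variable P : probability T R.
Local Open Scope ereal_scope.

Lemma measurable_integral_snd (Y : T -> T2) (f : T1 * T2 -> \bar R) :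
  measurable_fun setT Y -> measurable_fun setT f -> (forall u, 0 <= f u) ->
  measurable_fun setT (fun x => \int[P]_v f (x, Y v)).
Proof.
move=> mY mf f0.
pose Y' : {mfun T >-> T2} := HB.pack Y (isMeasurableFun.Build _ _ _ _ _ mY).
rewrite (_ : (fun x => _) = fubini_F (distribution P Y') f).
  exact: measurable_fun_fubini_tonelli_F.
apply/funext => x; rewrite /fubini_F ge0_integral_distribution //.
exact: measurableT_comp.
Qed.

Lemma integral_indep (X : T -> T1) (Y : T -> T2) (f : T1 * T2 -> \bar R) :
  measurable_fun setT X -> measurable_fun setT Y ->
  (forall B C, measurable B -> measurable C ->
     P (X @^-1` B `&` Y @^-1` C) = P (X @^-1` B) * P (Y @^-1` C)) ->
  measurable_fun setT f -> (forall u, 0 <= f u) ->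
  \int[P]_w f (X w, Y w) = \int[P]_w \int[P]_v f (X w, Y v).
Proof.
move=> mX mY indep mf f0.
have mXY : measurable_fun setT (fun w => (X w, Y w)).
  exact: measurable_fun_pair.
pose X' : {mfun T >-> T1} := HB.pack X (isMeasurableFun.Build _ _ _ _ _ mX).
pose Y' : {mfun T >-> T2} := HB.pack Y (isMeasurableFun.Build _ _ _ _ _ mY).
pose XY : {mfun T >-> (T1 * T2)%type} :=
  HB.pack (fun w => (X w, Y w)) (isMeasurableFun.Build _ _ _ _ _ mXY).
have e1 : \int[P]_w f (X w, Y w) = \int[distribution P XY]_u f u.
  by rewrite ge0_integral_distribution.
have e2 : \int[distribution P XY]_u f u =
    \int[distribution P X' \x distribution P Y']_u f u.
  apply: eq_measure_integral => A mA _; apply/esym.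
  by apply: product_measure_unique => // B C mB mC.
rewrite e1 e2 fubini_tonelli1 // ge0_integral_distribution.
- apply: eq_integral => w _ /=; rewrite /fubini_F ge0_integral_distribution //.
  exact: measurableT_comp.
- exact: measurable_fun_fubini_tonelli_F.
- by move=> x; apply: integral_ge0.
Qed.

End Independence.

Lemma indep_set_of_pi d d' (T : measurableType d) (T' : measurableType d')
    (R : realType) (P : probability T R) (D : set T) (Y : T -> T')
    (G : set (set T')) :
  measurable D -> measurable_fun setT Y -> measurable = <<s G >> ->
  setI_closed G -> G setT ->
  (forall C, G C -> P (D `&` Y @^-1` C) = (P D * P (Y @^-1` C))%E) ->
  forall C, measurable C -> P (D `&` Y @^-1` C) = (P D * P (Y @^-1` C))%E.
Proof.
move=> mD mY mG GI GT DG C mC.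
pose Y' : {mfun T >-> T'} := HB.pack Y (isMeasurableFun.Build _ _ _ _ _ mY).
have PD : P D = (fine (P D))%:E by rewrite fineK // fin_num_measure.
pose r : {nonneg R} := NngNum (fine_ge0 (measure_ge0 P D)).
have := @measure_unique _ R T' G (fun=> setT) mG GI (fun=> GT) _
  (pushforward (mrestr P mD) Y') (mscale r (distribution P Y')) _ _ C mC.
have E1 S : pushforward (mrestr P mD) Y S = P (D `&` Y @^-1` S).
  by rewrite /pushforward /mrestr setIC.
have E2 S : mscale r (distribution P Y') S = (P D * P (Y @^-1` S))%E.
  by rewrite /mscale /= -PD.
rewrite -E1 -E2 /=; apply => //.
- by rewrite bigcup_const.
- by move=> S GS; rewrite E1 E2 DG.
- by move=> _; rewrite E1 preimage_setT setIT ltey_eq fin_num_measure.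
Qed.

Section EntryIndependence.
Context {d : measure_display} {T : measurableType d} {R : realType}.
Variables (P : probability T R) (n : nat) (A0 : T -> 'M[R]_n).
Hypotheses (A0_meas : random_mx A0) (A0_sym : forall w, (A0 w)^T = A0 w).
Hypothesis A0_indep :
  mutually_indep P [set u : 'I_n * 'I_n | (u.1 <= u.2)%N]%SET
    (fun u w => A0 w u.1 u.2).

(** By symmetry the mirror image of the entry has to be erased with it before
    what remains is independent of the entry. *)
Definition erase (u : 'I_n * 'I_n) (M : 'M[R]_n) : 'M[R]_n :=
  \matrix_(a, b) (if ((a, b) == u) || ((b, a) == u) then 0 else M a b).

Definition box (b : 'I_n -> 'I_n -> set R) : set 'M[R]_n :=
  [set M | forall i j, b i j (M i j)].

Definition boxes : set (set 'M[R]_n) :=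
  [set S | exists2 b, (forall i j, measurable (b i j)) & S = box b].

Lemma measurable_box b : (forall i j, measurable (b i j)) ->
  measurable (box b).
Proof.
move=> mb; rewrite (_ : box b = \big[setI/setT]_(u : 'I_n * 'I_n)
    ((fun M : 'M[R]_n => M u.1 u.2) @^-1` b u.1 u.2)).
  apply: bigsetI_measurable => u _.
  by rewrite -[X in measurable X]setTI; apply: measurable_entry.
rewrite -bigcap_seq; apply/seteqP; split=> M /= h.
  by move=> u _; apply: h.
by move=> i j; apply: (h (i, j)); rewrite /= mem_index_enum.
Qed.

Lemma sigma_boxes : measurable = <<s boxes >>.
Proof.
apply/seteqP; split; last first.
  apply: smallest_sub; first exact: sigma_algebra_measurable.
  by move=> _ [b mb ->]; exact: measurable_box.
apply: smallest_sub; first exact: smallest_sigma_algebra.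
rewrite -bigcup_seq /=; apply: bigcup_sub => k _ _ [B mB <-].
apply: sub_sigma_algebra; case/mxvec_indexP: k => a c.
exists (fun i j => if (i == a) && (j == c) then B else setT).
  by move=> i j; case: ifP.
rewrite setTI; apply/seteqP; split=> M /=.
  by rewrite mxvecE => h i j; case: ifP => // /andP[/eqP -> /eqP ->].
by rewrite mxvecE => /(_ a c); rewrite !eqxx.
Qed.

Lemma boxesI : setI_closed boxes.
Proof.
move=> _ _ [b mb ->] [c mc ->]; exists (fun i j => b i j `&` c i j).
  by move=> i j; exact: measurableI.
apply/seteqP; split=> M /=; first by move=> [h1 h2] i j; split.
by move=> h; split=> i j; have [] := h i j.
Qed.

Lemma measurable_erase u : measurable_fun setT (fun w => erase u (A0 w)).
Proof.
apply/random_mxP => i j; under eq_fun do rewrite mxE.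
by case: (_ || _); [exact: measurable_cst|exact: A0_meas].
Qed.

(** It suffices to test the erased matrix on boxes, a pi-system generating its
    sigma-algebra; there the event is a conjunction over the upper triangle to
    which the mutual independence of the entries applies. *)
Lemma entry_indep (u : 'I_n * 'I_n) B C : (u.1 <= u.2)%N ->
  measurable B -> measurable C ->
  P ((fun w => A0 w u.1 u.2) @^-1` B `&` (fun w => erase u (A0 w)) @^-1` C) =
  (P ((fun w => A0 w u.1 u.2) @^-1` B)
   * P ((fun w => erase u (A0 w)) @^-1` C))%E.
Proof.
move=> up mB mC.
have mD : measurable ((fun w => A0 w u.1 u.2) @^-1` B).
  by rewrite -[X in measurable X]setTI; apply: A0_meas.
apply: (indep_set_of_pi mD (measurable_erase u) sigma_boxes boxesI) => //.
  by exists (fun _ _ => setT) => //; apply/seteqP; split.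
move=> _ [b mb ->].
(* the condition on the erased matrix, expressed on the upper triangle *)
pose bu (v : 'I_n * 'I_n) : set R :=
  if v == u then [set x | b u.1 u.2 0 /\ b u.2 u.1 0]
  else b v.1 v.2 `&` b v.2 v.1.
pose bu' v := if v == u then B `&` bu v else bu v.
pose J := [set v : 'I_n * 'I_n | (v.1 <= v.2)%N]%SET.
have mbu v : measurable (bu v).
  rewrite /bu; case: eqP => _; last exact: measurableI.
  have [h|h] := pselect (b u.1 u.2 0 /\ b u.2 u.1 0).
    by rewrite (_ : [set x | _] = setT) //; apply/seteqP; split.
  by rewrite (_ : [set x | _] = set0) //; apply/seteqP; split.
have mbu' v : measurable (bu' v).
  by rewrite /bu'; case: eqP => // _; exact: measurableI.
have uJ : u \in J by rewrite inE.
have eraseE w : box b (erase u (A0 w)) <->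
    (forall v, v \in J -> bu v (A0 w v.1 v.2)).
  have symA i j : A0 w i j = A0 w j i by rewrite -[in LHS]A0_sym mxE.
  have mirror (i j : 'I_n) : (i <= j)%N -> (j, i) == u -> (i, j) == u.
    move=> ij /eqP jiu; move: up; rewrite -jiu /= => ji.
    by rewrite (val_inj (anti_leq (introT andP (conj ij ji)))).
  split=> [h [i j]|h i j].
    rewrite inE /= => ij; have := h i j; have := h j i; rewrite !mxE /bu.
    have [iju|iju] /= := eqVneq (i, j) u.
      by rewrite orbT -iju /= => hj hi; split.
    have /negPf -> : (j, i) != u by apply: contraNneq iju => /eqP/(mirror _ _ ij).
    by rewrite (symA j i) /=; split.
  rewrite mxE; case/orP: (leq_total i j) => ij.
    have := h (i, j); rewrite inE /= => /(_ ij); rewrite /bu.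
    have [iju|iju] /= := eqVneq (i, j) u; first by rewrite -iju /= => -[].
    have /negPf -> : (j, i) != u by apply: contraNneq iju => /eqP/(mirror _ _ ij).
    by case.
  have := h (j, i); rewrite inE /= => /(_ ij); rewrite /bu.
  have [iju|iju] /= := eqVneq (j, i) u; first by rewrite orbT -iju /= => -[].
  have /negPf -> : (i, j) != u by apply: contraNneq iju => /eqP/(mirror _ _ ij).
  by rewrite (symA j i) => -[].
have P1 : P ((fun w => erase u (A0 w)) @^-1` box b) =
    (\prod_(v in J) P ((fun w => A0 w v.1 v.2) @^-1` bu v))%E.
  rewrite -(A0_indep (J := J)) //; congr (P _); apply/seteqP; split=> w /=; by move/eraseE.
have P2 : P ((fun w => A0 w u.1 u.2) @^-1` B `&` (fun w => erase u (A0 w)) @^-1` box b) =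
    (\prod_(v in J) P ((fun w => A0 w v.1 v.2) @^-1` bu' v))%E.
  rewrite -(A0_indep (J := J)) //; congr (P _); apply/seteqP; split=> w /=.
    move=> [wB /eraseE h] v vJ; rewrite /bu'; case: eqP => [vu|_]; last exact: h.
    by split; [rewrite vu|exact: h].
  move=> h; split; first by have := h u uJ; rewrite /bu' eqxx => -[].
  by apply/eraseE => v /h; rewrite /bu'; case: eqP => // _ [].
rewrite P1 P2 (bigD1 u) //= [X in _ = (_ * X)%E](bigD1 u) //= muleA.
congr (_ * _)%E; last first.
  by apply: eq_bigr => v /andP[_ /negPf vu]; rewrite /bu' vu.
rewrite /bu' /bu eqxx.
have [h|h] := pselect (b u.1 u.2 0 /\ b u.2 u.1 0).
  rewrite (_ : [set x | _] = setT); last by apply/seteqP; split.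
  by rewrite setIT preimage_setT probability_setT mule1.
rewrite (_ : [set x | _] = set0); last by apply/seteqP; split.
by rewrite setI0 preimage_set0 measure0 mule0.
Qed.

End EntryIndependence.

(** * Sub-Gaussian tails *)

(** The linear term disappears in the expectation of a centered variable,
    which leaves an exponential moment of Gaussian size. *)
Lemma expR_le_square {R : realType} (x : R) :
  expR x <= x + expR (2 * x ^+ 2).
Proof.
have [x1|x1] := lerP x 1; last first.
  apply: le_trans (_ : expR (2 * x ^+ 2) <= _); last by rewrite lerDr; lra.
  by rewrite ler_expR; nra.
apply: (@le_trans _ _ (x + (1 + 2 * x ^+ 2))); last first.
  by rewrite lerD2l expR_ge1Dx.
pose y := expR (- (x / 2)).
have y0 : 0 < y := expR_gt0 _.
have yx : 1 - x / 2 <= y by rewrite /y expR_ge1Dx.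
have ex : expR x * y ^+ 2 = 1.
  by rewrite /y -expRM_natl -expRD (_ : x + _ = 0) ?expR0 //; field.
have y20 : 0 < y ^+ 2 by rewrite exprn_gt0.
rewrite -(ler_pM2r y20) ex.
have q : (1 - x / 2) ^+ 2 <= y ^+ 2 by rewrite lerXn2r ?nnegrE //; [lra|exact: ltW].
have p0 : 0 <= x + (1 + 2 * x ^+ 2) by nra.
apply: le_trans (ler_wpM2l p0 q).
have -> : (x + (1 + 2 * x ^+ 2)) * (1 - x / 2) ^+ 2 =
  1 + x ^+ 2 * ((1 - x) * (5 / 4 - x / 2)) by field.
by rewrite lerDl mulr_ge0 ?sqr_ge0 // mulr_ge0; lra.
Qed.

Lemma measurable_le_set {d} {T : measurableType d} {R : realType}
    (f g : T -> R) :
  measurable_fun setT f -> measurable_fun setT g ->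
  measurable [set w | f w <= g w].
Proof.
move=> mf mg; have mgf := measurable_funB mg mf.
have := mgf measurableT `[0, +oo[%classic (measurable_itv _).
rewrite setTI; congr measurable; apply/seteqP; split=> w /=;
  by rewrite in_itv /= andbT subr_ge0.
Qed.

Section SubGaussian.
Context {d : measure_display} {T : measurableType d} {R : realType}.
Variable P : probability T R.

Lemma mgf_le (X : T -> R) (K c : R) : 0 <= K -> measurable_fun setT X ->
  {ae P, forall w, `|X w| <= K} -> ('E_P[X] = 0)%E ->
  (\int[P]_w (expR (c * X w))%:E <= (expR (2 * (c * K) ^+ 2))%:E)%E.
Proof.
move=> K0 mX XK EX.
(* truncation turns the almost sure bound into a pointwise one *)
pose Y w : R := Num.max (- K) (Num.min K (X w)).
have mY : measurable_fun setT Y.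
  by apply: measurable_maxr => //; apply: measurable_minr.
have YK w : `|Y w| <= K.
  rewrite ler_norml /Y le_max lexx ge_max ge_min lexx andbT /=.
  by rewrite (le_trans _ K0) // oppr_le0.
have YX : {ae P, forall w, X w = Y w}.
  apply: filterS XK => w; rewrite ler_norml => /andP[h1 h2].
  by rewrite /Y min_r // max_r.
have mexp (Z : T -> R) : measurable_fun setT Z ->
    measurable_fun setT (fun w => (expR (c * Z w))%:E).
  move=> mZ; apply/measurable_EFinP; apply: measurableT_comp => //.
  exact: measurable_funM.
have -> : (\int[P]_w (expR (c * X w))%:E = \int[P]_w (expR (c * Y w))%:E)%E.
  apply: ae_eq_integral => //; [exact: mexp|exact: mexp|].
  by apply: filterS YX => w -> _.
have iY : P.-integrable setT (EFin \o Y).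
  apply: measurable_bounded_integrable => //.
    by rewrite ltey_eq fin_num_measure.
  exists K; split; first exact: num_real.
  by move=> x Kx w _; apply: le_trans (YK w) (ltW Kx).
have EY : (\int[P]_w (Y w)%:E = 0)%E.
  rewrite -EX unlock; apply: ae_eq_integral => //.
  - exact/measurable_EFinP.
  - exact/measurable_EFinP.
  - by apply: filterS YX => w -> _.
pose C := expR (2 * (c * K) ^+ 2).
have iC : P.-integrable setT (EFin \o cst C).
  exact: finite_measure_integrable_cst.
have icY : P.-integrable setT (fun w => c%:E * (Y w)%:E)%E by exact: integrableZl.
have isum : P.-integrable setT (fun w => c%:E * (Y w)%:E + C%:E)%E.
  exact: integrableD.
apply: (@le_trans _ _ (\int[P]_w (c%:E * (Y w)%:E + C%:E))%E).
  have h w : expR (c * Y w) <= c * Y w + C.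
    apply: le_trans (expR_le_square _) _; rewrite lerD2l ler_expR ler_wpM2l //.
    rewrite !exprMn ler_wpM2l ?sqr_ge0 // -(real_normK (num_real (Y w))).
    by rewrite lerXn2r ?nnegrE.
  apply: le_integral => //; last by move=> w _; rewrite lee_fin.
  apply: le_integrable isum => //; first exact: mexp.
  move=> w _ /=; rewrite lee_fin ger0_norm ?expR_ge0 //.
  exact: le_trans (h w) (ler_norm _).
rewrite integralD // integralZl // EY mule0 add0e.
rewrite integral_cst //.
by rewrite [X in (_ * X)%E](@probability_setT _ _ _ P) mule1.
Qed.

Variables (n : nat) (A0 : T -> 'M[R]_n) (K : R).
Hypotheses (A0_meas : random_mx A0) (A0_sym : forall w, (A0 w)^T = A0 w).
Hypothesis A0_indep :
  mutually_indep P [set u : 'I_n * 'I_n | (u.1 <= u.2)%N]%SET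
    (fun u w => A0 w u.1 u.2).
Hypothesis A0_mean : forall i j : 'I_n, (i <= j)%N ->
  ('E_P[fun w => A0 w i j] = 0)%E.
Hypothesis K_ge2 : 2 <= K.
Hypothesis A0_le : {ae P, forall w, forall i j, `|A0 w i j| <= K}.
Implicit Types (M : 'M[R]_n) (u v : 'I_n * 'I_n).

Let K0 : 0 <= K. Proof. exact: le_trans (ler0n _ 2) K_ge2. Qed.

(** Conditionally on all the other entries, entry [u] is centered and
    bounded, so that its exponential moment is at most that of a Gaussian. *)
Lemma erase_one_entry u (h c : 'M[R]_n -> R) : (u.1 <= u.2)%N ->
  measurable_fun setT h -> measurable_fun setT c ->
  (forall M, 0 <= h M) ->
  (forall M, h (erase u M) = h M) -> (forall M, c (erase u M) = c M) ->
  (\int[P]_w (h (A0 w) *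
      expR (c (A0 w) * A0 w u.1 u.2 - 2 * (c (A0 w) * K) ^+ 2))%:E
   <= \int[P]_w (h (A0 w))%:E)%E.
Proof.
move=> up mh mc h0 hu cu.
pose X w := A0 w u.1 u.2; pose Y w := erase u (A0 w).
have mX : measurable_fun setT X by exact: A0_meas.
have mY : measurable_fun setT Y by exact: measurable_erase.
pose f (z : 'M[R]_n * R) : \bar R :=
  (h z.1 * expR (c z.1 * z.2 - 2 * (c z.1 * K) ^+ 2))%:E.
have mf : measurable_fun setT f.
  apply/measurable_EFinP; apply: measurable_funM.
    exact: measurableT_comp mh measurable_fst.
  have mc1 : measurable_fun setT (fun z : 'M[R]_n * R => c z.1).
    exact: measurableT_comp mc measurable_fst.
  apply: measurableT_comp => //; apply: measurable_funB.
    exact: measurable_funM.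
  apply: measurable_funM => //; apply: measurable_funX.
  exact: measurable_funM.
have f0 z : (0 <= f z)%E by rewrite lee_fin mulr_ge0 ?expR_ge0.
rewrite (eq_integral (fun w => f (Y w, X w))); last first.
  by move=> w _; rewrite /f /Y /= hu cu.
rewrite (integral_indep mY mX) //.
- apply: ge0_le_integral => //.
  + by move=> w _; apply: integral_ge0 => v _; rewrite lee_fin mulr_ge0 ?expR_ge0.
  + exact: measurableT_comp (measurable_integral_snd P mX mf f0) mY.
  + apply/measurable_EFinP; apply: measurableT_comp mh _; exact/random_mxP.
  + move=> w _; rewrite /f /=.
    set a := h _; set b := c _.
    have -> : (\int[P]_v (a * expR (b * X v - 2 * (b * K) ^+ 2))%:E =
      (a * expR (- (2 * (b * K) ^+ 2)))%:E * \int[P]_v (expR (b * X v))%:E)%E.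
      rewrite -ge0_integralZl_EFin //.
      * by apply: eq_integral => v _; rewrite expRD -EFinM [in RHS]mulrAC mulrA.
      * apply/measurable_EFinP; apply: measurableT_comp => //.
        exact: measurable_funM.
      * by rewrite mulr_ge0 ?expR_ge0 // /a.
    apply: (@le_trans _ _ ((a * expR (- (2 * (b * K) ^+ 2)))%:E *
        (expR (2 * (b * K) ^+ 2))%:E)%E).
      rewrite lee_wpmul2l ?lee_fin ?mulr_ge0 ?expR_ge0 ?h0 //.
      apply: mgf_le => //; last exact: A0_mean.
      by apply: filterS A0_le => v; apply.
    by rewrite -EFinM lee_fin -mulrA -expRD addNr expR0 mulr1 /a /Y hu.
- move=> B C mB mC; rewrite setIC muleC.
  exact: (entry_indep A0_meas A0_sym A0_indep).
Qed.

Lemma erase_other u v M : (u.1 <= u.2)%N -> (v.1 <= v.2)%N -> v != u ->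
  erase u M v.1 v.2 = M v.1 v.2.
Proof.
case: u v => [a b] [a' b'] /= ab ab' ne; rewrite mxE (negPf ne) /=.
case: eqP => // e; case: e => e1 e2; subst a b; move: ne.
by rewrite (val_inj (anti_leq (introT andP (conj ab ab')))) eqxx.
Qed.

(** The entries are integrated out one after the other; since no coefficient
    sees any of the entries of the sum, the quadratic compensators factor. *)
Lemma exp_moment_sum (I : eqType) (s : seq I) (u : I -> 'I_n * 'I_n)
    (c : I -> 'M[R]_n -> R) :
  uniq (map u s) -> (forall i, i \in s -> ((u i).1 <= (u i).2)%N) ->
  (forall i, measurable_fun setT (c i)) ->
  (forall i j M, j \in s -> c i (erase (u j) M) = c i M) ->
  (\int[P]_w (expR (\sum_(i <- s) (c i (A0 w) * A0 w (u i).1 (u i).2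
       - 2 * (c i (A0 w) * K) ^+ 2)))%:E <= 1)%E.
Proof.
move=> us up mc; elim: s us up => [_ _ _|i s ih /= /andP[iNs us] up inv].
  under eq_integral do rewrite big_nil expR0.
  by rewrite integral_cst // [X in (_ * X)%E](@probability_setT _ _ _ P) mule1.
pose h M := expR (\sum_(i <- s) (c i M * M (u i).1 (u i).2
       - 2 * (c i M * K) ^+ 2)).
have ups j : j \in s -> ((u j).1 <= (u j).2)%N.
  by move=> js; apply: up; rewrite inE js orbT.
have upi : ((u i).1 <= (u i).2)%N by apply: up; rewrite mem_head.
apply: le_trans (ih us ups _); last by move=> j k M ks; apply: inv; rewrite inE ks orbT.
under eq_integral do rewrite big_cons expRD mulrC.
apply: (erase_one_entry (h := h)) => //.
- apply: measurableT_comp => //; apply: measurable_sum => j.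
  apply: measurable_funB.
    by apply: measurable_funM => //; exact: measurable_entry.
  apply: measurable_funM => //; apply: measurable_funX.
  exact: measurable_funM.
- by move=> M; rewrite expR_ge0.
- move=> M; congr expR; apply: eq_big_seq => j js.
  rewrite inv ?mem_head // (erase_other _ upi (ups _ js)) //.
  by apply: contraNneq iNs => <-; apply: map_f.
- by move=> M; rewrite inv // mem_head.
Qed.

(** Normalised coefficients that do not depend on the entries they multiply
    give a sum with a Gaussian tail. *)
Lemma hoeffding (I : eqType) (s : seq I) (u : I -> 'I_n * 'I_n)
    (c : I -> 'M[R]_n -> R) (lam : R) :
  uniq (map u s) -> (forall i, i \in s -> ((u i).1 <= (u i).2)%N) ->
  (forall i, measurable_fun setT (c i)) ->
  (forall i j M, j \in s -> c i (erase (u j) M) = c i M) ->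
  (forall M, \sum_(i <- s) c i M ^+ 2 <= 1) -> 0 <= lam ->
  (P [set w | (lam * K <= \sum_(i <- s) c i (A0 w) * A0 w (u i).1 (u i).2)%R]
   <= (expR (- (lam ^+ 2 / 8)))%:E)%E.
Proof.
move=> us up mc inv c1 lam0.
have Kp : 0 < K by apply: lt_le_trans K_ge2.
(* the minimiser in [r] of [2 * (r * K) ^+ 2 - r * lam * K] *)
pose r := lam / (4 * K).
have mA : measurable_fun setT A0 by exact/random_mxP.
have mS : measurable_fun setT
    (fun w => \sum_(i <- s) c i (A0 w) * A0 w (u i).1 (u i).2).
  apply: measurable_sum => i; apply: measurable_funM; last exact: A0_meas.
  exact: measurableT_comp (mc i) mA.
set E := [set w | _].
have mE : measurable E.
  exact: measurable_le_set (measurable_cst (lam * K)) mS.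
pose Z w := \sum_(i <- s) (r * c i (A0 w) * A0 w (u i).1 (u i).2
       - 2 * (r * c i (A0 w) * K) ^+ 2).
have mZ : measurable_fun setT (fun w => (expR (Z w))%:E).
  apply/measurable_EFinP; apply: measurableT_comp => //.
  apply: measurable_sum => i.
  have mci : measurable_fun setT (fun w => r * c i (A0 w)).
    by apply: measurable_funM => //; exact: measurableT_comp (mc i) mA.
  apply: measurable_funB; first by apply: measurable_funM => //; exact: A0_meas.
  apply: measurable_funM => //; apply: measurable_funX.
  exact: measurable_funM.
have Z1 : (\int[P]_w (expR (Z w))%:E <= 1)%E.
  apply: (exp_moment_sum (c := fun i M => r * c i M)) => //.
    by move=> i; apply: measurable_funM.
  by move=> i j M js; rewrite inv.
have EZ w : E w -> lam ^+ 2 / 8 <= Z w.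
  rewrite /E /= => Ew.
  have -> : Z w = r * (\sum_(i <- s) c i (A0 w) * A0 w (u i).1 (u i).2)
      - 2 * (r * K) ^+ 2 * \sum_(i <- s) c i (A0 w) ^+ 2.
    rewrite /Z sumrB !mulr_sumr; congr (_ - _); apply: eq_bigr => i _; ring.
  have r0 : 0 <= r by rewrite divr_ge0 // mulr_ge0.
  have h1 : r * (lam * K) <= r * (\sum_(i <- s) c i (A0 w) * A0 w (u i).1 (u i).2).
    by rewrite ler_wpM2l.
  have h2 : 2 * (r * K) ^+ 2 * \sum_(i <- s) c i (A0 w) ^+ 2 <= 2 * (r * K) ^+ 2.
    by rewrite ler_piMr // mulr_ge0 ?sqr_ge0.
  have h3 : r * (lam * K) = lam ^+ 2 / 4 by rewrite /r; field; rewrite gt_eqF.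
  have h4 : 2 * (r * K) ^+ 2 = lam ^+ 2 / 8 by rewrite /r; field; rewrite gt_eqF.
  lra.
have -> : P E = (\int[P]_w (\1_E w)%:E)%E by rewrite integral_indic // setIT.
apply: (@le_trans _ _ (\int[P]_w ((expR (- (lam ^+ 2 / 8)))%:E * (expR (Z w))%:E))%E).
  apply: ge0_le_integral => //.
  - by apply/measurable_EFinP; exact: measurable_indic.
  - exact: emeasurable_funM.
  - move=> w _; rewrite -EFinM lee_fin indicE.
    case: (boolP (w \in E)) => [|_]; last by rewrite mulr_ge0 ?expR_ge0.
    rewrite inE => /EZ h; rewrite -expRD -[leLHS]expR0 ler_expR; lra.
rewrite ge0_integralZl_EFin ?expR_ge0 //.
by rewrite -[leRHS]mule1 lee_wpmul2l // lee_fin expR_ge0.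
Qed.

Lemma hoeffding_abs (I : eqType) (s : seq I) (u : I -> 'I_n * 'I_n)
    (c : I -> 'M[R]_n -> R) (lam : R) :
  uniq (map u s) -> (forall i, i \in s -> ((u i).1 <= (u i).2)%N) ->
  (forall i, measurable_fun setT (c i)) ->
  (forall i j M, j \in s -> c i (erase (u j) M) = c i M) ->
  (forall M, \sum_(i <- s) c i M ^+ 2 <= 1) -> 0 <= lam ->
  (P [set w | (lam * K <= `|\sum_(i <- s) c i (A0 w) * A0 w (u i).1 (u i).2|)%R]
   <= (2 * expR (- (lam ^+ 2 / 8)))%:E)%E.
Proof.
move=> us up mc inv c1 lam0.
have h1 := hoeffding us up mc inv c1 lam0.
have h2 : (P [set w | (lam * K <= \sum_(i <- s) - c i (A0 w) * A0 w (u i).1 (u i).2)%R]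
   <= (expR (- (lam ^+ 2 / 8)))%:E)%E.
  apply: (hoeffding (c := fun i M => - c i M)) => //.
  - by move=> i; exact: measurableT_comp.
  - by move=> i j M js; rewrite inv.
  - by move=> M; under eq_bigr do rewrite sqrrN.
have mA : measurable_fun setT A0 by exact/random_mxP.
have mS b : measurable [set w | lam * K <=
    \sum_(i <- s) (-1) ^+ b * c i (A0 w) * A0 w (u i).1 (u i).2].
  apply: measurable_le_set => //.
  apply: measurable_sum => i; apply: measurable_funM; last exact: A0_meas.
  by apply: measurable_funM => //; exact: measurableT_comp (mc i) mA.
have := mS 0%N; under eq_set do under eq_bigr do rewrite expr0 mul1r.
have := mS 1%N; under eq_set do under eq_bigr do rewrite expr1 mulN1r.
set S2 := [set w | _] in h2 *; set S1 := [set w | _] in h1 * => m2 m1.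
rewrite mulr_natl mulr2n EFinD.
apply: le_trans (leeD h1 h2); apply: le_trans (measureU2 _ m1 m2).
rewrite (_ : [set w | _] = S1 `|` S2) //.
apply/seteqP; split=> w; rewrite /S1 /S2 /= ler_normr.
  case/orP; first by left.
  by right; under eq_bigr do rewrite mulNr; rewrite sumrN.
case=> [->//|]; under eq_bigr do rewrite mulNr.
by rewrite sumrN => ->; rewrite orbT.
Qed.

End SubGaussian.

(** * Measurability of the iteration *)

Section RandomMatrices.
Context {d : measure_display} {T : measurableType d} {R : realType}.

Lemma random_cst m n (M : 'M[R]_(m, n)) : random_mx (fun _ : T => M).
Proof. by move=> i j; exact: measurable_cst. Qed.

Lemma random_addmx m n (X Y : T -> 'M[R]_(m, n)) :
  random_mx X -> random_mx Y -> random_mx (fun w => X w + Y w).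
Proof.
move=> mX mY i j; under eq_fun do rewrite mxE.
exact: measurable_funD.
Qed.

Lemma random_scalemx m n (a : T -> R) (X : T -> 'M[R]_(m, n)) :
  measurable_fun setT a -> random_mx X -> random_mx (fun w => a w *: X w).
Proof.
move=> ma mX i j; under eq_fun do rewrite mxE.
exact: measurable_funM.
Qed.

Lemma random_mulmx m n p (X : T -> 'M[R]_(m, n)) (Y : T -> 'M[R]_(n, p)) :
  random_mx X -> random_mx Y -> random_mx (fun w => X w *m Y w).
Proof.
move=> mX mY i j; under eq_fun do rewrite mxE.
by apply: measurable_sum => k; apply: measurable_funM.
Qed.

Lemma random_had n (X Y : T -> 'cV[R]_n) :
  random_mx X -> random_mx Y -> random_mx (fun w => had (X w) (Y w)).
Proof.
move=> mX mY i j; under eq_fun do rewrite mxE.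
exact: measurable_funM.
Qed.

Lemma random_coordwise n (f : 'I_n -> R -> R) (X : T -> 'cV[R]_n) :
  (forall l, measurable_fun setT (f l)) -> random_mx X ->
  random_mx (fun w => coordwise f (X w)).
Proof.
move=> mf mX i j; under eq_fun do rewrite mxE.
exact: measurableT_comp.
Qed.

Lemma random_loo n k (X : T -> 'M[R]_n) :
  random_mx X -> random_mx (fun w => loo k (X w)).
Proof.
move=> mX i j; under eq_fun do rewrite mxE.
by case: (_ || _); [exact: measurable_cst|exact: mX].
Qed.

Lemma measurable_nrm n (X : T -> 'cV[R]_n) :
  random_mx X -> measurable_fun setT (fun w => nrm (X w)).
Proof.
move=> mX.
have ms : measurable_fun setT (fun w => dot (X w) (X w)).
  by apply: measurable_sum => k; apply: measurable_funM.
have mq : measurable_fun setT (@Num.sqrt R).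
  by apply: continuous_measurable_fun; exact: sqrt_continuous.
exact: measurableT_comp mq ms.
Qed.

Lemma smooth2_measurable (f : R -> R) : smooth2 f ->
  [/\ measurable_fun setT f, measurable_fun setT (derive1 f)
    & measurable_fun setT (derive1 (derive1 f))].
Proof.
move=> [d0 [d1 c2]]; split.
- exact: continuous_measurable_fun (derivable_continuous d0).
- exact: continuous_measurable_fun (derivable_continuous d1).
- exact: continuous_measurable_fun c2.
Qed.

Section Iteration.
Variables (n t : nat) (F G : nat -> 'I_n -> R -> R).
Hypothesis FG_smooth : forall s l, (s < t)%N ->
  smooth2 (F s.+1 l) /\ smooth2 (G s.+1 l).
Variables (A : T -> 'M[R]_n) (z : T -> 'cV[R]_n).
Hypotheses (mA : random_mx A) (mz : random_mx z).

Lemma random_state s : (s <= t)%N ->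
  random_mx (fun w => state F G (z w) (A w) s).
Proof.
elim: s => [//|s ih] st; rewrite /state /=.
apply: random_addmx.
  apply: random_mulmx => //; apply: random_coordwise; last exact: ih (ltnW st).
  by move=> l; have [] := smooth2_measurable (FG_smooth l st).1.
apply: random_coordwise; last exact: ih (ltnW st).
by move=> l; have [] := smooth2_measurable (FG_smooth l st).2.
Qed.

Lemma random_slope (E : nat -> 'I_n -> R -> R) s : (s < t)%N ->
  (forall l, smooth2 (E s.+1 l)) ->
  random_mx (fun w => slope F G (z w) E (A w) s).
Proof.
move=> st Es; apply: (random_coordwise (f := fun l => derive1 (E s.+1 l))).
  by move=> l; have [] := smooth2_measurable (Es l).
exact: random_state (ltnW st).
Qed.

Lemma random_curv (E : nat -> 'I_n -> R -> R) s : (s < t)%N ->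
  (forall l, smooth2 (E s.+1 l)) ->
  random_mx (fun w => curv F G (z w) E (A w) s).
Proof.
move=> st Es.
apply: (random_coordwise (f := fun l => derive1 (derive1 (E s.+1 l)))).
  by move=> l; have [] := smooth2_measurable (Es l).
exact: random_state (ltnW st).
Qed.

Let F_smooth s st l := (@FG_smooth s l st).1.
Let G_smooth s st l := (@FG_smooth s l st).2.

Lemma random_step s x : (s < t)%N -> random_mx x ->
  random_mx (fun w => step F G (z w) (A w) s (x w)).
Proof.
move=> st mx; apply: random_addmx.
  apply: random_mulmx => //; apply: random_had => //.
  exact: random_slope (F_smooth st).
apply: random_had => //; exact: random_slope (G_smooth st).
Qed.

Lemma random_prop s m x : (s + m <= t)%N -> random_mx x ->
  random_mx (fun w => prop F G (z w) (A w) s m (x w)).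
Proof.
elim: m => [//|m ih] smt mx; rewrite addnS in smt.
by apply: random_step => //; apply: ih => //; exact: ltnW.
Qed.

Variables i j : 'I_n.

Lemma random_dstate s : (s <= t)%N ->
  random_mx (fun w => dstate F G (z w) i j (A w) s).
Proof.
elim: s => [_|s ih st]; first exact: random_cst.
apply: random_addmx; first exact: random_step (ih (ltnW st)).
apply: random_mulmx; first exact: random_cst.
apply: random_coordwise; last exact: random_state (ltnW st).
by move=> l; have [] := smooth2_measurable (F_smooth st l).
Qed.

Lemma random_d2state s : (s <= t)%N ->
  random_mx (fun w => d2state F G (z w) i j (A w) s).
Proof.
elim: s => [_|s ih st]; first exact: random_cst.
have md := random_dstate (ltnW st).
apply: random_addmx; first exact: random_step (ih (ltnW st)).
have mdd := random_had md md.
apply: random_addmx.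
  apply: random_mulmx => //; apply: random_had => //.
  exact: random_curv (F_smooth st).
apply: random_addmx.
  by apply: random_had => //; exact: random_curv (G_smooth st).
apply: random_scalemx => //; apply: random_mulmx; first exact: random_cst.
by apply: random_had => //; exact: random_slope (F_smooth st).
Qed.

End Iteration.
End RandomMatrices.

(** * The operator norm *)

Section Net.
Context {R : realType} {n : nat}.

(** Points of the grid [(1/n) Z^n] with coordinates in [[-1, 1]]. A grid this
    fine makes the rounding errors harmless even when estimated with the
    trivial bound [sqrt n * K] on the norm, and its cardinality is still only
    [exp (O (n log n))]. *)
Definition grid (g : {ffun 'I_n -> 'I_n.*2.+1}) : 'cV[R]_n :=
  \col_a (((g a)%:R - n%:R) / n%:R).

Lemma grid_approx (x : 'cV[R]_n) : (0 < n)%N -> nrm x <= 1 ->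
  exists g, nrm (x - grid g) <= (Num.sqrt n%:R)^-1.
Proof.
move=> n0 x1; have nR : 0 < n%:R :> R by rewrite ltr0n.
pose r a : R := n%:R * (x a 0 + 1).
have xa a : 0 <= x a 0 + 1 <= 2.
  by have := le_trans (entry_nrm x a) x1; rewrite ler_norml => /andP[? ?]; lra.
have r0 a : 0 <= r a by rewrite mulr_ge0 ?(ltW nR) //; have /andP[] := xa a.
have tr a := truncn_itv (r0 a).
have rn a : (Num.truncn (r a) < n.*2.+1)%N.
  rewrite ltnS -(ler_nat R); have /andP[h _] := tr a; apply: le_trans h _.
  rewrite /r -muln2 natrM ler_wpM2l ?(ltW nR) //; by have /andP[] := xa a.
exists [ffun a => Ordinal (rn a)].
have rt : Num.sqrt n%:R * (Num.sqrt n%:R * n%:R^-1) = 1 :> R.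
  by rewrite mulrA -expr2 sqr_sqrtr ?(ltW nR) // mulfV ?gt_eqF.
have rt0 : 0 < Num.sqrt n%:R :> R by rewrite sqrtr_gt0.
have -> : (Num.sqrt n%:R)^-1 = Num.sqrt n%:R * n%:R^-1 :> R.
  by apply: (mulfI (lt0r_neq0 rt0)); rewrite rt mulfV // gt_eqF.
apply: nrm_le_const => [|a]; first by rewrite invr_ge0 ltW.
rewrite !mxE ffunE /=; have /andP[h1 h2] := tr a.
have -> : x a 0 - ((Num.truncn (r a))%:R - n%:R) / n%:R =
    (r a - (Num.truncn (r a))%:R) / n%:R by rewrite /r; field; rewrite gt_eqF.
rewrite normrM (gtr0_norm (_ : 0 < n%:R^-1)) ?invr_gt0 //.
rewrite ler_piMl ?invr_ge0 ?(ltW nR) // ger0_norm ?subr_ge0 //.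
by move: h2; rewrite -natr1; lra.
Qed.

Variables (A : 'M[R]_n) (K lam : R).
Hypotheses (n_gt0 : (0 < n)%N) (K_ge0 : 0 <= K) (lam_ge1 : 1 <= lam).
Hypothesis A_le : forall a b, `|A a b| <= K / Num.sqrt n%:R.
Hypothesis A_grid : forall g h, nrm (grid g) <= 2 -> nrm (grid h) <= 2 ->
  `|dot (grid g) (A *m grid h)| <= 8 * lam * K.

Let rt : R := Num.sqrt n%:R.
Let rt0 : 0 < rt. Proof. by rewrite sqrtr_gt0 ltr0n. Qed.
Let rt1 : rt^-1 <= 1.
Proof. by rewrite invf_le1 // -[leLHS]sqrtr1 ler_wsqrtr // (ler_nat _ 1). Qed.

Let crude v : nrm (A *m v) <= rt * (K * nrm v).
Proof.
apply: nrm_le_const; first by rewrite mulr_ge0 ?nrm_ge0.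
by move=> k; exact: mulmx_row_le.
Qed.

(** Bilinear forms at unit vectors are rounded to the grid at a cost [3 * K],
    and [v] is tested against [A *m v]. *)
Lemma op_bound_of_grid : op_bounded K lam A.
Proof.
have unit_case x y : nrm x <= 1 -> nrm y <= 1 ->
    `|dot x (A *m y)| <= 11 * lam * K.
  move=> x1 y1.
  have [g xg] := grid_approx n_gt0 x1; have [h yh] := grid_approx n_gt0 y1.
  have near (u v : 'cV[R]_n) : nrm u <= 1 -> nrm (u - v) <= rt^-1 -> nrm v <= 2.
    move=> u1 uv; rewrite -[v](subrK u); apply: le_trans (nrmD _ _) _.
    by rewrite -nrmN opprB; have := le_trans uv rt1; lra.
  have g2 := near _ _ x1 xg; have h2 := near _ _ y1 yh.
  have -> : dot x (A *m y) = dot (grid g) (A *m grid h)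
      + dot (x - grid g) (A *m y) + dot (grid g) (A *m (y - grid h)).
    rewrite mulmxBr -[- grid g]scaleN1r -[- (A *m grid h)]scaleN1r.
    by rewrite dotDl dotDr dotZl dotZr; ring.
  have e1 : `|dot (x - grid g) (A *m y)| <= K.
    apply: le_trans (dot_cauchy _ _) _.
    apply: (@le_trans _ _ (rt^-1 * (rt * K))).
      apply: ler_pM; rewrite ?nrm_ge0 //.
      by apply: le_trans (crude _) _; rewrite ler_wpM2l ?(ltW rt0) // ler_piMr.
    by rewrite mulKf ?gt_eqF.
  have e2 : `|dot (grid g) (A *m (y - grid h))| <= 2 * K.
    apply: le_trans (dot_cauchy _ _) _.
    apply: ler_pM; rewrite ?nrm_ge0 //.
    apply: le_trans (crude _) _.
    apply: (@le_trans _ _ (rt * (K * rt^-1))).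
      by rewrite ler_wpM2l ?(ltW rt0) // ler_wpM2l.
    by rewrite mulrCA mulfV ?gt_eqF // mulr1.
  have KlK : K <= lam * K by rewrite ler_peMl.
  apply: le_trans (ler_normD _ _) _.
  apply: le_trans (lerD (ler_normD _ _) (lexx _)) _.
  by have := A_grid g2 h2; rewrite -!mulrA; lra.
move=> v; set u := A *m v.
have [u0|u0] := eqVneq (nrm u) 0.
  by rewrite u0 !mulr_ge0 ?nrm_ge0 // (le_trans ler01).
have v0 : nrm v != 0.
  apply: contra_neq u0 => /nrm_eq0 v0; rewrite /u v0 mulmx0; exact: nrm0.
have up : 0 < nrm u by rewrite lt_def u0 nrm_ge0.
have vp : 0 < nrm v by rewrite lt_def v0 nrm_ge0.
have normed (x : 'cV[R]_n) : 0 < nrm x -> nrm ((nrm x)^-1 *: x) <= 1.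
  move=> xp; rewrite nrmZ ger0_norm ?invr_ge0 ?(ltW xp) //.
  by rewrite mulVf ?gt_eqF.
have := unit_case _ _ (normed u up) (normed v vp).
rewrite -scalemxAr -/u dotZl dotZr -nrm_sqr ger0_norm; last first.
  by rewrite !mulr_ge0 ?invr_ge0 ?nrm_ge0 ?sqr_ge0.
rewrite (_ : (nrm u)^-1 * ((nrm v)^-1 * nrm u ^+ 2) = nrm u / nrm v).
  by rewrite ler_pdivrMr.
by field; rewrite u0 v0.
Qed.

End Net.

(** * Probability of the good event *)

Lemma union_bound {d} {T : measurableType d} {R : realType}
    (P : probability T R) (I : Type) (s : seq I) (E : I -> set T) (p : R) :
  (forall i, measurable (E i)) -> (forall i, (P (E i) <= p%:E)%E) ->
  measurable (\big[setU/set0]_(i <- s) E i) /\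
  (P (\big[setU/set0]_(i <- s) E i) <= ((size s)%:R * p)%:E)%E.
Proof.
move=> mE PE; elim: s => [|i s [mU PU]].
  by rewrite big_nil measure0 mul0r.
rewrite big_cons; split; first exact: measurableU.
apply: le_trans (measureU2 _ (mE i) mU) _.
by rewrite /= -natr1 addrC mulrDl mul1r EFinD leeD.
Qed.

Lemma random_mx_comp {d} {T : measurableType d} {R : realType} m n m' n'
    (f : 'M[R]_(m, n) -> 'M[R]_(m', n')) (X : T -> 'M[R]_(m, n)) :
  random_mx f -> random_mx X -> random_mx (fun w => f (X w)).
Proof.
move=> /random_mxP mf /random_mxP mX; apply/random_mxP.
exact: measurableT_comp mf mX.
Qed.

Section GoodEvent.
Context {d : measure_display} {T : measurableType d} {R : realType}.
Variables (P : probability T R) (n : nat) (A0 : T -> 'M[R]_n) (K lam : R).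
Hypotheses (A0_meas : random_mx A0) (A0_sym : forall w, (A0 w)^T = A0 w).
Hypothesis A0_indep :
  mutually_indep P [set u : 'I_n * 'I_n | (u.1 <= u.2)%N]%SET
    (fun u w => A0 w u.1 u.2).
Hypothesis A0_mean : forall i j : 'I_n, (i <= j)%N ->
  ('E_P[fun w => A0 w i j] = 0)%E.
Hypothesis K_ge2 : 2 <= K.
Hypothesis A0_le : {ae P, forall w, forall i j, `|A0 w i j| <= K}.
Hypotheses (n_ge2 : (2 <= n)%N) (lam_ge1 : 1 <= lam).

Let rt : R := Num.sqrt n%:R.
Let n_gt0 : (0 < n)%N. Proof. exact: ltnW. Qed.
Let rt0 : 0 < rt. Proof. by rewrite sqrtr_gt0 ltr0n. Qed.
Let K0 : 0 <= K. Proof. exact: le_trans (ler0n _ 2) K_ge2. Qed.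
Let lam0 : 0 <= lam. Proof. exact: le_trans ler01 lam_ge1. Qed.

Definition scaled w : 'M[R]_n := rt^-1 *: A0 w.

Lemma random_scaled : random_mx scaled.
Proof. by apply: random_scalemx. Qed.

Let mul_scaled w v k : (scaled w *m v : 'cV[R]_n) k 0 =
  rt^-1 * \sum_l A0 w k l * v l 0.
Proof. by rewrite /scaled -scalemxAl !mxE. Qed.

(** Without row [k] the matrix determines [v], so that the pairing is a sum of
    independent entries with frozen coefficients. Normalising these by
    [nrm v `^ (-1)] is harmless at [v = 0], where the power vanishes and the
    strict inequality fails. *)
Lemma row_tail k (v : 'M[R]_n -> 'cV[R]_n) : random_mx v ->
  let E := [set w | lam * K / rt * nrm (v (loo k (scaled w)))
     < `|(scaled w *m v (loo k (scaled w))) k 0| ] in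
  measurable E /\ (P E <= (2 * expR (- (lam ^+ 2 / 8)))%:E)%E.
Proof.
move=> mv E.
pose vk M := v (loo k (rt^-1 *: M)).
have mid : random_mx (fun M : 'M[R]_n => M) by move=> i j; exact: measurable_entry.
have mvk : random_mx vk.
  by apply: (random_mx_comp mv); apply: random_loo; apply: random_scalemx.
have mvw : random_mx (fun w => v (loo k (scaled w))).
  by apply: (random_mx_comp mv); apply: random_loo; exact: random_scaled.
have mE : measurable E.
  have -> : E = ~` [set w | `|(scaled w *m v (loo k (scaled w))) k 0| <=
       lam * K / rt * nrm (v (loo k (scaled w)))].
    by apply/seteqP; split=> w; rewrite /E /= ltNge => /negP.
  apply: measurableC; apply: measurable_le_set.
    by apply: measurableT_comp => //; exact: (random_mulmx random_scaled mvw).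
  by apply: measurable_funM => //; exact: measurable_nrm.
split=> //.
pose c l M := vk M l 0 * nrm (vk M) `^ (-1).
(* the representative of the entry [(k, l)] in the upper triangle *)
pose u (l : 'I_n) : 'I_n * 'I_n := if (l <= k)%N then (l, k) else (k, l).
have uE l w : A0 w (u l).1 (u l).2 = A0 w k l.
  rewrite /u; case: ifP => //= _.
  by rewrite -[in LHS](A0_sym w) mxE.
have u_inj : injective u.
  move=> a b; rewrite /u; case: (leqP a k) => ak; case: (leqP b k) => bk [] //.
    by move=> _ e2; move: bk; rewrite -e2 ltnn.
  by move=> _ e2; move: ak; rewrite e2 ltnn.
have uu : uniq (map u (index_enum 'I_n)) by rewrite map_inj_uniq // index_enum_uniq.
have up l : l \in index_enum 'I_n -> ((u l).1 <= (u l).2)%N.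
  by move=> _; rewrite /u; case: (leqP l k) => lk //=; exact: ltnW.
have mc l : measurable_fun setT (c l).
  have mq : measurable_fun setT (fun M => nrm (vk M) `^ (-1)).
    have mp : measurable_fun setT (fun x : R => x `^ (-1)) by exact: measurable_powR.
    exact: measurableT_comp mp (measurable_nrm mvk).
  exact: measurable_funM (mvk l 0) mq.
have inv l j M : j \in index_enum 'I_n -> c l (erase (u j) M) = c l M.
  move=> _; rewrite /c /vk; suff -> : loo k (rt^-1 *: erase (u j) M) =
    loo k (rt^-1 *: M) by [].
  apply/matrixP => a b; rewrite !mxE.
  case: (boolP ((a == k) || (b == k))) => //; rewrite negb_or => /andP[ak bk].
  by rewrite /u; case: (leqP j k) => _; rewrite !xpair_eqE (negPf ak) (negPf bk)
    ?andbF ?andFb.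
have c1 M : \sum_(l <- index_enum 'I_n) c l M ^+ 2 <= 1.
  under eq_bigr do rewrite exprMn.
  rewrite -mulr_suml -nrm_sqrE powR_inv1 ?nrm_ge0 // -exprMn.
  have [->|h] := eqVneq (nrm (vk M)) 0; first by rewrite mul0r expr0n.
  by rewrite mulfV // expr1n.
apply: le_trans (hoeffding_abs A0_meas A0_sym A0_indep A0_mean K_ge2 A0_le
  uu up mc inv c1 lam0).
apply: le_measure; rewrite ?inE //.
  apply: measurable_le_set => //; apply: measurableT_comp => //.
  apply: measurable_sum => l; apply: measurable_funM; last exact: A0_meas.
  by apply: measurableT_comp (mc l) _; exact/random_mxP.
move=> w; rewrite /E /=.
under eq_bigr do rewrite uE.
rewrite mul_scaled normrM (gtr0_norm (_ : 0 < rt^-1)) ?invr_gt0 //.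
set x := v _; set S := \sum_(l < n) _ => h.
have x0 : 0 < nrm x.
  rewrite lt_def nrm_ge0 andbT; apply: contraTneq h => x0.
  by rewrite /S (nrm_eq0 x0) big1 ?normr0 ?mulr0 ?nrm0 ?mulr0 ?ltxx // => l _;
     rewrite mxE mulr0.
have -> : \sum_(l < n) c l (A0 w) * A0 w k l = S / nrm x.
  rewrite /S mulr_suml; apply: eq_bigr => l _.
  by rewrite /c powR_inv1 ?nrm_ge0 // /vk -/(scaled w) -/x; ring.
rewrite normrM (gtr0_norm (_ : 0 < (nrm x)^-1)) ?invr_gt0 // ler_pdivlMr //.
move: h; rewrite [X in X < _](_ : _ = rt^-1 * (lam * K * nrm x)); last by ring.
by rewrite ltr_pM2l ?invr_gt0 // => /ltW.
Qed.

(** A bilinear form is a sum over the upper triangle with coefficients of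
    total square at most [4 * 16]; the matrix being divided by [sqrt n], the
    tail gains a factor [n] in the exponent. *)
Lemma grid_tail g h : nrm (grid g : 'cV[R]_n) <= 2 ->
  nrm (grid h : 'cV[R]_n) <= 2 ->
  let E := [set w | 8 * lam * K < `|dot (grid g) (scaled w *m grid h)| ] in
  measurable E /\ (P E <= (2 * expR (- (n%:R * lam ^+ 2 / 8)))%:E)%E.
Proof.
move=> g2 h2 E; set y : 'cV[R]_n := grid g in g2 E *; set x := grid h in h2 E *.
have mdot : measurable_fun setT (fun w => dot y (scaled w *m x)).
  apply: measurable_sum => a; apply: measurable_funM => //.
  by apply: (random_mulmx random_scaled); exact: random_cst.
have mE : measurable E.
  have -> : E = ~` [set w | `|dot y (scaled w *m x)| <= 8 * lam * K].
    by apply/seteqP; split=> w; rewrite /E /= ltNge => /negP.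
  apply: measurableC; apply: measurable_le_set => //.
  exact: measurableT_comp.
split=> //.
pose s := seq.filter (fun v : 'I_n * 'I_n => (v.1 <= v.2)%N) (index_enum _).
pose cc (v : 'I_n * 'I_n) : R := 8^-1 * (y v.1 0 * x v.2 0
  + (v.1 != v.2)%:R * (y v.2 0 * x v.1 0)).
pose c (v : 'I_n * 'I_n) (M : 'M[R]_n) := cc v.
have uu : uniq (map id s) by rewrite map_id filter_uniq // index_enum_uniq.
have up v : v \in s -> (v.1 <= v.2)%N by rewrite mem_filter => /andP[].
have swap (f : 'I_n * 'I_n -> R) : \sum_v f (v.2, v.1) = \sum_v f v.
  rewrite [RHS](reindex_inj (h := fun v => (v.2, v.1))) //.
  by move=> [a b] [a' b'] /= [-> ->].
have c1 (M : 'M[R]_n) : \sum_(v <- s) c v M ^+ 2 <= 1.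
  pose f v : R := (y v.1 0 * x v.2 0) ^+ 2.
  have fs : \sum_v f v = nrm y ^+ 2 * nrm x ^+ 2.
    rewrite !nrm_sqrE big_distrl /= -(pair_bigA _ (fun a b => f (a, b))) /=.
    apply: eq_bigr => a _; rewrite big_distrr /=; apply: eq_bigr => b _.
    by rewrite /f /= exprMn.
  have sq (a b : R) (e : bool) :
      (a + e%:R * b) ^+ 2 <= 2 * a ^+ 2 + 2 * b ^+ 2.
    have := sqr_ge0 (a - b); have := sqr_ge0 a; have := sqr_ge0 b.
    by case: e; rewrite /= ?mul1r ?mul0r ?addr0 sqrrB ?sqrrD; lra.
  have f16 : \sum_v f v <= 16.
    have e4 (r : R) : 0 <= r -> r <= 2 -> r ^+ 2 <= 4 by move=> r0 r2; nra.
    rewrite fs (_ : 16 = 4 * 4); last by ring.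
    by rewrite ler_pM ?sqr_ge0 ?e4 ?nrm_ge0.
  apply: (@le_trans _ _ (\sum_v 64^-1 * (2 * f v + 2 * f (v.2, v.1)))).
    rewrite /s big_filter big_mkcond /=; apply: ler_sum => v _.
    have fv : 0 <= f v by exact: sqr_ge0.
    have fv' : 0 <= f (v.2, v.1) by exact: sqr_ge0.
    case: ifP => _; last by rewrite mulr_ge0 ?invr_ge0 // addr_ge0 // mulr_ge0.
    rewrite /c /cc exprMn (_ : 8^-1 ^+ 2 = 64^-1); last by field.
    by rewrite ler_wpM2l ?invr_ge0 // /f /=.
  rewrite -mulr_sumr big_split /= -!mulr_sumr swap; lra.
have mc v : measurable_fun setT (c v) by exact: measurable_cst.
have lr0 : 0 <= lam * rt by rewrite mulr_ge0 // ltW.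
have := hoeffding_abs A0_meas A0_sym A0_indep A0_mean K_ge2 A0_le uu up mc
  (fun _ _ _ _ => erefl) c1 lr0.
rewrite exprMn sqr_sqrtr ?ler0n // [lam ^+ 2 * _]mulrC; apply: le_trans.
apply: le_measure; rewrite ?inE //.
  apply: measurable_le_set => //; apply: measurableT_comp => //.
  apply: measurable_sum => v; apply: measurable_funM => //; exact: A0_meas.
move=> w; rewrite /E /= => lt.
have <- : 8^-1 * (rt * dot y (scaled w *m x)) =
    \sum_(v <- s) c v (A0 w) * A0 w v.1 v.2.
  have symA a b : A0 w a b = A0 w b a by rewrite -[in LHS]A0_sym mxE.
  pose f (v : 'I_n * 'I_n) := y v.1 0 * x v.2 0 * A0 w v.1 v.2.
  have -> : rt * dot y (scaled w *m x) = \sum_v f v.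
    rewrite -(pair_bigA _ (fun a b => f (a, b))) /= mulr_sumr.
    apply: eq_bigr => a _; rewrite mul_scaled mulrCA mulVKf ?gt_eqF //.
    by rewrite mulr_sumr; apply: eq_bigr => b _; rewrite /f /=; ring.
  pose f1 (v : 'I_n * 'I_n) : R := if (v.1 <= v.2)%N then f v else 0.
  pose f2 (v : 'I_n * 'I_n) : R := if (v.2 < v.1)%N then f v else 0.
  have -> : \sum_v f v = \sum_v (f1 v + f2 (v.2, v.1)).
    rewrite big_split /= swap -big_split; apply: eq_bigr => v _.
    by rewrite /f1 /f2 ltnNge; case: (_ <= _)%N; rewrite /= ?addr0 ?add0r.
  rewrite /s big_filter [RHS]big_mkcond mulr_sumr; apply: eq_bigr => -[a b] _.
  rewrite /f1 /f2 /c /cc /f /=; case: (ltngtP a b) => ab.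
  - have -> : (a != b) by apply: contraTneq ab => ->; rewrite ltnn.
    by rewrite (symA b a) /=; ring.
  - by rewrite addr0 mulr0.
  - by rewrite (val_inj ab) eqxx /=; ring.
rewrite normrM (gtr0_norm (_ : 0 < 8^-1)) ?invr_gt0 // normrM (gtr0_norm rt0).
move: lt; rewrite -(ltr_pM2l rt0) -(ltr_pM2l (_ : 0 < 8^-1 :> R)) ?invr_gt0 //.
by move=> /ltW; apply: le_trans; rewrite le_eqVlt; apply/orP; left; apply/eqP; field.
Qed.

End GoodEvent.

Section TestVectors.
Context {R : realType} {n : nat}.
Variables (F G : nat -> 'I_n -> R -> R) (z : 'cV[R]_n) (t : nat).

(** The finitely many vectors whose pairings with the rows a good matrix
    controls, as functions of the matrix from which the row is deleted; the
    value [0] only fills in for pairs of times beyond the horizon. *)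
Definition test_vector (j : ('I_t + 'I_n * 'I_t * 'I_t * bool)%type)
    (M : 'M[R]_n) : 'cV[R]_n :=
  match j with
  | inl s => coordwise (F s.+1) (state F G z M s)
  | inr (i, s, m, b) =>
      if (s + m < t)%N then
        had (slope F G z F M (s + m))
            (prop F G z M s m (if b then M *m evec i else evec i))
      else 0
  end.

Hypothesis FG_smooth : forall s l, (s < t)%N ->
  smooth2 (F s.+1 l) /\ smooth2 (G s.+1 l).

Lemma random_test_vector j : random_mx (test_vector j).
Proof.
have mid : random_mx (fun M : 'M[R]_n => M) by move=> a b; exact: measurable_entry.
have mz : random_mx (fun _ : 'M[R]_n => z) by exact: random_cst.
rewrite /test_vector; case: j => [s|[[[i s] m] b]] /=.
  apply: random_coordwise.
    by move=> l; have [] := smooth2_measurable (FG_smooth l (ltn_ord s)).1.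
  exact: (random_state FG_smooth mid mz (ltnW (ltn_ord s))).
case: (boolP (s + m < t)%N) => [smt|_] /=; last exact: random_cst.
have msrc : random_mx (fun M : 'M[R]_n => if b then M *m evec i else evec i).
  by case: b => /=; [exact: random_mulmx mid (random_cst _)|exact: random_cst].
apply: random_had.
  by apply: (random_slope FG_smooth mid mz smt) => l; exact: (FG_smooth l smt).1.
exact: (random_prop FG_smooth mid mz (ltnW smt)).
Qed.

Variables (K lam : R) (A : 'M[R]_n).
Hypotheses (n_gt0 : (0 < n)%N) (K_ge0 : 0 <= K) (lam_ge1 : 1 <= lam).

Lemma good_matrix_of_tests :
  (forall a b, `|A a b| <= K / Num.sqrt n%:R) ->
  (forall g h, nrm (grid g : 'cV[R]_n) <= 2 -> nrm (grid h : 'cV[R]_n) <= 2 ->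
    `|dot (grid g) (A *m grid h)| <= 8 * lam * K) ->
  (forall k j, row_small K lam A k (test_vector j (loo k A))) ->
  good_matrix F G z K lam t A.
Proof.
move=> A_le A_grid A_row; split=> //.
- exact: op_bound_of_grid.
- by move=> k s st; exact: (A_row k (inl (Ordinal st))).
- move=> k i s m smt.
  have st : (s < t)%N := leq_ltn_trans (leq_addr m s) smt.
  have mt : (m < t)%N := leq_ltn_trans (leq_addl s m) smt.
  by have := A_row k (inr (i, Ordinal st, Ordinal mt, false)); rewrite /= smt.
- move=> k i s m smt.
  have st : (s < t)%N := leq_ltn_trans (leq_addr m s) smt.
  have mt : (m < t)%N := leq_ltn_trans (leq_addl s m) smt.
  by have := A_row k (inr (i, Ordinal st, Ordinal mt, true)); rewrite /= smt.
Qed.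

(** With [lam = sqrt n] every matrix with small entries is good, by the
    Cauchy-Schwarz inequality; this provides the crude bound used outside
    the likely event. *)
Lemma good_matrix_crude :
  (forall a b, `|A a b| <= K / Num.sqrt n%:R) ->
  good_matrix F G z K (Num.sqrt n%:R) t A.
Proof.
move=> A_le.
have rt0 : 0 < Num.sqrt n%:R :> R by rewrite sqrtr_gt0 ltr0n.
have rs k v : row_small K (Num.sqrt n%:R) A k v.
  rewrite /row_small [_ * K]mulrC mulfK ?gt_eqF //.
  exact: mulmx_row_le.
split=> // v.
apply: (@le_trans _ _ (Num.sqrt n%:R * (K * nrm v))).
  apply: nrm_le_const; first by rewrite mulr_ge0 ?nrm_ge0.
  by move=> k; exact: mulmx_row_le.
have : 0 <= Num.sqrt n%:R * (K * nrm v).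
  by rewrite !mulr_ge0 ?nrm_ge0 // ltW.
rewrite -!mulrA; lra.
Qed.

End TestVectors.

Section GoodEvent.
Context {d : measure_display} {T : measurableType d} {R : realType}.
Variables (P : probability T R) (n : nat) (A0 : T -> 'M[R]_n) (K lam : R).
Hypotheses (A0_meas : random_mx A0) (A0_sym : forall w, (A0 w)^T = A0 w).
Hypothesis A0_indep :
  mutually_indep P [set u : 'I_n * 'I_n | (u.1 <= u.2)%N]%SET
    (fun u w => A0 w u.1 u.2).
Hypothesis A0_mean : forall i j : 'I_n, (i <= j)%N ->
  ('E_P[fun w => A0 w i j] = 0)%E.
Hypothesis K_ge2 : 2 <= K.
Hypothesis A0_le : {ae P, forall w, forall i j, `|A0 w i j| <= K}.
Hypotheses (n_ge2 : (2 <= n)%N) (lam_ge1 : 1 <= lam).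
Hypothesis lam_ln : 96 * ln n%:R <= lam ^+ 2.
Variables (F G : nat -> 'I_n -> R -> R) (z : 'cV[R]_n) (t : nat).
Hypothesis FG_smooth : forall s l, (s < t)%N ->
  smooth2 (F s.+1 l) /\ smooth2 (G s.+1 l).

Let n_gt0 : (0 < n)%N. Proof. exact: ltnW. Qed.
Let nR0 : 0 < n%:R :> R. Proof. by rewrite ltr0n. Qed.

(** The grid has [exp (O (n log n))] points, which the tail
    [exp (- n lam ^ 2 / 8)] absorbs once [lam ^ 2] exceeds a multiple of
    [log n]. *)
Lemma grid_count :
  #|{: {ffun 'I_n -> 'I_n.*2.+1} * {ffun 'I_n -> 'I_n.*2.+1}}|%:R
    * (2 * expR (- (n%:R * lam ^+ 2 / 8))) <= 2 * expR (- (lam ^+ 2 / 8)) :> R.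
Proof.
rewrite card_prod card_ffun !card_ord -expnD addnn.
have c3 : (n.*2.+1 <= n ^ 3)%N.
  by move: n_ge2; clear; rewrite !expnS expn0; nia.
have nE : n%:R = expR (ln n%:R) :> R by rewrite lnK ?posrE.
have h : (n.*2.+1 ^ n.*2)%:R <= expR (6 * n%:R * ln n%:R) :> R.
  apply: (@le_trans _ _ ((n ^ 3) ^ n.*2)%:R).
    by rewrite ler_nat leq_exp2r // double_gt0.
  rewrite -expnM natrX {1}nE -expRM_natl ler_expR natrM -muln2 natrM.
  by rewrite le_eqVlt; apply/orP; left; apply/eqP; ring.
rewrite mulrCA; apply: ler_wpM2l => //.
apply: le_trans (ler_wpM2r (expR_ge0 _) h) _.
rewrite -expRD ler_expR.
have l1 : 6 * n%:R * ln n%:R <= n%:R * lam ^+ 2 / 16 :> R.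
  have := ler_wpM2l (ltW nR0) lam_ln; lra.
have l2 : 2 * lam ^+ 2 <= n%:R * lam ^+ 2.
  by rewrite ler_wpM2r ?sqr_ge0 // ler_nat.
lra.
Qed.

Lemma event_count :
  (n * (t + n * t * t * 2) * 2 + 2 <= 8 * n ^ 2 * 4 ^ t)%N.
Proof.
have t2 : (t <= 2 ^ t)%N by rewrite ltnW // ltn_expl.
have t4 : (t * t <= 4 ^ t)%N by rewrite -[4%N]/(2 * 2)%N expnMn leq_mul.
have t4' : (t <= 4 ^ t)%N.
  by apply: leq_trans t2 _; rewrite -[4%N]/(2 * 2)%N expnMn leq_pmulr ?expn_gt0.
have e_gt0 : (0 < 4 ^ t)%N by rewrite expn_gt0.
move: n_ge2 t4 t4' e_gt0; set e := (4 ^ t)%N; move: e; clear.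
move=> e n2 tt te e_gt0; rewrite !expnS expn0.
have e1 : (n * t <= n * n * e)%N by rewrite -mulnA leq_mul2l; apply/orP; right; nia.
have e2 : (n * n * (t * t) <= n * n * e)%N by rewrite leq_mul2l tt orbT.
have e0 : (2 <= n * n * e + n * n * e)%N.
  by move: e_gt0 n2; clear; nia.
by move: e0 e1 e2; clear; nia.
Qed.

(** The union bound over the grid points and the test vectors: there are about
    [n ^ 2 * t ^ 2] of the latter, whence the factor [4 ^+ t]. *)
Lemma good_event : exists Bad : set T,
  [/\ measurable Bad,
      (P Bad <= (8 * n%:R ^+ 2 * 4 ^+ t * expR (- (lam ^+ 2 / 8)))%:E)%E
    & forall w, ~ Bad w ->
        good_matrix F G z K lam t (scaled A0 w)
        /\ (forall a b, `|scaled A0 w a b| <= K / Num.sqrt n%:R)].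
Proof.
case: A0_le => N [mN PN Nsub].
have K0 : 0 <= K by rewrite (le_trans _ K_ge2).
pose J := ('I_n * ('I_t + 'I_n * 'I_t * 'I_t * bool))%type.
pose H := ({ffun 'I_n -> 'I_n.*2.+1} * {ffun 'I_n -> 'I_n.*2.+1})%type.
pose E1 (u : J) := [set w | lam * K / Num.sqrt n%:R
    * nrm (test_vector F G z u.2 (loo u.1 (scaled A0 w)))
  < `|(scaled A0 w *m test_vector F G z u.2 (loo u.1 (scaled A0 w))) u.1 0|].
pose E2 (u : H) := if (nrm (grid u.1 : 'cV[R]_n) <= 2)
    && (nrm (grid u.2 : 'cV[R]_n) <= 2)
  then [set w | 8 * lam * K < `|dot (grid u.1) (scaled A0 w *m grid u.2)| ]
  else set0.
have E1P u := row_tail A0_meas A0_sym A0_indep A0_mean K_ge2 A0_le n_ge2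
  lam_ge1 u.1 (random_test_vector z FG_smooth u.2).
have E2P u : measurable (E2 u) /\
    (P (E2 u) <= (2 * expR (- (n%:R * lam ^+ 2 / 8)))%:E)%E.
  rewrite /E2; case: ifP => [/andP[u1 u2]|_].
    exact: grid_tail.
  by rewrite measure0 lee_fin mulr_ge0 ?expR_ge0.
have [mU1 PU1] := union_bound (index_enum J) (fun u => (E1P u).1)
  (fun u => (E1P u).2).
have [mU2 PU2] := union_bound (index_enum H) (fun u => (E2P u).1)
  (fun u => (E2P u).2).
set U1 := \big[setU/set0]_(u <- index_enum J) _ in mU1 PU1.
set U2 := \big[setU/set0]_(u <- index_enum H) _ in mU2 PU2.
exists (N `|` (U1 `|` U2)); split.
- by apply: measurableU => //; exact: measurableU.
- apply: le_trans (measureU2 _ mN (measurableU _ _ mU1 mU2)) _.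
  rewrite [X in (X + _)%E]PN add0e.
  apply: le_trans (measureU2 _ mU1 mU2) _.
  apply: le_trans (leeD PU1 PU2) _.
  have enum_size (X : finType) : size (index_enum X) = #|X|.
    by rewrite -sum1_size -sum1_card; apply: eq_bigl.
  rewrite -EFinD lee_fin !enum_size.
  apply: le_trans (lerD (lexx _) grid_count) _.
  rewrite card_prod card_sum !card_prod !card_ord card_bool.
  rewrite mulrA -mulrDl ler_wpM2r ?expR_ge0 //.
  by rewrite -!natrM -natrD -!natrX -!natrM ler_nat event_count.
move=> w /not_orP[Nw /not_orP[U1w U2w]].
have w_le : forall a b, `|scaled A0 w a b| <= K / Num.sqrt n%:R.
  have h : forall i j, `|A0 w i j| <= K.
    by apply: contrapT => h; apply: Nw; exact: Nsub.
  move=> a b; rewrite mxE normrM mulrC [`|_^-1|]ger0_norm ?invr_ge0 ?sqrtr_ge0 //.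
  by rewrite ler_wpM2r ?invr_ge0 ?sqrtr_ge0.
split=> //; apply: good_matrix_of_tests => //.
- move=> g h g2 h2; rewrite leNgt; apply/negP => lt; apply: U2w.
  rewrite /U2 -bigcup_seq; exists (g, h); first by rewrite /= mem_index_enum.
  by rewrite /E2 /= g2 h2.
- move=> k j; rewrite /row_small leNgt; apply/negP => lt; apply: U1w.
  by rewrite /U1 -bigcup_seq; exists (k, j); first by rewrite /= mem_index_enum.
Qed.

End GoodEvent.

(** * Conditioning on the initial vector *)

Section Conditioning.
Context {d : measure_display} {T : measurableType d} {R : realType}.
Variable P : probability T R.
Local Open Scope ereal_scope.

(** One half of the almost sure uniqueness of versions. On the set where the
    second version exceeds the first by a fixed amount and the first one is
    bounded, the integrals are equal and finite, so this set is null. *)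
Lemma cond_exp_version_le (G0 : set (set T)) (f g1 g2 : T -> \bar R) :
  <<s G0>> `<=` measurable ->
  is_cond_exp P <<s G0>> f g1 -> is_cond_exp P <<s G0>> f g2 ->
  (forall w, g1 w < +oo) -> {ae P, forall w, g2 w <= g1 w}.
Proof.
move=> Gm [mg1 g10 e1] [mg2 g20 e2] g1oo.
pose T' := g_sigma_algebraType G0.
have m1 : measurable_fun [set: T'] (g1 : T' -> \bar R).
  by move=> _ B mB; rewrite setTI; exact: mg1.
have m2 : measurable_fun [set: T'] (g2 : T' -> \bar R).
  by move=> _ B mB; rewrite setTI; exact: mg2.
have m1T : measurable_fun setT g1.
  by move=> _ B mB; rewrite setTI; apply: Gm; exact: mg1.
have m2T : measurable_fun setT g2.
  by move=> _ B mB; rewrite setTI; apply: Gm; exact: mg2.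
pose eps m : R := (m.+1%:R^-1)%R.
have eps0 m : (0 < eps m)%R by rewrite invr_gt0 ltr0n.
pose E m := [set w | g1 w + (eps m)%:E <= g2 w] `&` [set w | g1 w <= m%:R%:E].
have GE m : <<s G0>> (E m).
  have h1 : measurable ([set w | g1 w + (eps m)%:E <= g2 w] : set T').
    by rewrite -[X in measurable X]setTI; apply: measurable_lee => //;
      apply: emeasurable_funD.
  have h2 : measurable ([set w | g1 w <= m%:R%:E] : set T').
    by rewrite -[X in measurable X]setTI; apply: measurable_lee.
  exact: (measurableI _ _ h1 h2).
have PE m : P (E m) = 0.
  have mE : measurable (E m) := Gm _ (GE m).
  have int_eq := e1 _ (GE m); rewrite -(e2 _ (GE m)) in int_eq.
  have fin1 : \int[P]_(w in E m) g1 w < +oo.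
    apply: (@le_lt_trans _ _ (\int[P]_(w in E m) m%:R%:E)).
      apply: ge0_le_integral => //; first exact: measurable_funTS.
      by move=> w [].
    by rewrite integral_cst // lte_mul_pinfty ?lee_fin // ltey_eq fin_num_measure.
  have ge1 : \int[P]_(w in E m) g1 w + (eps m)%:E * P (E m)
      <= \int[P]_(w in E m) g2 w.
    rewrite -integral_cst // -ge0_integralD //; last 2 first.
    - exact: measurable_funTS.
    - by move=> w _; rewrite lee_fin ltW.
    apply: ge0_le_integral => //.
    - by move=> w _; rewrite adde_ge0 // lee_fin ltW.
    - by apply: emeasurable_funD => //; exact: measurable_funTS.
    - exact: measurable_funTS.
    - by move=> w [].
  rewrite -int_eq in ge1.
  have fin : \int[P]_(w in E m) g1 w \is a fin_num.
    by rewrite ge0_fin_numE //; apply: integral_ge0.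
  move: ge1; rewrite -leeBrDl // subee // => h.
  apply/eqP; rewrite eq_le measure_ge0 andbT.
  by rewrite -(lee_pmul2l (_ : (eps m)%:E \is a fin_num)) ?mule0 ?lte_fin.
have : P.-negligible (\bigcup_m E m).
  apply: negligible_bigcup => m; exists (E m); split => //; first exact: Gm (GE m).
  exact: PE.
move=> [N [mN PN sN]]; exists N; split=> // w /= /negP.
rewrite -ltNge => lt; apply: sN.
have g1f : g1 w \is a fin_num by rewrite ge0_fin_numE.
suff [m [h1 h2]] : exists m, g1 w + (eps m)%:E <= g2 w /\ g1 w <= m%:R%:E.
  by exists m.
rewrite -(fineK g1f) in lt *; set r := fine (g1 w) in lt *.
have archi (x : R) : (0 <= x)%R -> exists m, (x <= m%:R)%R.
  move=> x0; exists (Num.truncn x).+1; have /andP[_ h] := truncn_itv x0.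
  exact: ltW.
case: (g2 w) lt (g20 w) => [s lt s0|_ _|] //.
- rewrite lte_fin in lt; have rs : (0 < s - r)%R by rewrite subr_gt0.
  have [m hm] := archi (`|r| + (s - r)^-1)%R
    (addr_ge0 (normr_ge0 _) (ltW (etrans (invr_gt0 _) rs))).
  have rm : (r <= m%:R)%R.
    apply: le_trans hm; apply: le_trans (ler_norm r) _.
    by rewrite lerDl invr_ge0 ltW.
  exists m; split; last by rewrite lee_fin.
  rewrite -EFinD lee_fin -lerBrDl /eps -[leRHS]invrK lef_pV2 ?posrE ?invr_gt0 ?ltr0n //.
  have := hm; rewrite -natr1; have := normr_ge0 r; lra.
- have [m hm] := archi `|r|%R (normr_ge0 _).
  exists m; split; first by rewrite leey.
  by rewrite lee_fin (le_trans (ler_norm r)).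
Qed.

Variables (m n m' n' : nat) (X : T -> 'M[R]_(m, n)) (Y : T -> 'M[R]_(m', n')).
Hypotheses (mX : random_mx X) (mY : random_mx Y).
Hypothesis indep : indep_sigma P (sigma_mx X) (sigma_mx Y).
Variable f : 'M[R]_(m, n) * 'M[R]_(m', n') -> \bar R.
Hypotheses (mf : measurable_fun setT f) (f0 : forall u, 0 <= f u).

Let mX' : measurable_fun setT X. Proof. exact/random_mxP. Qed.
Let mY' : measurable_fun setT Y. Proof. exact/random_mxP. Qed.

Let indep' B C : measurable B -> measurable C ->
  P (X @^-1` B `&` Y @^-1` C) = P (X @^-1` B) * P (Y @^-1` C).
Proof.
move=> mB mC; apply: indep; rewrite /sigma_mx sigma_mxE.
  by exists B => //; rewrite setTI.
by exists C => //; rewrite setTI.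
Qed.

(** Freezing: [X] is kept and the independent [Y] integrated out. *)
Lemma is_cond_exp_indep :
  is_cond_exp P (sigma_mx X) (fun w => f (X w, Y w))
    (fun w => \int[P]_v f (X w, Y v)).
Proof.
have mphi := measurable_integral_snd P mY' mf f0.
split.
- move=> B mB; rewrite /sigma_mx sigma_mxE.
  exists ((fun x => \int[P]_v f (x, Y v)) @^-1` B); last by rewrite setTI.
  by rewrite -[X in measurable X]setTI; apply: mphi.
- by move=> w; apply: integral_ge0.
rewrite /sigma_mx sigma_mxE => _ [C mC <-]; rewrite setTI.
pose fC (u : 'M[R]_(m, n) * 'M[R]_(m', n')) := (\1_C u.1)%:E * f u.
have mfC : measurable_fun setT fC.
  apply: emeasurable_funM => //; apply/measurable_EFinP.
  exact: measurableT_comp (measurable_indic mC) measurable_fst.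
have fC0 u : 0 <= fC u by rewrite mule_ge0 // lee_fin.
have restr (h : T -> \bar R) : \int[P]_(w in X @^-1` C) h w =
    \int[P]_w ((\1_C (X w))%:E * h w).
  rewrite integral_mkcond; apply: eq_integral => w _.
  rewrite patchE indicE.
  have -> : (w \in X @^-1` C) = (X w \in C) by apply/idP/idP; rewrite !inE.
  by case: (X w \in C); rewrite ?mul1e ?mul0e.
rewrite !restr.
transitivity (\int[P]_w \int[P]_v fC (X w, Y v)); last first.
  by rewrite -(integral_indep mX' mY' indep' mfC fC0).
apply: eq_integral => w _; rewrite /fC /= ge0_integralZl //.
have mp : measurable_fun setT (fun v => (X w, Y v)) by exact: measurable_fun_pair.
exact: measurableT_comp mf mp.
Qed.

Lemma cond_exp_indep_le : (forall w, \int[P]_v f (X w, Y v) < +oo) ->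
  {ae P, forall w, cond_exp P (sigma_mx X) (fun w => f (X w, Y w)) w
     <= \int[P]_v f (X w, Y v)}.
Proof.
move=> fin.
have sub : sigma_mx X `<=` measurable.
  rewrite /sigma_mx sigma_mxE => _ [C mC <-].
  by rewrite setTI -[X in measurable X]setTI; apply: mX'.
apply: cond_exp_version_le fin; first exact: sub.
- exact: is_cond_exp_indep.
- rewrite /cond_exp; apply: xgetPex; eexists; exact: is_cond_exp_indep.
Qed.

End Conditioning.

(** * Choice of the constants *)

Section Constants.
Context {R : realType}.
Implicit Types (K L D r b lam zeta : R) (n t c : nat).

Lemma ln_ge_half n : (2 <= n)%N -> 2^-1 <= ln n%:R :> R.
Proof.
move=> n2; have n0 : 0 < n%:R :> R by rewrite ltr0n ltnW.
rewrite -ler_expR lnK ?posrE //; apply: (@le_trans _ _ 2); last by rewrite ler_nat.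
have : 1 - 2^-1 <= expR (- 2^-1) :> R by apply: expR_ge1Dx.
rewrite expRN (_ : 1 - 2^-1 = 2^-1 :> R); last by field.
by rewrite lef_pV2 ?posrE ?expR_gt0.
Qed.

Lemma expR_ln n (k : R) : (0 < n)%N -> expR (k * ln n%:R) = n%:R `^ k.
Proof. by move=> n0; rewrite /powR gt_eqF ?ltr0n. Qed.

(** The value of [lam] for which the tail [exp (- lam ^ 2 / 8)] is the power
    [- M] of [n]. *)
Definition level M n : R := Num.sqrt (8 * M * ln n%:R).

Lemma levelP M n : (2 <= n)%N -> 12 <= M ->
  [/\ 1 <= level M n, 96 * ln n%:R <= level M n ^+ 2,
      level M n <= 8 * M * ln n%:R
    & expR (- (level M n ^+ 2 / 8)) = n%:R `^ (- M)].
Proof.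
move=> n2 M12; have l := ln_ge_half n2.
have x0 : 48 <= 8 * M * ln n%:R.
  rewrite (_ : 48 = 8 * 12 * 2^-1); last by field.
  by rewrite ler_pM ?mulr_ge0 ?invr_ge0 // ler_wpM2l.
have sq : level M n ^+ 2 = 8 * M * ln n%:R by rewrite sqr_sqrtr //; lra.
have l1 : 1 <= level M n by rewrite -[leLHS]sqrtr1 ler_wsqrtr //; lra.
split=> //.
- by rewrite sq ler_wpM2r //; lra.
- by rewrite -sq expr2 ler_peMr // (le_trans ler01 l1).
- rewrite sq -expR_ln ?(ltnW n2) //; congr expR; by field.
Qed.

Lemma tail_power D n : (2 <= n)%N -> 0 < D ->
  8 * n%:R ^+ 2 * n%:R `^ (- (D + 12)) <= 152 * (D + 12) * n%:R `^ (- D).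
Proof.
move=> n2 D0; have n1 : 1 <= n%:R :> R by rewrite (ler_nat _ 1) ltnW.
have n0 : 0 < n%:R :> R := lt_le_trans ltr01 n1.
rewrite opprD powRD; last by rewrite (gt_eqF n0) implybT.
have -> : n%:R `^ (- 12) = n%:R ^- 12 :> R by rewrite (powR_invn 12) // ltW.
have h : n%:R ^+ 2 * n%:R ^- 12 <= 1 :> R.
  by rewrite ler_pdivrMr ?exprn_gt0 // mul1r ler_weXn2l.
have p0 : 0 <= n%:R `^ (- D) by exact: powR_ge0.
rewrite (_ : 8 * n%:R ^+ 2 * (n%:R `^ (- D) * n%:R ^- 12)
  = 8 * (n%:R ^+ 2 * n%:R ^- 12) * n%:R `^ (- D)); last by ring.
by rewrite ler_wpM2r //; lra.
Qed.

Lemma natr_exp2 m : m%:R <= 2 ^+ m :> R.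
Proof. by rewrite -natrX ler_nat ltnW // ltn_expl. Qed.

Lemma le_powR_nat b (x : R) m m' : 1 <= b -> x <= b ^+ m -> (m <= m')%N ->
  x <= b `^ m'%:R.
Proof.
move=> b1 xm mm; rewrite powR_mulrn ?(le_trans ler01) //.
by apply: le_trans xm _; rewrite ler_weXn2l.
Qed.

Definition base C K L n zeta : R := C * K * L * ln n%:R * zeta.

Lemma base_ge C K L n zeta : (2 <= n)%N -> 2 <= K -> 2 <= L -> 1 <= zeta ->
  0 <= C -> 2 * C <= base C K L n zeta.
Proof.
move=> n2 K2 L2 z1 C0; have l := ln_ge_half n2.
rewrite /base (_ : 2 * C = C * 2 * 2 * 2^-1 * 1); last by field.
by repeat (apply: ler_pM; rewrite ?mulr_ge0 ?invr_ge0 //).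
Qed.

Variables (K L zeta : R) (n t c : nat).
Hypotheses (n2 : (2 <= n)%N) (K2 : 2 <= K) (L2 : 2 <= L) (z1 : 1 <= zeta).
Hypotheses (t0 : (0 < t)%N) (c0 : (88 <= c)%N).

Let K0 : 0 <= K. Proof. exact: le_trans (ler0n _ 2) K2. Qed.
Let L0 : 0 <= L. Proof. exact: le_trans (ler0n _ 2) L2. Qed.
Let zeta0 : 0 <= zeta. Proof. exact: le_trans ler01 z1. Qed.
Let ln0 : 0 <= ln n%:R :> R.
Proof. by apply: le_trans (ln_ge_half n2); rewrite invr_ge0. Qed.

Let scaled_base lam M : lam <= M * ln n%:R ->
  19 * (lam * K * L) * zeta <= base (19 * M) K L n zeta.
Proof.
move=> lM; rewrite /base.
rewrite (_ : 19 * M * K * L * ln n%:R * zeta =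
  19 * (M * ln n%:R * K * L) * zeta); last by ring.
by rewrite ler_wpM2r // ler_wpM2l // ler_wpM2r // ler_wpM2r.
Qed.

(** The level for the tail estimate does not depend on [t], so an exponent of
    order [t ^ 2] is enough. *)
Lemma tail_exponent D : 0 < D ->
  (19 * (level (D + 12) n * K * L) * zeta) ^+ (c * t ^ 2) <=
  base (152 * (D + 12)) K L n zeta `^ ((c * (c + 3) + 1)%:R * t%:R ^+ 3).
Proof.
move=> D0; have [|l1 _ lM _] := @levelP (D + 12) n n2; first by lra.
have C0 : 0 <= 152 * (D + 12) by lra.
have b1 : 1 <= base (152 * (D + 12)) K L n zeta.
  by apply: le_trans (base_ge n2 K2 L2 z1 C0); lra.
rewrite -natrX -natrM; apply: (@le_powR_nat _ _ (c * t ^ 2)%N) => //.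
  have lam0 : 0 <= level (D + 12) n := le_trans ler01 l1.
  have b0 : 0 <= base (152 * (D + 12)) K L n zeta := le_trans ler01 b1.
  have X0 : 0 <= 19 * (level (D + 12) n * K * L) * zeta by rewrite !mulr_ge0.
  rewrite lerXn2r ?nnegrE //; apply: le_trans (scaled_base lM) _.
  by rewrite (_ : 19 * (8 * (D + 12)) = 152 * (D + 12)) //; ring.
apply: leq_mul; last by rewrite leq_pexp2l.
by rewrite -[leqLHS]muln1 (leq_trans _ (leq_addr _ _)) // leq_mul // addn3.
Qed.

Let N := (c * t ^ 2)%N.

Let N_ge : (88 * t <= N)%N.
Proof. by rewrite leq_mul // -[leqLHS]expn1 leq_pexp2l. Qed.

(** The level for the moments grows with [N], of order [t ^ 2]. Bounding this
    factor by an exponential in [t] turns the power [N] into an exponent of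
    order [t ^ 3]. *)
Lemma moment_exponent r : 1 <= r ->
  4 * (19 * (level (20 * N%:R * r) n * K * L) * zeta) ^+ N <=
  base (3040 * r) K L n zeta `^ ((c * (c + 3) + 1)%:R * t%:R ^+ 3).
Proof.
move=> r1.
have N1 : 1 <= N%:R :> R by rewrite (ler_nat _ 1) (leq_trans _ N_ge) // muln_gt0.
have [|l1 _ lM _] := @levelP (20 * N%:R * r) n n2.
  by have : 1 <= N%:R * r by [rewrite mulr_ege1]; rewrite -mulrA; lra.
have C0 : 0 <= 3040 * r by lra.
set b := base (3040 * r) K L n zeta.
have b4 : 4 <= b by apply: le_trans (base_ge n2 K2 L2 z1 C0); lra.
have b1 : 1 <= b by lra.
have b0 : 0 <= b by lra.
have Nb : N%:R <= b ^+ (c + t).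
  rewrite /N natrM natrX exprD; apply: ler_pM; rewrite ?exprn_ge0 //.
    apply: le_trans (natr_exp2 c) _; rewrite lerXn2r ?nnegrE //; lra.
  apply: (@le_trans _ _ (2 ^+ t ^+ 2)).
    by rewrite lerXn2r ?nnegrE ?exprn_ge0 ?natr_exp2.
  rewrite -exprM mulnC exprM lerXn2r ?nnegrE ?exprn_ge0 //.
  by rewrite (_ : 2 ^+ 2 = 4 :> R) // expr2; lra.
rewrite -[t%:R ^+ 3]natrX -[X in _ `^ X]natrM.
apply: (@le_powR_nat _ _ (1 + (c + t + 1) * N)%N); first exact: b1.
  rewrite exprD expr1; apply: ler_pM => //.
    by rewrite exprn_ge0 // !mulr_ge0 ?(le_trans ler01 l1).
  rewrite exprM lerXn2r ?nnegrE ?exprn_ge0 //.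
    by rewrite !mulr_ge0 ?(le_trans ler01 l1).
  apply: le_trans (scaled_base lM) _.
  rewrite exprD expr1 (_ : base _ _ _ _ _ = N%:R * b).
    by rewrite ler_wpM2r.
  by rewrite /b /base; ring.
rewrite /N; move: t0 c0; clear; case: t => // u _ c88.
rewrite !expnS expn0 !muln1; nia.
Qed.

(** The crude bound exceeds the bound at the level by at most the power [N]
    of [n]; the moment of order [r] of this factor is [n `^ (N * r)], while the
    level is chosen so that the tail is [n `^ (- (20 * N * r))]. *)
Lemma crude_tail r (e : R) (lam := level (20 * N%:R * r) n) :
  1 <= r -> 0 <= e ->
  8 * n%:R ^+ 2 * 4 ^+ t * expR (- (lam ^+ 2 / 8)) *
    (e * (19 * (Num.sqrt n%:R * K * L) * zeta) ^+ N) `^ r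
  <= (e * (19 * (lam * K * L) * zeta) ^+ N) `^ r.
Proof.
move=> r1 e0; have r0 : 0 <= r := le_trans ler01 r1.
have N1 : 1 <= N%:R :> R by rewrite (ler_nat _ 1) (leq_trans _ N_ge) // muln_gt0.
have [|l1 _ lM ->] := @levelP (20 * N%:R * r) n n2.
  by have : 1 <= N%:R * r by [rewrite mulr_ege1]; rewrite -mulrA; lra.
rewrite -/lam in l1 lM.
have nn : 1 <= n%:R :> R by rewrite (ler_nat _ 1) ltnW.
have n0 : 0 <= n%:R :> R := le_trans ler01 nn.
have lam0 : 0 <= lam := le_trans ler01 l1.
have s0 : 0 <= Num.sqrt n%:R :> R := sqrtr_ge0 _.
have sn : Num.sqrt n%:R <= n%:R :> R.
  rewrite -[leRHS](sqr_sqrtr n0) expr2 ler_peMr //.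
  by rewrite -[leLHS]sqrtr1 ler_wsqrtr.
have crude : 19 * (Num.sqrt n%:R * K * L) * zeta <= n%:R * (19 * (lam * K * L) * zeta).
  rewrite (_ : n%:R * _ = 19 * (n%:R * lam * K * L) * zeta); last by ring.
  rewrite ler_wpM2r // ler_wpM2l // ler_wpM2r // ler_wpM2r //.
  by rewrite (le_trans sn) // ler_peMr.
set X := 19 * (lam * K * L) * zeta in crude *.
have X0 : 0 <= X by rewrite /X !mulr_ge0.
set Y := 19 * (Num.sqrt n%:R * K * L) * zeta in crude *.
have Y0 : 0 <= Y by rewrite /Y !mulr_ge0.
have XN : 0 <= X ^+ N := exprn_ge0 N X0.
have YX : (e * Y ^+ N) `^ r <= n%:R `^ (N%:R * r) * (e * X ^+ N) `^ r.
  rewrite powRrM powR_mulrn // -powRM ?exprn_ge0 ?mulr_ge0 //.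
  rewrite ge0_ler_powR ?nnegrE ?mulr_ge0 ?exprn_ge0 //.
  rewrite (_ : n%:R ^+ N * (e * X ^+ N) = e * (n%:R * X) ^+ N).
    by rewrite ler_wpM2l // lerXn2r ?nnegrE ?mulr_ge0.
  by rewrite (exprMn N n%:R X) mulrCA.
have count : 8 * n%:R ^+ 2 * 4 ^+ t <= n%:R `^ (5 + 2 * t%:R) :> R.
  rewrite (_ : 5 + 2 * t%:R = (5 + 2 * t)%:R :> R); last by rewrite natrD natrM.
  rewrite powR_mulrn // exprD (exprD _ 3 2) exprM.
  apply: ler_pM; rewrite ?mulr_ge0 ?exprn_ge0 //.
    rewrite ler_wpM2r ?exprn_ge0 // -[8]/(8%:R) (_ : 8%N = 2 ^ 3)%N // natrX.
    by rewrite lerXn2r ?nnegrE // ler_nat.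
  rewrite lerXn2r ?nnegrE ?exprn_ge0 // -[4]/(4%:R) (_ : 4%N = 2 ^ 2)%N // natrX.
  by rewrite lerXn2r ?nnegrE // ler_nat.
have p0 a : 0 <= n%:R `^ a :> R := powR_ge0 _ _.
apply: (@le_trans _ _ (n%:R `^ (5 + 2 * t%:R) * n%:R `^ (- (20 * N%:R * r)) *
    (n%:R `^ (N%:R * r) * (e * X ^+ N) `^ r))).
  by apply: ler_pM; rewrite ?mulr_ge0 ?exprn_ge0 ?powR_ge0 // ler_wpM2r.
rewrite mulrA -!powRD; try by rewrite (gt_eqF (lt_le_trans ltr01 nn)) implybT.
rewrite -[leRHS]mul1r ler_wpM2r ?powR_ge0 //.
rewrite -[leRHS](powRr0 n%:R) ler_powR //.
have Nt : 88 * t%:R <= N%:R :> R by rewrite -natrM ler_nat.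
have t1 : 1 <= t%:R :> R by rewrite (ler_nat _ 1).
have Nr : N%:R <= N%:R * r :> R by rewrite ler_peMr.
rewrite -mulrA; lra.
Qed.

End Constants.


(** * From the good event to the two estimates *)

Section WeightedMax.
Context {R : realType} {n : nat}.
Implicit Types (i j k : 'I_n) (om : R).

(** The factor [sqrt n] on the indices outside [i] and [j] is compensated
    there. *)
Lemma weighted_max_le i j om (x : 'I_n -> \bar R) : 0 <= om ->
  (forall k, (x k <= (om * (if (k == i) || (k == j) then 1
                            else (Num.sqrt n%:R)^-1))%:E)%E) ->
  (weighted_max i j x <= (2 * om)%:E)%E.
Proof.
move=> om0 xle; have n0 : (0 < n)%N by apply: leq_trans (ltn_ord i).
have s1 : 1 <= Num.sqrt n%:R :> R.
  by rewrite -[leLHS]sqrtr1 ler_wsqrtr // (ler_nat _ 1).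
have s0 : 0 < Num.sqrt n%:R :> R := lt_le_trans ltr01 s1.
rewrite /weighted_max mulrDl mul1r EFinD; apply: leeD.
  apply: (@le_trans _ _ ((Num.sqrt n%:R)%:E * (om / Num.sqrt n%:R)%:E)%E).
    rewrite lee_wpmul2l ?lee_fin ?(ltW s0) //; apply: bigmax_le.
      by rewrite lee_fin divr_ge0 // ltW.
    move=> k /andP[/negPf ki /negPf kj].
    by have := xle k; rewrite ki kj.
  by rewrite -EFinM lee_fin mulrCA divff ?mulr1 // gt_eqF.
apply: bigmax_le; first by rewrite lee_fin.
move=> k _; apply: le_trans (xle k) _; rewrite lee_fin -[leRHS]mulr1.
by rewrite ler_wpM2l //; case: ifP => // _; rewrite invf_le1.
Qed.

Lemma sup_norm_ge0 (z : 'cV[R]_n) : 0 <= sup_norm z.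
Proof. by rewrite /sup_norm; apply: bigmax_ge_id. Qed.

Lemma entry_le_sup_norm (z : 'cV[R]_n) l : `|z l 0| <= sup_norm z.
Proof. exact: (le_bigmax _ (fun l => `|z l 0|)). Qed.

Lemma measurable_bigmaxe {d} {T : measurableType d} (Q : pred 'I_n)
    (x : 'I_n -> T -> \bar R) : (forall k, measurable_fun setT (x k)) ->
  measurable_fun setT (fun w => \big[maxe/0%E]_(k < n | Q k) x k w).
Proof.
move=> mx; elim: index_enum => [|k s IH].
  by under eq_fun do rewrite big_nil; exact: measurable_cst.
under eq_fun do rewrite big_cons.
by case: (Q k) => //; apply: measurable_maxe.
Qed.

Lemma measurable_weighted_max {d} {T : measurableType d} i j
    (x : 'I_n -> T -> \bar R) : (forall k, measurable_fun setT (x k)) ->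
  measurable_fun setT (fun w => weighted_max i j (x ^~ w)).
Proof.
move=> mx; rewrite /weighted_max.
apply: emeasurable_funD; last exact: measurable_bigmaxe.
by apply: emeasurable_funM => //; exact: measurable_bigmaxe.
Qed.

Lemma measurable_sup_norm {d} {T : measurableType d} (z : T -> 'cV[R]_n) :
  random_mx z -> measurable_fun setT (fun w => sup_norm (z w)).
Proof.
move=> mz; rewrite /sup_norm; elim: index_enum => [|k s IH].
  by under eq_fun do rewrite big_nil; exact: measurable_cst.
under eq_fun do rewrite big_cons; apply: measurable_maxr => //.
exact: measurableT_comp.
Qed.

End WeightedMax.


Section Estimates.
Context {d : measure_display} {T : measurableType d} {R : realType}.
Variables (P : probability T R) (n t : nat) (A0 : T -> 'M[R]_n).
Variables (F G : nat -> 'I_n -> R -> R) (K L : R) (p : nat).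
Hypotheses (n_ge2 : (2 <= n)%N) (A0_meas : random_mx A0).
Hypothesis A0_sym : forall w, (A0 w)^T = A0 w.
Hypothesis A0_indep :
  mutually_indep P [set u : 'I_n * 'I_n | (u.1 <= u.2)%N]%SET
    (fun u w => A0 w u.1 u.2).
Hypothesis A0_mean : forall i j : 'I_n, (i <= j)%N ->
  ('E_P[fun w => A0 w i j] = 0)%E.
Hypothesis K_ge2 : 2 <= K.
Hypothesis A0_le : {ae P, forall w, forall i j, `|A0 w i j| <= K}.
Hypothesis L_ge2 : 2 <= L.
Hypothesis FG_class : forall s l, (1 <= s <= t)%N ->
  [/\ class_C 3 (F s l), class_C 3 (G s l),
      (smooth_norm p (F s l) <= L%:E)%E
    & (smooth_norm p (G s l) <= L%:E)%E].

Let c := (8 * (p + 11))%N.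
Let c_ge : (88 <= c)%N. Proof. by rewrite /c; lia. Qed.
Let c1 : R := (c * (c + 3) + 1)%:R.
Let zeta (z : 'cV[R]_n) := 1 + sup_norm z.
Let zeta_ge1 z : 1 <= zeta z.
Proof. by rewrite /zeta lerDl sup_norm_ge0. Qed.
Let zeta0 z : 0 <= zeta z. Proof. exact: le_trans ler01 (zeta_ge1 z). Qed.
Let n_gt0 : (0 < n)%N. Proof. exact: ltnW. Qed.
Let K0 : 0 <= K. Proof. exact: le_trans (ler0n _ 2) K_ge2. Qed.
Let L0 : 0 <= L. Proof. exact: le_trans (ler0n _ 2) L_ge2. Qed.

Let FG_smooth s l : (s < t)%N -> smooth2 (F s.+1 l) /\ smooth2 (G s.+1 l).
Proof. by move=> st; have [] := @FG_class s.+1 l st; split; exact: class_C_smooth2. Qed.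

Let growth lam z : R := (19 * (lam * K * L) * zeta z) ^+ (c * t ^ 2).

Let growth_ge0 lam z : 0 <= lam -> 0 <= growth lam z.
Proof. by move=> lam0; rewrite /growth exprn_ge0 // !mulr_ge0. Qed.

Let reg lam : 1 <= lam -> regime F G K L lam p t.
Proof.
by move=> l1; split=> // s l st; have [] := @FG_class s.+1 l st => *;
  exact: smooth_norm_tame.
Qed.

Let scale (i j k : 'I_n) : R :=
  if (k == i) || (k == j) then 1 else (Num.sqrt n%:R)^-1.

Let scale_ge0 i j k : 0 <= scale i j k.
Proof. by rewrite /scale; case: ifP => // _; rewrite invr_ge0 sqrtr_ge0. Qed.

Let deriv_le lam z M i j k : (0 < t)%N -> 1 <= lam ->
  good_matrix F G z K lam t M ->
  `|dstate F G z i j M t k 0| <= growth lam z / 3 * scale i j k /\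
  `|d2state F G z i j M t k 0| <= growth lam z / 3 * scale i j k.
Proof.
move=> t0 l1 good; have z_le l : 1 + `|z l 0| <= zeta z.
  by rewrite /zeta lerD2l entry_le_sup_norm.
have [d1 d2] := derivative_bound (reg l1) good (zeta_ge1 z) z_le t0 i j.
by split; [apply: d1 | apply: d2].
Qed.

Let random_fst : random_mx (fst : 'cV[R]_n * 'M[R]_n -> _).
Proof. by apply/random_mxP. Qed.
Let random_snd : random_mx (snd : 'cV[R]_n * 'M[R]_n -> _).
Proof. by apply/random_mxP. Qed.

Section Tail.
Variables (D : R) (i j : 'I_n).
Hypothesis D0 : 0 < D.

Let threshold z : R := base (152 * (D + 12)) K L n (zeta z) `^ (c1 * t%:R ^+ 3).
Let largest z M : \bar R := weighted_max i j (fun k =>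
  (Num.max `|dstate F G z i j M t k 0| `|d2state F G z i j M t k 0|)%:E).

Definition excess : set ('cV[R]_n * 'M[R]_n) :=
  [set u | ((threshold u.1)%:E <= largest u.1 u.2)%E].

Lemma measurable_excess : measurable excess.
Proof.
rewrite -[excess]setTI; apply: measurable_lee => //.
  apply/measurable_EFinP; apply: (measurableT_comp (measurable_powR _)).
  apply: measurable_funM => //; apply: measurable_funD => //.
  exact: measurable_sup_norm.
apply: measurable_weighted_max => k; apply/measurable_EFinP.
apply: measurable_maxr; apply: measurableT_comp => //.
  exact: (random_dstate FG_smooth random_snd random_fst).
exact: (random_d2state FG_smooth random_snd random_fst).
Qed.

(** On the good event the weighted maximum is below the threshold. *)
Lemma excess_prob z :
  (P [set w | excess (z, scaled A0 w)] <=
   (4 ^+ t * (152 * (D + 12) * n%:R `^ (- D)))%:E)%E.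
Proof.
have [|l1 lln _ tail] := @levelP _ (D + 12) n n_ge2.
  by rewrite lerDr ltW.
set lam := level (D + 12) n in l1 lln tail.
have [Bad [mBad PBad good]] := good_event A0_meas A0_sym A0_indep A0_mean K_ge2
  A0_le n_ge2 l1 lln z FG_smooth.
have m_ex : measurable [set w | excess (z, scaled A0 w)].
  rewrite -[X in measurable X]setTI.
  have m : measurable_fun setT (fun w => (z, scaled A0 w)).
    apply: measurable_fun_pair; first exact: measurable_cst.
    by apply/random_mxP; exact: random_scaled.
  exact: (m measurableT _ measurable_excess).
apply: (@le_trans _ _ (P Bad)); last first.
  apply: le_trans PBad _; rewrite lee_fin tail.
  rewrite (_ : 8 * _ * _ * _ = 4 ^+ t * (8 * n%:R ^+ 2 * n%:R `^ (- (D + 12)))).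
    by rewrite ler_wpM2l ?exprn_ge0 // tail_power.
  by ring.
apply: le_measure; rewrite ?inE //.
move=> w ex; apply: contrapT => /good[{}good _].
move: ex; rewrite /excess /=; apply/negP; rewrite -ltNge.
have [t0|t0] := posnP t.
  apply: (@le_lt_trans _ _ (2 * 0)%:E).
    apply: weighted_max_le => // k; rewrite mul0r lee_fin.
    by rewrite t0 !mxE normr0 maxxx.
  by rewrite mulr0 lte_fin /threshold t0 expr0n mulr0 powRr0.
have g0 : 0 <= growth lam z / 3.
  by rewrite divr_ge0 // growth_ge0 // (le_trans ler01 l1).
have g1 : 0 < growth lam z.
  rewrite exprn_gt0 // !mulr_gt0 //.
  - exact: lt_le_trans ltr01 l1.
  - exact: lt_le_trans (ltr0Sn _ 1) K_ge2.
  - exact: lt_le_trans (ltr0Sn _ 1) L_ge2.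
  - exact: lt_le_trans ltr01 (zeta_ge1 z).
apply: (@le_lt_trans _ _ (2 * (growth lam z / 3))%:E).
  apply: weighted_max_le => // k; rewrite lee_fin ge_max.
  by have [-> ->] := deriv_le i j k t0 l1 good.
rewrite lte_fin; apply: (@lt_le_trans _ _ (growth lam z)).
  by move: g1; set x := growth lam z; lra.
exact: (tail_exponent c n_ge2 K_ge2 L_ge2 (zeta_ge1 z) t0 D0).
Qed.

End Tail.

Section Moment.
Variables (r : R) (i j : 'I_n).
Hypotheses (r_ge1 : 1 <= r) (t_gt0 : (0 < t)%N).
Let lam := level (20 * (c * t ^ 2)%:R * r) n.
Let r0 : 0 <= r. Proof. exact: le_trans ler01 r_ge1. Qed.

(** The moment is split along the good event: there the derivative is bounded
    by the tail level, and elsewhere by the crude level [sqrt n], whose large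
    value is paid for by the small probability. *)
Lemma moment_le z k :
  (\int[P]_w (`|dstate F G z i j (scaled A0 w) t k 0| `^ r)%:E <=
   ((2 * (scale i j k * growth lam z)) `^ r)%:E)%E.
Proof.
have M12 : 12 <= 20 * (c * t ^ 2)%:R * r.
  have : 1 <= (c * t ^ 2)%:R * r.
    rewrite mulr_ege1 // (ler_nat _ 1) muln_gt0 expn_gt0 t_gt0 andbT.
    exact: leq_trans c_ge.
  by rewrite -mulrA; set x := _ * r => x1; lra.
have [l1 lln _ _] := levelP n_ge2 M12; rewrite -/lam in l1 lln.
have lam0 : 0 <= lam := le_trans ler01 l1.
have [Bad [mBad PBad good]] := good_event A0_meas A0_sym A0_indep A0_mean K_ge2
  A0_le n_ge2 l1 lln z FG_smooth.
pose s := Num.sqrt n%:R : R.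
have s1 : 1 <= s by rewrite /s -[leLHS]sqrtr1 ler_wsqrtr // (ler_nat _ 1).
have s0 : 0 <= s := le_trans ler01 s1.
set e := scale i j k; have e0 : 0 <= e := scale_ge0 i j k.
have drop3 x (X : R) : 0 <= X -> x <= X / 3 * e -> x <= e * X.
  move=> X0 /le_trans; apply; rewrite mulrC ler_wpM2l //.
  by rewrite ler_pdivrMr // ler_peMr // (ler_nat _ 1).
pose a : R := (e * growth lam z) `^ r; pose b : R := (e * growth s z) `^ r.
have a0 : 0 <= a := powR_ge0 _ _.
have b0 : 0 <= b := powR_ge0 _ _.
have mBadE : measurable_fun setT (fun w => (b * \1_Bad w)%:E).
  apply/measurable_EFinP; apply: measurable_funM => //.
have dom : {ae P, forall w, setT w ->
    ((`|dstate F G z i j (scaled A0 w) t k 0| `^ r)%:E <=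
     a%:E + (b * \1_Bad w)%:E)%E}.
  apply: filterS A0_le => w A0w _; rewrite -EFinD lee_fin.
  have [wBad|wBad] := pselect (Bad w).
    rewrite indicE mem_set // mulr1; apply: (@le_trans _ _ b).
      rewrite /b ge0_ler_powR ?nnegrE ?mulr_ge0 ?growth_ge0 //.
      apply: drop3; first exact: growth_ge0.
      have crude : good_matrix F G z K s t (scaled A0 w).
        apply: good_matrix_crude => // l m.
        by rewrite /scaled mxE normrM ger0_norm ?invr_ge0 // [leRHS]mulrC ler_wpM2l ?invr_ge0.
      by have [] := deriv_le i j k t_gt0 s1 crude.
    by rewrite lerDr.
  rewrite indicE memNset // mulr0 addr0.
  rewrite /a ge0_ler_powR ?nnegrE ?mulr_ge0 ?growth_ge0 //.
  apply: drop3; first exact: growth_ge0.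
  by have [] := deriv_le i j k t_gt0 l1 (good w wBad).1.
have md : measurable_fun setT
    (fun w => (`|dstate F G z i j (scaled A0 w) t k 0| `^ r)%:E).
  apply/measurable_EFinP; apply: (measurableT_comp (measurable_powR _)).
  apply: measurableT_comp => //.
  exact: (random_dstate FG_smooth (random_scaled A0_meas) (random_cst z)).
apply: le_trans (ae_ge0_le_integral measurableT _ md _ _ dom) _.
- by move=> w _; rewrite lee_fin powR_ge0.
- by move=> w _; rewrite -EFinD lee_fin addr_ge0 ?mulr_ge0.
- exact: emeasurable_funD.
rewrite ge0_integralD //; last first.
  by move=> w _; rewrite lee_fin mulr_ge0.
rewrite integral_cst // [X in (_ * X)%E](@probability_setT _ _ _ P) mule1.
under eq_integral do rewrite EFinM.
rewrite ge0_integralZl_EFin //; last by apply/measurable_EFinP.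
rewrite integral_indic // setIT.
apply: (@le_trans _ _ (a%:E + a%:E)%E).
  rewrite leeD2l //; apply: (@le_trans _ _ (b%:E *
     (8 * n%:R ^+ 2 * 4 ^+ t * expR (- (lam ^+ 2 / 8)))%:E)%E).
    by rewrite lee_wpmul2l.
  rewrite -EFinM lee_fin mulrC.
  exact: (crude_tail n_ge2 K_ge2 L_ge2 (zeta_ge1 z) t_gt0 c_ge r_ge1 e0).
rewrite -EFinD lee_fin powRM ?mulr_ge0 ?growth_ge0 // -/a.
rewrite (_ : a + a = 2 * a); last by ring.
by rewrite ler_wpM2r // -[leLHS]powRr1 // ler_powR // (ler_nat _ 1).
Qed.

End Moment.
Variable z0 : T -> 'cV[R]_n.
Hypotheses (z0_meas : random_mx z0)
  (indep : indep_sigma P (sigma_mx z0) (sigma_mx (scaled A0))).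

Lemma cond_tail_le (D : R) (i j : 'I_n) : 0 < D ->
  {ae P, forall w,
    (cond_prob P (sigma_mx z0)
      [set v | (((152 * (D + 12)) * K * L * ln n%:R * (1 + sup_norm (z0 v)))
                   `^ (c1 * t%:R ^+ 3))%:E
        <= weighted_max i j (fun k =>
             (Num.max `|dz F G (z0 v) t i j k (scaled A0 v)|
                      `|d2z F G (z0 v) t i j k (scaled A0 v)|)%:E)]%E w
     <= (4 ^+ t * (152 * (D + 12) * n%:R `^ (- D)))%:E)%E}.
Proof.
move=> D0; pose f u : \bar R := (\1_(excess D i j) u)%:E.
have mf : measurable_fun setT f.
  by apply/measurable_EFinP; apply: measurable_indic; apply: measurable_excess.
have intf w : (\int[P]_v f (z0 w, scaled A0 v) =
    P [set v | excess D i j (z0 w, scaled A0 v)])%E.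
  have m : measurable_fun setT (fun v => (z0 w, scaled A0 v)).
    apply: measurable_fun_pair; first exact: measurable_cst.
    by apply/random_mxP; exact: random_scaled.
  rewrite -[X in _ = P X]setIT -integral_indic //; last first.
    rewrite -[X in measurable X]setTI; apply: m => //; exact: measurable_excess.
have fin w : (\int[P]_v f (z0 w, scaled A0 v) < +oo)%E.
  by rewrite intf; apply: le_lt_trans (excess_prob i j D0 (z0 w)) (ltry _).
have f0 u : (0 <= f u)%E by rewrite lee_fin.
have ae_le := cond_exp_indep_le z0_meas (random_scaled A0_meas) indep mf f0 fin.
rewrite /cond_prob (_ : (fun v => _) = fun v => f (z0 v, scaled A0 v)).
  apply: filterS ae_le => w /le_trans; apply; rewrite intf.
  exact: excess_prob.
apply/funext => v; rewrite /f !indicE; congr (_%:R%:E).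
have derivE : (fun k => (Num.max `|dz F G (z0 v) t i j k (scaled A0 v)|
      `|d2z F G (z0 v) t i j k (scaled A0 v)|)%:E) =
    fun k => (Num.max `|dstate F G (z0 v) i j (scaled A0 v) t k 0|
      `|d2state F G (z0 v) i j (scaled A0 v) t k 0|)%:E.
  by apply/funext => k; rewrite (dzE _ _ _ FG_smooth) (d2zE _ _ _ FG_smooth).
by congr (nat_of_bool _); apply/idP/idP; rewrite !inE /excess /base /= derivE.
Qed.

Lemma cond_moment_le (r : R) (i j : 'I_n) : 1 <= r ->
  {ae P, forall w,
    (weighted_max i j (fun k =>
       cond_exp P (sigma_mx z0)
         (fun v => (`|dz F G (z0 v) t i j k (scaled A0 v)| `^ r)%:E) w
         `^ r^-1)
     <= (((3040 * r) * K * L * ln n%:R * (1 + sup_norm (z0 w)))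
            `^ (c1 * t%:R ^+ 3))%:E)%E}.
Proof.
move=> r1; have r0 : 0 < r := lt_le_trans ltr01 r1.
pose h k (u : 'cV[R]_n * 'M[R]_n) : \bar R :=
  (`|dstate F G u.1 i j u.2 t k 0| `^ r)%:E.
have mh k : measurable_fun setT (h k).
  apply/measurable_EFinP; apply: (measurableT_comp (measurable_powR _)).
  apply: measurableT_comp => //.
  exact: (random_dstate FG_smooth random_snd random_fst).
have h0 k u : (0 <= h k u)%E by rewrite lee_fin powR_ge0.
pose X z : R := if t is 0 then 0
  else 2 * growth (level (20 * (c * t ^ 2)%:R * r) n) z.
have X0 z : 0 <= X z.
  by rewrite /X; case: (t) => // u; rewrite mulr_ge0 // growth_ge0 // sqrtr_ge0.
have int_le k z : (\int[P]_v h k (z, scaled A0 v) <=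
    ((X z * scale i j k) `^ r)%:E)%E.
  have [t0|t0] := posnP t.
    rewrite (eq_integral (cst 0%E)) ?integral0 ?lee_fin ?powR_ge0 // => v _.
    by rewrite /h t0 !mxE normr0 powR0 // gt_eqF.
  apply: le_trans (moment_le i j r1 t0 z k) _.
  by rewrite lee_fin /X mulrCA mulrC -(prednK t0).
have fin k w : (\int[P]_v h k (z0 w, scaled A0 v) < +oo)%E.
  exact: le_lt_trans (int_le _ _) (ltry _).
have ae_le : {ae P, forall w, forall k,
   (cond_exp P (sigma_mx z0) (fun v => h k (z0 v, scaled A0 v)) w <=
     ((X (z0 w) * scale i j k) `^ r)%:E)%E}.
  apply: filter_forall => k.
  have := cond_exp_indep_le z0_meas (random_scaled A0_meas) indep (mh k) (h0 k) (fin k).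
  by apply: filterS => w /le_trans; apply; exact: int_le.
apply: filterS ae_le => w ae_le.
apply: (@le_trans _ _ (2 * X (z0 w))%:E); last first.
  rewrite lee_fin /X; have [t0|t0] := posnP t.
    by rewrite t0 mulr0 powR_ge0.
  rewrite -{1}(prednK t0) mulrA (_ : 2 * 2 = 4); last by ring.
  exact: (moment_exponent n_ge2 K_ge2 L_ge2 (zeta_ge1 (z0 w)) t0 c_ge r1).
apply: weighted_max_le => // k.
have -> : (fun v => (`|dz F G (z0 v) t i j k (scaled A0 v)| `^ r)%:E) =
    fun v => h k (z0 v, scaled A0 v).
  by apply/funext => v; rewrite (dzE _ _ _ FG_smooth).
have Xs : 0 <= X (z0 w) * scale i j k by rewrite mulr_ge0.
have -> : X (z0 w) * (if (k == i) || (k == j) then 1 else (Num.sqrt n%:R)^-1) =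
    ((X (z0 w) * scale i j k) `^ r) `^ r^-1.
  by rewrite -powRrM divff ?(gt_eqF r0) //; rewrite (powRr1 Xs).
rewrite -poweR_EFin; apply: gt0_ler_poweR (ae_le k).
- by rewrite invr_ge0 ltW.
- rewrite in_itv /= leey andbT /cond_exp; case: xgetP => [g _ [_ g0 _]|_].
    exact: g0.
  exact: leey.
- by rewrite in_itv /= leey andbT lee_fin powR_ge0.
Qed.

End Estimates.

Theorem proposition6p3 (R : realType) :
  exists (c0 : R) (c1 : nat -> R) (C0 Cp : R -> R),
  [/\ 0 < c0, forall pp : nat, 0 < c1 pp,
      forall D : R, 0 < D -> 0 < C0 D & forall p : R, 1 <= p -> 0 < Cp p] /\
  forall (d : measure_display) (T : measurableType d) (P : probability T R)
    (n t : nat) (A0 A : T -> 'M[R]_n) (z0 : T -> 'cV[R]_n)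
    (F G : nat -> 'I_n -> R -> R) (K L : R) (pp : nat),
  (2 <= n)%N ->
  (forall w, A w = (Num.sqrt n%:R)^-1 *: A0 w) ->
  random_mx A0 ->
  (forall w, (A0 w)^T = A0 w) ->
  mutually_indep P [set u : 'I_n * 'I_n | (u.1 <= u.2)%N]%SET
    (fun u w => A0 w u.1 u.2) ->
  (forall i j : 'I_n, (i <= j)%N -> ('E_P[fun w => A0 w i j] = 0)%E) ->
  2 <= K ->
  {ae P, forall w, forall i j, `|A0 w i j| <= K} ->
  random_mx z0 ->
  indep_sigma P (sigma_mx z0) (sigma_mx A) ->
  2 <= L ->
  (forall s l, (1 <= s <= t)%N ->
    [/\ class_C 3 (F s l), class_C 3 (G s l),
        (smooth_norm pp (F s l) <= L%:E)%E
      & (smooth_norm pp (G s l) <= L%:E)%E]) ->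
  (forall D : R, 0 < D -> t%:R <= c0^-1 * ln n%:R ->
    forall i j : 'I_n,
    {ae P, forall w,
      (cond_prob P (sigma_mx z0)
        [set v | (((C0 D * K * L * ln n%:R * (1 + sup_norm (z0 v)))
                     `^ (c1 pp * t%:R ^+ 3))%R%:E
                  <= weighted_max i j (fun k =>
                       (Num.max `|dz F G (z0 v) t i j k (A v)|
                                `|d2z F G (z0 v) t i j k (A v)|)%R%:E))%E] w
       <= (c0 ^+ t * (C0 D * n%:R `^ (- D)))%:E)%E}) /\
  (forall p : R, 1 <= p ->
    forall i j : 'I_n,
    {ae P, forall w,
      (weighted_max i j (fun k =>
         cond_exp P (sigma_mx z0)
           (fun v => (`|dz F G (z0 v) t i j k (A v)| `^ p)%R%:E) w `^ p^-1)
       <= ((Cp p * K * L * ln n%:R * (1 + sup_norm (z0 w)))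
             `^ (c1 pp * t%:R ^+ 3))%R%:E)%E}).
Proof.
exists 4, (fun p => (8 * (p + 11) * (8 * (p + 11) + 3) + 1)%:R).
exists (fun D => 152 * (D + 12)), (fun r => 3040 * r).
split.
  split=> [|p|D D0|r r1]; first exact: ltr0Sn _ 3.
  - by rewrite addn1; exact: ltr0Sn.
  - apply: mulr_gt0; first by rewrite ltr0n.
    by apply: addr_gt0 => //; rewrite ltr0n.
  - apply: mulr_gt0; first by rewrite ltr0n.
    exact: lt_le_trans ltr01 r1.
move=> d T P n t A0 A z0 F G K L p n2 AE A0_meas A0_sym A0_indep A0_mean K2
  A0_le z0_meas indep L2 FG_class.
have {}AE : A = scaled A0 by apply/funext.
subst A.
split=> [D D0 _ i j | r r1 i j].
  exact: (cond_tail_le n2 A0_meas A0_sym A0_indep A0_mean K2 A0_le L2 FG_class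
    z0_meas indep i j D0).
exact: (cond_moment_le n2 A0_meas A0_sym A0_indep A0_mean K2 A0_le L2 FG_class
    z0_meas indep i j r1).
Qed.
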